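(* Let $A\in\mathbb{R}^{n\times n}$ be a symmetric matrix with singular values $\sigma_1\ge\sigma_2\ge\dots\ge\sigma_n$, let $\mu\in\mathbb{R}$ and $A_\mu=A+\mu I$. Let $k$ be an integer with $l=2k+2\ge 8$, and draw a Gaussian matrix $X\in\mathbb{R}^{l\times n}$. Let $q\ge1$ be an integer, define the test matrix $\Omega=A^qX^{\mathrm T}$, and let $\Pi$ be the orthogonal projector onto $\mathrm{range}(A_\mu\Omega)$. Then with probability at least $1-6^{-k}$, $$\|(I-\Pi)A_\mu\|\le 3|\mu|+\left(2C_1+2C_2\sqrt{\frac{\mathrm{sr}_k(A_\mu^2A^{2q})}{k}}\right)^{\frac1{q+1}}\sigma_k^{\frac q{q+1}}(\sigma_k+|\mu|)^{\frac1{q+1}}$$ with $C_1=18$ and $C_2=8\sqrt2$. Furthermore, the expectation $\mathbb{E}\big[\|(I-\Pi)A_\mu\|\big]$ is bounded by the same right-hand side with the smaller constants $C_1=2$ and $C_2=\sqrt2\,\mathrm e$.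
   Context: $\|\cdot\|$ is the spectral norm. Singular values $\sigma_j(C)$ of a matrix $C\in\mathbb{R}^{n\times n}$ are in decreasing order. The $k$-stable rank is $\mathrm{sr}_k(C)=\sum_{j\ge k}\sigma_j(C)/\sigma_k(C)\ (\le n)$, with the convention $0/0=0$. A matrix $X\in\mathbb{R}^{l\times n}$ is called Gaussian if its entries are i.i.d. normal with mean $0$ and variance $l^{-1}$. *)

(* Defs.v *)
From HB Require Import structures.
From mathcomp Require Import all_boot all_order all_algebra.
From mathcomp Require Import complex.
From mathcomp Require Import all_classical all_reals all_analysis.

Set Implicit Arguments.
Unset Strict Implicit.
Unset Printing Implicit Defensive.

Import Order.TTheory GRing.Theory Num.Theory.
Import numFieldNormedType.Exports.

Local Open Scope classical_set_scope.
Local Open Scope ring_scope.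

Definition enorm (R : realType) (n : nat) (x : 'cV[R]_n) : R :=
  Num.sqrt (\sum_(i < n) x i 0 ^+ 2).

(* Operator norm induced by [enorm]; not the library's norm on matrices, which
   is the entrywise maximum. *)
Definition spectral_norm (R : realType) (m n : nat) (C : 'M[R]_(m, n)) : R :=
  sup [set enorm (C *m x) | x in [set x : 'cV[R]_n | enorm x <= 1]].

(* Square roots of the eigenvalues, with multiplicity, of C^T C. The library's
   spectral theorem lives over a closed field, hence the passage through R[i];
   see [char_poly_singular_values] below. *)
Definition singular_values (R : realType) (n : nat) (C : 'M[R]_n) : seq R :=
  let d := spectral_diag (map_mx (real_complex R) (C^T *m C)) in
  sort >=%R [seq Num.sqrt (complex.Re (d 0 i)) | i <- enum 'I_n].

(* The indices j are 1-based; the value is meaningful for 1 <= j <= n. *)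
Definition sigma (R : realType) (n : nat) (C : 'M[R]_n) (j : nat) : R :=
  nth 0 (singular_values C) j.-1.

(* x / 0 = 0 in the library, which subsumes the convention 0 / 0 = 0. *)
Definition stable_rank (R : realType) (n : nat) (k : nat) (C : 'M[R]_n) : R :=
  (\sum_(k <= j < n.+1) sigma C j) / sigma C k.

(* Subspaces are row spaces in the library: the column space of M is the row
   space of M^T, its orthogonal complement is [kermx M], and [proj_mx] acts on
   row vectors. *)
Definition orthoproj (R : realType) (n m : nat) (M : 'M[R]_(n, m)) : 'M[R]_n :=
  (proj_mx << M^T >>%MS (kermx M))^T.

Definition mutually_independent (d : measure_display) (T : measurableType d)
    (R : realType) (P : probability T R) (I : finType)
    (Y : I -> {RV P >-> R}) : Prop :=
  forall (J : {set I}) (B : I -> set R), (forall i, measurable (B i)) ->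
    P (\bigcap_(i in [set` J]) (Y i @^-1` B i)) =
    (\prod_(i in J) P (Y i @^-1` B i))%E.

(* [normal_prob m s] is parameterized by the standard deviation s. *)
Definition gaussian_matrix (d : measure_display) (T : measurableType d)
    (R : realType) (P : probability T R) (l n : nat)
    (X : 'I_l -> 'I_n -> {RV P >-> R}) : Prop :=
  mutually_independent (fun ij : 'I_l * 'I_n => X ij.1 ij.2) /\
  forall i j (B : set R), measurable B ->
    distribution P (X i j) B = normal_prob 0 (Num.sqrt l%:R^-1) B.

Definition random_matrix (d : measure_display) (T : measurableType d)
    (R : realType) (P : probability T R) (l n : nat)
    (X : 'I_l -> 'I_n -> {RV P >-> R}) (w : T) : 'M[R]_(l, n) :=
  \matrix_(i, j) X i j w.

Lemma size_singular_values (R : realType) (n : nat) (C : 'M[R]_n) :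
  size (singular_values C) = n.
Proof. by rewrite size_sort size_map size_enum_ord. Qed.

Lemma singular_values_sorted (R : realType) (n : nat) (C : 'M[R]_n) :
  sorted >=%R (singular_values C).
Proof. by apply: sort_sorted => x y; exact: le_total. Qed.

Lemma singular_values_ge0 (R : realType) (n : nat) (C : 'M[R]_n) :
  all (fun s => 0 <= s) (singular_values C).
Proof.
by rewrite all_sort; apply/allP => s /mapP[i _ ->]; rewrite sqrtr_ge0.
Qed.

Lemma char_poly_singular_values (R : realType) (n : nat) (C : 'M[R]_n) :
  char_poly (C^T *m C) = \prod_(s <- singular_values C) ('X - (s ^+ 2)%:P).
Proof.
set M := map_mx (real_complex R) (C^T *m C).
set toC := map_mx (real_complex R) C.
have conjC_toC (x : R) : (real_complex R x)^* = real_complex R x.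
  by apply/CrealP/complex_realP; exists x.
have ME : M = (map_mx Num.conj toC^T) *m toC.
  rewrite /M map_mxM /toC map_trmx; congr (_ *m _).
  by apply/matrixP => i j; rewrite !mxE conjC_toC.
have Mherm : M \is hermsymmx.
  apply/is_hermitianmxP; rewrite expr0 scale1r; apply/matrixP => i j.
  rewrite !mxE conjC_toC; congr (real_complex R _).
  by apply: eq_bigr => a _; rewrite !mxE mulrC.
have /orthomx_spectralP MS := hermitian_normalmx Mherm.
set U := spectralmx M in MS; set D := spectral_diag M in MS.
have Uu : U \is unitarymx by exact: spectral_unitarymx.
have Uunit : U \in unitmx by exact: spectral_unit.
have DE : diag_mx D = (map_mx Num.conj (toC *m invmx U)^T) *m (toC *m invmx U).
  rewrite trmx_mul map_mxM {1}invmx_unitary// map_trmx trmxK -map_mx_comp.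
  rewrite (map_mx_id (@conjCK _)) -!mulmxA [X in U *m X]mulmxA -ME.
  by rewrite MS !mulmxA mulmxV// mul1mx -mulmxA mulmxV// mulmx1.
have D_ge0 i : 0 <= D 0 i.
  have /matrixP/(_ i i) := DE.
  rewrite !mxE eqxx mulr1n => ->; apply: sumr_ge0 => j _.
  by rewrite !mxE mulrC -normCK exprn_ge0.
have DR i : real_complex R (Num.sqrt (complex.Re (D 0 i)) ^+ 2) = D 0 i.
  have := D_ge0 i; case: (D 0 i) => a b.
  by rewrite lecE /= => /andP[/eqP -> a0]; rewrite sqr_sqrtr.
apply: (map_poly_inj (real_complex R)); rewrite map_char_poly -/M.
have -> : char_poly M = char_poly (diag_mx D).
  rewrite /char_poly /char_poly_mx {1}MS.
  have -> : 'X%:M - map_mx polyC (invmx U *m diag_mx D *m U) =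
    map_mx polyC (invmx U) *m ('X%:M - map_mx polyC (diag_mx D)) *m map_mx polyC U.
    rewrite mulmxBr mulmxBl !map_mxM; congr (_ - _).
    by rewrite scalar_mxC -mulmxA -map_mxM mulVmx// map_mx1 mulmx1.
  rewrite !det_mulmx mulrAC -det_mulmx -map_mxM mulVmx// map_mx1 det1.
  by rewrite mul1r.
rewrite char_poly_trig; last by apply: diag_mx_is_trig.
rewrite rmorph_prod /= (perm_big _ (permEl (perm_sort _ _))) /= big_map.
rewrite big_enum /=; apply: eq_bigr => i _.
by rewrite rmorphB /= map_polyX map_polyC /= DR mxE eqxx mulr1n.
Qed.

Lemma orthoprojP (R : realType) (n m : nat) (M : 'M[R]_(n, m)) :
  [/\ (orthoproj M)^T = orthoproj M,
      orthoproj M *m orthoproj M = orthoproj M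
    & ((orthoproj M)^T :=: M^T)%MS].
Proof.
have row_eq0 (v : 'rV[R]_n) : v *m v^T = 0 -> v = 0.
  move=> /matrixP/(_ 0 0)/eqP; rewrite !mxE psumr_eq0; last first.
    by move=> i _; rewrite !mxE -expr2 sqr_ge0.
  move=> /allP v0; apply/rowP => i; have := v0 i (mem_index_enum i).
  by rewrite !mxE /= mulf_eq0 orbb => /eqP.
have cap0 : (<< M^T >> :&: kermx M = 0)%MS.
  apply/eqP/rowV0P => v; rewrite sub_capmx genmxE => /andP[/submxP[u vE]].
  move=> /sub_kermxP vM; apply: row_eq0.
  by rewrite {1}vE -mulmxA -trmx_mul vM trmx0 mulmx0.
have full (W : 'M[R]_n) : (W <= << M^T >> + kermx M)%MS.
  apply: submx_full; rewrite /row_full mxrank_disjoint_sum//.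
  by rewrite mxrank_gen mxrank_tr mxrank_ker subnKC// rank_leq_row.
set Q := proj_mx << M^T >>%MS (kermx M).
have QQ : Q *m Q = Q by exact: proj_mx_proj.
have /submxP[W QW] : (Q <= M^T)%MS.
  have := proj_mx_sub << M^T >>%MS (kermx M) 1%:M.
  by rewrite mul1mx genmxE.
have /sub_kermxP kQ : (1%:M - Q <= kermx M)%MS.
  by rewrite -[X in _ - X]mul1mx proj_mx_compl_sub.
have QS : Q = Q *m Q^T.
  apply/eqP; rewrite -subr_eq0 -{1}[Q]mulmx1 -mulmxBr -trmx1 -linearB /=.
  by rewrite {1}QW -mulmxA -trmx_mul kQ trmx0 mulmx0.
have QT : Q^T = Q by rewrite QS trmx_mul trmxK.
rewrite /orthoproj -/Q !QT; split=> //.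
apply/eqmxP/andP; split.
  by apply/submxP; exists W.
apply/submxP; exists M^T; symmetry.
by apply: proj_mx_id => //; rewrite genmxE.
Qed.

(* Main.v *)
Require Import Defs.
From mathcomp Require Import all_boot all_order all_algebra.
From mathcomp Require Import all_classical all_reals all_analysis.
From mathcomp Require Import measurable_realfun perm.
From mathcomp Require Import ring lra.

Set Implicit Arguments.
Unset Strict Implicit.
Unset Printing Implicit Defensive.

Import Order.TTheory GRing.Theory Num.Theory.
Import numFieldNormedType.Exports.

Local Open Scope classical_set_scope.
Local Open Scope ring_scope.

(** Write B = A_mu A^q = V diag(b) V^T with |b| decreasing, Y = X V = [U N] with
    U of width r = k - 1, s = |b_k|.
    If (I - Pi) u = u then X B u = 0, and convexity of t |-> t^(q+1) against the
    spectral measure of u gives |A_mu u| <= (|mu| + t^(1/(q+1))) |u| as soon as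
    |B u| <= t |u|. Solving Y y = 0 (y = V^T B u) for the first r coordinates
    gives |B u| <= (s + S + rho) |u|, where S is the norm of R U^T N diag(b''),
    b'' the tail of b, R = (U^T U + eps)^-1, and rho tends to 0 with eps.
    The moments of S are bounded without any theory of Wishart matrices: for a
    Gaussian z independent of Y, S^(2a) is at most the mean over z of
    (z . R U^T N diag(b'') c)^(2a) divided by that of a standard Gaussian, hence
    of |diag(b'') N^T U R z|^(2a), and Gaussian integration by parts yields a
    recursion on these moments and on those of z^T R z that can be solved in
    closed form. With a = ceil(k/2), Markov's inequality gives the tail bound
    and tangent lines (Jensen) give the expectation bound. *)

(** * Integration by parts for a normal variable *)

Section NormalDensity.
Context {R : realType}.
Implicit Types (s x : R) (f g : R -> R).
Local Notation lam := (@lebesgue_measure R).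

(** The exponent a is pinned from both sides. Markov's inequality at six times the size of S costs
    36^(-a), which is at most 6^(-k) as soon as 2a >= k. On the other hand, step j of the recursion
    for the moments of z^T R z divides by l - r - 1 - 2j, that is by k + 2 - 2j, which has to be
    positive for all j < a. The parameter eps > 0 keeps the entries of R below 1/eps, so every field
    that is integrated by parts has polynomial growth and integrability never has to be discussed
    near rank-deficient U. Its price is the vector eps R y_1, of norm at most sqrt(eps tr R) |y_1|,
    and the mean of tr R is bounded uniformly in eps. With f = s sqrt(sr_k / k), so that k f^2 is
    the sum of b_i^2 over i >= k, the majorant of S^(2a) has mean at most (14 (f^2 + s^2/2))^a. The
    factor 14 = 4 * 7/2 bounds the growth of the constant when k increases by 2. The final constants
    only have to dominate it: 36 * 14 <= (16 sqrt 2)^2 for the tail, 14 <= (2 sqrt 2 e)^2 for the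
    expectation. *)

Lemma integral_normal_prob_density s (f : R -> \bar R) :
  (normal_prob 0 s).-integrable setT f ->
  (\int[normal_prob 0 s]_x f x = \int[lam]_x (f x * (normal_pdf 0 s x)%:E))%E.
Proof.
move=> fint.
rewrite -(Radon_Nikodym_change_of_variables (normal_prob_dominates 0 s))//=.
apply: ae_eq_integral => //.
- apply: emeasurable_funM; first exact: measurable_int fint.
  apply: (measurable_int lam).
  by apply: Radon_Nikodym_integrable; exact: normal_prob_dominates.
- apply: emeasurable_funM; first exact: measurable_int fint.
  by apply/measurable_EFinP; exact: measurable_normal_pdf.
- apply: ae_eqe_mul2l => /=.
  rewrite Radon_NikodymE//=; first exact: normal_prob_dominates.
  move=> dom; case: cid => /= h [h1 h2 h3].
  apply: integral_ae_eq => //=.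
  + by apply/measurable_EFinP; exact: measurable_normal_pdf.
  + by move=> E _ mE; rewrite -h3.
Qed.

(** Truncation at level n and monotone convergence remove the integrability hypothesis of the
    previous lemma, so that integrability under the normal law can itself be deduced from a Lebesgue
    integral. *)
Lemma ge0_integral_normal_prob_density s f : measurable_fun setT f ->
  (forall x, 0 <= f x) ->
  (\int[normal_prob 0 s]_x (f x)%:E =
   \int[lam]_x (f x * normal_pdf 0 s x)%:E)%E.
Proof.
move=> mf f0.
pose fn (n : nat) x := Num.min (f x) n%:R.
have mfn n : measurable_fun setT (fn n) by exact: measurable_minr.
have fn0 n x : 0 <= fn n x by rewrite le_min f0 ler0n.
have fnnd x : {homo (fun n => fn n x) : m n / (m <= n)%N >-> m <= n}.
  move=> a b ab; rewrite /fn le_min ge_min lexx/= ge_min (_ : a%:R <= b%:R) ?orbT//.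
  by rewrite ler_nat.
have fncvg x : fn ^~ x @ \oo --> f x.
  apply: cvg_near_cst; exists (Num.truncn (f x)).+1 => // n /= hn.
  rewrite /fn min_l//; apply/ltW/(lt_le_trans (truncnS_gt _)).
  by rewrite ler_nat.
have intn n : (\int[normal_prob 0 s]_x (fn n x)%:E =
   \int[lam]_x (fn n x * normal_pdf 0 s x)%:E)%E.
  rewrite integral_normal_prob_density//.
  apply: (@le_integrable _ _ _ _ _ measurableT _ (EFin \o cst n%:R)) => //=.
  - by apply/measurable_EFinP; exact: mfn.
  - by move=> x _; rewrite lee_fin !ger0_norm// ge_min lexx orbT.
  - by apply: finite_measure_integrable_cst.
transitivity (limn (fun n => \int[normal_prob 0 s]_x (fn n x)%:E)%E).
  rewrite -monotone_convergence//.
  - apply: eq_integral => x _; apply/esym/cvg_lim => //.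
    by apply: cvg_EFin; [exact: nearW|exact: fncvg].
  - by move=> n; apply/measurable_EFinP; exact: mfn.
  - by move=> n x _; rewrite lee_fin.
  - by move=> x _ a b ab; rewrite lee_fin fnnd.
under eq_fun do rewrite intn.
rewrite -monotone_convergence//.
- apply: eq_integral => x _; apply/cvg_lim => //.
  by apply: cvg_EFin; [exact: nearW|apply: cvgM; [exact: fncvg|exact: cvg_cst]].
- by move=> n; apply/measurable_EFinP; apply: (measurable_funM (mfn n)); exact: measurable_normal_pdf.
- by move=> n x _; rewrite lee_fin mulr_ge0// normal_pdf_ge0.
- by move=> x _ a b ab; rewrite lee_fin ler_wpM2r ?normal_pdf_ge0// fnnd.
Qed.

(** Half of the Gaussian exponent absorbs the polynomial; the other half is, up to a constant, the
    density with doubled variance, whose integrability is known. *)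
Lemma sqrX_normal_pdf_le s (N : nat) : s != 0 ->
  exists2 C, 0 <= C &
    forall x, (1 + x ^+ 2) ^+ N * normal_pdf 0 s x <=
              C * normal_pdf 0 (s * Num.sqrt 2) x.
Proof.
move=> s0.
have s20 : s * Num.sqrt 2 != 0 by rewrite mulf_neq0// gt_eqF// sqrtr_gt0.
(* The density is proportional to exp(- 2 c x^2), and the one with doubled variance to exp(- c
   x^2). *)
pose c := (4 * s ^+ 2)^-1.
have c0 : 0 < c by rewrite invr_gt0 mulr_gt0// exprn_even_gt0.
have bnd y : 0 <= y -> y ^+ N <= N`!%:R * c ^- N * expR (c * y).
  move=> y0.
  have cy0 : 0 <= c * y by rewrite mulr_ge0// ltW.
  have : (c * y) ^+ N <= N`!%:R * expR (c * y).
    case: N => [|N].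
      by rewrite expr0 mul1r -[leLHS]expR0 ler_expR.
    have : (c * y) ^+ N.+1 / N.+1`!%:R <= expR (c * y).
      by apply: le_trans (expR_ge1Dxn N cy0); rewrite lerDr.
    by rewrite ler_pdivrMr ?ltr0n ?fact_gt0// [expR _ * _]mulrC.
  by rewrite exprMn mulrAC ler_pdivlMr ?exprn_gt0// [y ^+ N * _]mulrC.
exists (N`!%:R * c ^- N * expR c * (normal_peak s / normal_peak (s * Num.sqrt 2))).
  rewrite !mulr_ge0 ?expR_ge0 ?ler0n ?invr_ge0 ?exprn_ge0 ?normal_peak_ge0//.
  exact: ltW.
move=> x; rewrite !normal_pdfE//.
rewrite (le_trans (ler_wpM2r _ (bnd _ _)))//.
- by rewrite mulr_ge0 ?normal_peak_ge0 ?normal_fun_ge0.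
- by rewrite addr_ge0 ?sqr_ge0.
rewrite /normal_fun !subr0 exprMn sqr_sqrtr//.
rewrite le_eqVlt; apply/orP; left; apply/eqP.
set p1 := normal_peak s; set p2 := normal_peak _.
have p20 : p2 != 0 by rewrite gt_eqF// normal_peak_gt0.
have -> : expR (- x ^+ 2 / (s ^+ 2 * 2 *+ 2)) = expR (- (c * x ^+ 2)).
  by congr expR; rewrite /c; field.
have -> : expR (- x ^+ 2 / (s ^+ 2 *+ 2)) = expR (- (c * x ^+ 2)) * expR (- (c * x ^+ 2)).
  by rewrite -expRD; congr expR; rewrite /c; field.
rewrite mulrDr mulr1 expRD !expRN.
have : expR (c * x ^+ 2) != 0 by rewrite expR_eq0.
move: (expR (c * x ^+ 2)) => e e0.
have : c ^+ N != 0 by rewrite expf_neq0// gt_eqF.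
by move: (c ^+ N) => cn cn0; field; do ?(apply/andP; split).
Qed.

End NormalDensity.

Section NormalIntegrationByParts.
Context {R : realType}.
Implicit Types (s x : R) (f g : R -> R).
Local Notation lam := (@lebesgue_measure R).

Lemma integrable_sqrX_normal_pdf s (N : nat) : s != 0 ->
  lam.-integrable setT (fun x => ((1 + x ^+ 2) ^+ N * normal_pdf 0 s x)%:E).
Proof.
move=> s0; have [C C0 hC] := sqrX_normal_pdf_le N s0.
apply: (@le_integrable _ _ R lam setT measurableT _
  (fun x => (C * normal_pdf 0 (s * Num.sqrt 2) x)%:E)) => //=.
- apply/measurable_EFinP; apply: measurable_funM; last exact: measurable_normal_pdf.
  apply: measurable_funX; apply: measurable_funD; first exact: measurable_cst.
  exact: measurable_funX.
- move=> x _; rewrite lee_fin !ger0_norm ?hC//.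
    by rewrite mulr_ge0// normal_pdf_ge0.
  by rewrite mulr_ge0 ?normal_pdf_ge0// exprn_ge0// addr_ge0// sqr_ge0.
- under eq_fun do rewrite EFinM.
  by apply: integrableZl => //; exact: integrable_normal_pdf.
Qed.

Lemma integrable_growth_normal_pdf s (N : nat) C f : s != 0 ->
  measurable_fun setT f ->
  (forall x, `|f x| <= C * (1 + x ^+ 2) ^+ N) ->
  lam.-integrable setT (fun x => (f x * normal_pdf 0 s x)%:E).
Proof.
move=> s0 mf fC.
apply: (@le_integrable _ _ R lam setT measurableT _
  (fun x => (C * ((1 + x ^+ 2) ^+ N * normal_pdf 0 s x))%:E)) => //=.
- apply/measurable_EFinP; apply: measurable_funM; first exact: mf.
  exact: measurable_normal_pdf.
- move=> x _; rewrite lee_fin !normrM [in leRHS]mulrA.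
  rewrite ler_wpM2r// (le_trans (fC x))// -normrM; exact: ler_norm.
- under eq_fun do rewrite EFinM.
  by apply: integrableZl => //; exact: integrable_sqrX_normal_pdf.
Qed.

Lemma integrable_growth_normal_prob s (N : nat) C f : s != 0 ->
  measurable_fun setT f ->
  (forall x, `|f x| <= C * (1 + x ^+ 2) ^+ N) ->
  (normal_prob 0 s).-integrable setT (EFin \o f).
Proof.
move=> s0 mf fC; apply/integrableP; split; first exact/measurable_EFinP.
have := integrable_growth_normal_pdf s0 mf fC => /integrableP[_].
under eq_integral do rewrite /= normrM (ger0_norm (normal_pdf_ge0 _ _ _)).
rewrite -(@ge0_integral_normal_prob_density R s (fun x => `|f x|))//.
by apply: measurableT_comp mf.
Qed.

Lemma is_derive_normal_pdf s x : s != 0 ->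
  is_derive x 1 (normal_pdf 0 s) (- (x / s ^+ 2) * normal_pdf 0 s x).
Proof.
move=> s0; rewrite normal_pdfE//.
have -> : (fun x => normal_peak s * normal_fun 0 s x) =
    (fun x => normal_peak s * expR (- (s ^+ 2 *+ 2)^-1 * x ^+ 2)).
  by apply/funext => y; rewrite /normal_fun subr0 !mulNr [(s ^+ 2 *+ 2)^-1 * _]mulrC.
apply: is_derive_eq.
by rewrite /normal_fun subr0 /GRing.scale/= !mulNr [(s ^+ 2 *+ 2)^-1 * x ^+ 2]mulrC; field.
Qed.

(** The product of [f] with the density has derivative (f' - x f / s^2) times the density. The
    integral of that over [-n, n] is a difference of boundary values, which vanish in the limit
    because [f] grows polynomially. *)
Lemma normal_stein s (f f' : R -> R) (N : nat) C : s != 0 ->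
  (forall x, is_derive x 1 f (f' x)) -> continuous f' ->
  (forall x, `|f x| <= C * (1 + x ^+ 2) ^+ N) ->
  (forall x, `|f' x| <= C * (1 + x ^+ 2) ^+ N) ->
  (\int[normal_prob 0 s]_x (x * f x)%:E =
   (s ^+ 2)%:E * \int[normal_prob 0 s]_x (f' x)%:E)%E.
Proof.
move=> s0 df cf' fC f'C.
pose pdf := normal_pdf 0 s.
have cf : continuous f.
  by move=> x; apply/differentiable_continuous/derivable1_diffP; case: (df x).
have mf : measurable_fun setT f by exact: continuous_measurable_fun.
have mf' : measurable_fun setT f' by exact: continuous_measurable_fun.
have C0 : 0 <= C.
  by have := fC 0; rewrite expr0n addr0 expr1n mulr1; apply: le_trans.
pose h x := f x * pdf x.
pose h' x := f' x * pdf x - (s ^+ 2)^-1 * (x * f x * pdf x).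
have xfC x : `|x * f x| <= C * (1 + x ^+ 2) ^+ N.+1.
  rewrite normrM exprS mulrCA ler_pM//.
  rewrite -[x ^+ 2]real_normK ?num_real//.
  by have := sqr_ge0 (`|x| - 2^-1); rewrite !expr2; lra.
have mxf : measurable_fun setT (fun x => x * f x) by exact: measurable_funM.
have i1 := integrable_growth_normal_pdf s0 mf' f'C.
have i2 := integrable_growth_normal_pdf s0 mxf xfC.
have hD x : is_derive x 1 h (h' x).
  have := is_derive_normal_pdf x s0; have := df x => d1 d2.
  apply: is_derive_eq; rewrite /h' /GRing.scale/= -/pdf.
  by move: (f x) (f' x) (pdf x) => a b c; field.
have ch' : continuous h'.
  have cp : continuous pdf by exact: continuous_normal_pdf.
  move=> x; apply: cvgB; first by apply: cvgM; [exact: cf'|exact: cp].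
  apply: cvgM; first exact: cvg_cst.
  apply: cvgM; last exact: cp.
  by apply: cvgM; [exact: cvg_id|exact: cf].
have ih' : lam.-integrable setT (EFin \o h').
  have -> : EFin \o h' = ((fun x => (f' x * pdf x)%:E) \-
     (fun x => ((s ^+ 2)^-1)%:E * (x * f x * pdf x)%:E))%E.
    by apply/funext => x; rewrite /= /h' EFinB EFinM.
  by apply: integrableB => //; exact: integrableZl.
suff h0 : (\int[lam]_x (h' x)%:E = 0)%E.
  have g1 := integrable_growth_normal_prob s0 mf' f'C.
  have g2 := integrable_growth_normal_prob s0 mxf xfC.
  rewrite (integral_normal_prob_density g1) (integral_normal_prob_density g2).
  move: h0; rewrite /h'.
  under eq_integral do rewrite EFinB [X in (_ - X)%E]EFinM.
  rewrite integralB//=; last exact: integrableZl.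
  rewrite integralZl//.
  have /fineK <- := integrable_fin_num measurableT i1.
  have /fineK <- := integrable_fin_num measurableT i2.
  rewrite -!EFinM -EFinB => -[] /eqP; rewrite subr_eq0 => /eqP ->.
  by congr EFin; field.
(* One more power of 1 + x^2 than the growth of [f] is put into the density bound, which leaves a
   quantitative decay at infinity. *)
have hC : exists2 K, 0 <= K & forall x, `|h x| <= K / (1 + x ^+ 2).
  have [K K0 hK] := sqrX_normal_pdf_le N.+1 s0.
  have s20 : s * Num.sqrt 2 != 0 by rewrite mulf_neq0// gt_eqF// sqrtr_gt0.
  exists (C * (K * normal_peak (s * Num.sqrt 2))).
    by rewrite !mulr_ge0// normal_peak_ge0.
  move=> x; have x1 : 0 < 1 + x ^+ 2 by rewrite ltr_pwDl// sqr_ge0.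
  rewrite ler_pdivlMr// normrM (ger0_norm (normal_pdf_ge0 _ _ _)).
  rewrite (le_trans (ler_wpM2r (ltW x1) (ler_wpM2r (normal_pdf_ge0 _ _ _) (fC x))))//.
  have -> : C * (1 + x ^+ 2) ^+ N * normal_pdf 0 s x * (1 + x ^+ 2) =
      C * ((1 + x ^+ 2) ^+ N.+1 * normal_pdf 0 s x) by rewrite [(1 + _) ^+ N.+1]exprS; ring.
  rewrite ler_wpM2l// (le_trans (hK x))// ler_wpM2l// normal_pdf_ub//.
have [K K0 hK] := hC.
have hlim (t : nat -> R) : (forall n, t n ^+ 2 = n%:R ^+ 2) ->
    h (t n) @[n --> \oo] --> 0.
  move=> tn; apply/cvgr0Pnorm_lt => e e0.
  near=> n.
  rewrite (le_lt_trans (hK _))// tn ltr_pdivrMr; last by rewrite ltr_pwDl// sqr_ge0.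
  have n0 : 1 <= n%:R :> R by rewrite ler1n; near: n; exists 1.
  have : K / e < n%:R by near: n; exact: nbhs_infty_gtr.
  rewrite ltr_pdivrMr// => /lt_le_trans; apply.
  rewrite mulrC ler_wpM2l ?(ltW e0)// expr2.
  by rewrite (le_trans (ler_peMl _ n0))// lerDr.
pose fn (n : nat) := (EFin \o h') \_ `[(- n%:R)%R, n%:R%R].
have [] := @dominated_convergence _ _ R lam setT measurableT fn (EFin \o h')
  (abse \o (EFin \o h')).
- move=> n; apply/(measurable_restrictT _ _).1 => //; apply: (@measurable_funS _ _ _ _ setT) => //; exact: measurable_int ih'.
- exact: measurable_int ih'.
- apply: aeW => x _; apply: cvg_near_cst.
  near=> n; rewrite /fn patchE mem_set//= in_itv/= -ler_norml.
  by apply: ltW; near: n; exact: nbhs_infty_gtr.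
- exact: integrable_abse.
- apply: aeW => x n _; rewrite /fn patchE /=; case: ifP => _; first by rewrite /= lexx.
  by rewrite (_ : point = 0%E :> \bar R)// abse0 lee_fin.
move=> _ _ lim1.
have lim2 : (\int[lam]_x (fn n x))%E @[n --> \oo] --> 0%:E.
  (* The shift excludes n = 0: the fundamental theorem of calculus is applied on [-n, n] with
     distinct endpoints. *)
  rewrite -(cvg_shiftn 1)/=.
  have -> : (fun n => \int[lam]_x fn (n + 1)%N x)%E =
      (fun n => (h (n + 1)%:R - h (- (n + 1)%:R))%:E).
    apply/funext => n; rewrite /fn -integral_mkcond.
    rewrite (@continuous_FTC2 _ h' h).
    - by rewrite EFinB.
    - by rewrite gtrN// ltr0n addn1.
    - by apply: continuous_subspaceT => x; exact: ch'.
    - have ch : continuous h.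
        by move=> x; apply/differentiable_continuous/derivable1_diffP; case: (hD x).
      split.
      + by move=> x _; case: (hD x).
      + by apply: cvg_at_right_filter; exact: ch.
      + by apply: cvg_at_left_filter; exact: ch.
    - by move=> x _; rewrite derive1E; case: (hD x).
  apply: cvg_EFin; first exact: nearW.
  rewrite -[0]subr0; apply: cvgB.
    by rewrite (cvg_shiftn 1 (fun n => h n%:R)); exact: hlim.
  rewrite (cvg_shiftn 1 (fun n => h (- n%:R))).
  by apply: hlim => n; rewrite sqrrN.
exact: (cvg_unique _ lim1 lim2).
Unshelve. all: by end_near.
Qed.
End NormalIntegrationByParts.

(** * Functions of a random matrix *)

Section MatrixMeasurability.
Context {R : realType} (l n : nat).

Definition coord_measurable d (T : measurableType d) (Y : T -> 'M[R]_(l, n)) :=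
  forall i j, measurable_fun setT (fun w => Y w i j).

(* Measurability of f for the product sigma-algebra, phrased so that no
   measurable structure on matrices is needed. *)
Definition measurable_on_mx (f : 'M[R]_(l, n) -> R) : Prop :=
  forall d (T : measurableType d) (Y : T -> 'M[R]_(l, n)),
    coord_measurable Y -> measurable_fun setT (fun w => f (Y w)).

Definition rectangles : set (set 'M[R]_(l, n)) :=
  [set A | exists B : 'I_l -> 'I_n -> set R,
    (forall i j, measurable (B i j)) /\
    A = [set M : 'M[R]_(l, n) | forall i j, B i j (M i j)]].

Let mxT : measurableType _ := g_sigma_algebraType rectangles.

Lemma setI_closed_rectangles : setI_closed rectangles.
Proof.
move=> _ _ [B [mB ->]] [C [mC ->]].
exists (fun i j => B i j `&` C i j); split=> [i j|]; first exact: measurableI.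
apply/seteqP; split=> M /= => [[hB hC] i j|h]; first by split.
by split=> i j; case: (h i j).
Qed.

Lemma rectanglesT : rectangles setT.
Proof. by exists (fun _ _ => setT); split=> //; apply/seteqP; split. Qed.

Lemma coord_measurable_mx d (T : measurableType d) (Y : T -> 'M[R]_(l, n)) :
  coord_measurable Y -> measurable_fun setT (Y : T -> mxT).
Proof.
move=> mY; apply: (@measurability _ _ T mxT setT Y rectangles) => //.
move=> _ [_ [B [mB ->]] <-]; rewrite setTI.
rewrite (_ : _ @^-1` _ = \bigcap_(i in setT) \bigcap_(j in setT)
   ((fun w => Y w i j) @^-1` B i j)); last first.
  apply/seteqP; split=> w /=; first by move=> h i _ j _ /=; exact: h.
  by move=> h i j; exact: (h i I j I).
apply: fin_bigcap_measurable => // i _; apply: fin_bigcap_measurable => // j _.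
by rewrite -[X in measurable X]setTI; exact: mY.
Qed.

Lemma measurable_coord i j : measurable_fun setT (fun M : mxT => M i j).
Proof.
move=> _ B mB; rewrite setTI; apply: sub_sigma_algebra.
exists (fun i' j' => if (i', j') == (i, j) then B else setT); split=> [i' j'|].
  by case: ifP.
apply/seteqP; split=> M /=; last by move=> /(_ i j); rewrite eqxx.
by move=> BM i' j'; case: ifP => // /eqP[-> ->].
Qed.

Lemma measurable_on_mxE (f : 'M[R]_(l, n) -> R) :
  measurable_on_mx f -> measurable_fun setT (f : mxT -> R).
Proof. by move=> mf; apply: (mf _ mxT id); exact: measurable_coord. Qed.

(** Rectangles are stable under intersection and generate the sigma-algebra, so laws that agree on
    them coincide. [P2] is a plain measure because it will be a product measure. *)
Lemma integral_same_law d1 (T1 : measurableType d1) (P1 : probability T1 R)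
    d2 (T2 : measurableType d2) (P2 : {measure set T2 -> \bar R})
    (Y1 : T1 -> 'M[R]_(l, n)) (Y2 : T2 -> 'M[R]_(l, n)) (f : 'M[R]_(l, n) -> R) :
  coord_measurable Y1 -> coord_measurable Y2 ->
  (forall B : 'I_l -> 'I_n -> set R, (forall i j, measurable (B i j)) ->
     P1 [set w | forall i j, B i j (Y1 w i j)] =
     P2 [set w | forall i j, B i j (Y2 w i j)]) ->
  measurable_on_mx f -> P1.-integrable setT (EFin \o f \o Y1) ->
  P2.-integrable setT (EFin \o f \o Y2) /\
  (\int[P1]_w (f (Y1 w))%:E = \int[P2]_w (f (Y2 w))%:E)%E.
Proof.
move=> mY1 mY2 eqB mf intf.
have mY1' := coord_measurable_mx mY1; have mY2' := coord_measurable_mx mY2.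
have mf' := measurable_on_mxE mf.
have eqP12 (A : set mxT) : measurable A -> A `<=` setT ->
    pushforward P1 (Y1 : _ -> mxT) A = pushforward P2 (Y2 : _ -> mxT) A.
  move=> mA _.
  apply: (@measure_unique _ _ mxT rectangles (fun=> setT)) => //=.
  - exact: setI_closed_rectangles.
  - by move=> _; exact: rectanglesT.
  - by rewrite bigcup_const.
  - by move=> _ [B [mB ->]]; exact: eqB.
  - move=> _; rewrite /pushforward preimage_setT.
    by rewrite (le_lt_trans (probability_le1 _ _))// ltry.
have int1 : (pushforward P1 (Y1 : _ -> mxT)).-integrable setT (EFin \o f).
  by apply: integrable_pushforward => //; exact/measurable_EFinP.
have int2 : P2.-integrable setT (EFin \o f \o Y2).
  apply/integrableP; split; first exact/measurable_EFinP/mf.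
  move/integrableP : int1 => [_].
  rewrite (eq_measure_integral _ eqP12)// (ge0_integral_pushforward mY2')//.
  by apply/measurableT_comp => //; exact/measurable_EFinP.
split=> //.
rewrite -(@integral_pushforward _ _ _ _ _ _ mY1' P1 setT (EFin \o f))//; last exact/measurable_EFinP.
rewrite -(@integral_pushforward _ _ _ _ _ _ mY2' P2 setT (EFin \o f))//; last exact/measurable_EFinP.
exact: eq_measure_integral.
Qed.

End MatrixMeasurability.

Section Tame.
Context {R : realType} {l n : nat}.
Implicit Types (f g : 'M[R]_(l, n) -> R) (M H : 'M[R]_(l, n)).

(** One plus the squared Frobenius norm. Being at least 1, it has powers that increase with the
    exponent, which makes polynomial growth stable under sums. *)
Definition mx_size M : R := 1 + \sum_i \sum_j M i j ^+ 2.

Lemma mx_size_ge1 M : 1 <= mx_size M.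
Proof.
by rewrite lerDl; do 2 (apply: sumr_ge0 => ? _); exact: sqr_ge0.
Qed.

Lemma mx_size_ge0 M : 0 <= mx_size M.
Proof. exact: le_trans (mx_size_ge1 M). Qed.

Lemma coord_le_mx_size M i j : M i j ^+ 2 <= mx_size M.
Proof.
rewrite /mx_size (bigD1 i)//= (bigD1 j)//= -[leLHS]add0r lerD// -addrA lerDl.
rewrite addr_ge0// sumr_ge0// => a _; first exact: sqr_ge0.
by apply: sumr_ge0 => b _; exact: sqr_ge0.
Qed.

Definition growth f := exists C N, forall M, `|f M| <= C * mx_size M ^+ N.

Lemma growthE f : growth f ->
  exists C N, 0 <= C /\ forall M, `|f M| <= C * mx_size M ^+ N.
Proof.
move=> [C [N h]]; exists C, N; split=> //.
have := h 0; set u := mx_size 0 => hu; rewrite -(@pmulr_lge0 _ (u ^+ N)).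
  exact: le_trans hu.
by rewrite exprn_gt0// (lt_le_trans ltr01)// mx_size_ge1.
Qed.

Lemma growth_cst (c : R) : growth (fun=> c).
Proof. by exists `|c|, 0%N => M; rewrite expr0 mulr1. Qed.

Lemma growth_coord i j : growth (fun M => M i j).
Proof.
exists 1, 1%N => M; rewrite mul1r expr1.
have := coord_le_mx_size M i j; rewrite -[_ ^+ 2]real_normK ?num_real//.
have [h _|h] := leP `|M i j| 1; first exact: le_trans (mx_size_ge1 M).
by apply: le_trans; rewrite expr2 ler_peMl// ltW.
Qed.

Lemma growthD f g : growth f -> growth g -> growth (fun M => f M + g M).
Proof.
move=> /growthE[C [N [C0 hf]]] /growthE[D [K [D0 hg]]].
exists (C + D), (N + K)%N => M; rewrite (le_trans (ler_normD _ _))// mulrDl.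
have h1 := mx_size_ge1 M.
apply: lerD.
  by apply: le_trans (hf M) _; rewrite ler_wpM2l// ler_weXn2l// leq_addr.
by apply: le_trans (hg M) _; rewrite ler_wpM2l// ler_weXn2l// leq_addl.
Qed.

Lemma growthM f g : growth f -> growth g -> growth (fun M => f M * g M).
Proof.
move=> [C [N hf]] [D [K hg]].
by exists (C * D), (N + K)%N => M; rewrite normrM exprD mulrACA ler_pM.
Qed.

Definition tame f := measurable_on_mx f /\ growth f.

Lemma tame_cst (c : R) : tame (fun=> c).
Proof. by split; [move=> *; exact: measurable_cst|exact: growth_cst]. Qed.

Lemma tame_coord i j : tame (fun M => M i j).
Proof. by split; [move=> d T Y; exact|exact: growth_coord]. Qed.

Lemma tameD f g : tame f -> tame g -> tame (fun M => f M + g M).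
Proof.
move=> [mf f0] [mg g0]; split; last exact: growthD.
by move=> d T Y mY; apply: measurable_funD; [exact: mf|exact: mg].
Qed.

Lemma tameM f g : tame f -> tame g -> tame (fun M => f M * g M).
Proof.
move=> [mf f0] [mg g0]; split; last exact: growthM.
by move=> d T Y mY; apply: measurable_funM; [exact: mf|exact: mg].
Qed.

Lemma tame_sum I (r : seq I) (p : pred I) (F : I -> 'M[R]_(l, n) -> R) :
  (forall i, tame (F i)) -> tame (fun M => \sum_(i <- r | p i) F i M).
Proof.
move=> tF; elim: r => [|i r ih].
  by under eq_fun do rewrite big_nil; exact: tame_cst.
under eq_fun do rewrite big_cons; case: (p i) => //.
exact: tameD.
Qed.

Lemma tameX f N : tame f -> tame (fun M => f M ^+ N).
Proof.
move=> tf; elim: N => [|N ih]; first exact: tame_cst.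
by under eq_fun do rewrite exprS; exact: tameM.
Qed.

(* df is the gradient of f, with only the line derivatives that the
   one-variable integration by parts consumes. *)
Definition nice f (df : 'M[R]_(l, n) -> 'M[R]_(l, n)) := [/\ tame f,
  (forall i j, tame (fun M => df M i j)),
  (forall M H, is_derive (0 : R) 1 (fun t : R => f (M + t *: H))
     (\sum_i \sum_j df M i j * H i j)) &
  (forall M H i j, {for 0, continuous (fun t : R => df (M + t *: H) i j)})].

Lemma eq_nice f g df dg : f =1 g -> df =1 dg -> nice f df -> nice g dg.
Proof. by move=> /funext -> /funext ->. Qed.

Lemma nice_continuous f df M H : nice f df ->
  {for 0, continuous (fun t : R => f (M + t *: H))}.
Proof.
by case=> _ _ dfD _; apply/differentiable_continuous/derivable1_diffP; case: (dfD M H).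
Qed.

Lemma nice_cst (c : R) : nice (fun=> c) (fun=> 0).
Proof.
split; first exact: tame_cst.
- by move=> i j; under eq_fun do rewrite mxE; exact: tame_cst.
- move=> M H; rewrite big1; first exact: is_derive_cst.
  by move=> i _; rewrite big1// => j _; rewrite mxE mul0r.
- by move=> M H i j; rewrite /prop_for; under eq_fun do rewrite mxE; exact: cvg_cst.
Qed.

Lemma nice_coord i j : nice (fun M => M i j) (fun=> delta_mx i j).
Proof.
split; first exact: tame_coord.
- by move=> i' j'; exact: tame_cst.
- move=> M H; under eq_fun do rewrite !mxE.
  apply: is_derive_eq; rewrite (bigD1 i)//= (bigD1 j)//= !mxE !eqxx.
  rewrite big1 ?addr0; last by move=> b bj; rewrite mxE (negbTE bj) andbF mul0r.
  rewrite big1 ?addr0; last first.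
    by move=> a ai; rewrite big1// => b _; rewrite mxE (negbTE ai) mul0r.
  by rewrite /GRing.scale/=; ring.
- by move=> M H a b; exact: cvg_cst.
Qed.

Lemma niceD f g df dg : nice f df -> nice g dg ->
  nice (fun M => f M + g M) (fun M => df M + dg M).
Proof.
move=> [tf tdf fD cf] [tg tdg gD cg]; split; first exact: tameD.
- by move=> i j; under eq_fun do rewrite mxE; exact: tameD.
- move=> M H; have := fD M H; have := gD M H => d1 d2.
  apply: is_derive_eq; rewrite -big_split/=; apply: eq_bigr => i _.
  by rewrite -big_split/=; apply: eq_bigr => j _; rewrite mxE mulrDl.
- move=> M H i j; rewrite /prop_for; under eq_fun do rewrite mxE.
  by apply: cvgD; [exact: cf|exact: cg].
Qed.

Lemma niceM f g df dg : nice f df -> nice g dg ->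
  nice (fun M => f M * g M) (fun M => f M *: dg M + g M *: df M).
Proof.
move=> nf ng.
have cf' M H := @nice_continuous f df M H nf.
have cg' M H := @nice_continuous g dg M H ng.
move: nf ng => [tf tdf fD cf] [tg tdg gD cg]; split; first exact: tameM.
- by move=> i j; under eq_fun do rewrite !mxE; apply: tameD; exact: tameM.
- move=> M H; have := fD M H; have := gD M H => d1 d2.
  apply: is_derive_eq; rewrite !scale0r !addr0 /GRing.scale/=.
  rewrite !mulr_sumr -big_split/=; apply: eq_bigr => i _.
  rewrite !mulr_sumr -big_split/=; apply: eq_bigr => j _.
  by rewrite !mxE mulrDl !mulrA.
- move=> M H i j; rewrite /prop_for; under eq_fun do rewrite !mxE.
  apply: cvgD; apply: cvgM; [exact: cf'|exact: cg|exact: cg'|exact: cf].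
Qed.

Lemma nice_sum I (r : seq I) (F : I -> 'M[R]_(l, n) -> R) dF :
  (forall i, nice (F i) (dF i)) ->
  nice (fun M => \sum_(i <- r) F i M) (fun M => \sum_(i <- r) dF i M).
Proof.
move=> nF; elim: r => [|i r ih].
  apply: eq_nice (nice_cst 0) => M; by rewrite big_nil.
by apply: eq_nice (niceD (nF i) ih) => M; rewrite big_cons.
Qed.

Lemma niceZ (c : R) f df : nice f df -> nice (fun M => c * f M) (fun M => c *: df M).
Proof.
move=> nf; apply: eq_nice (niceM (nice_cst c) nf) => M //.
by rewrite scaler0 addr0.
Qed.

Lemma niceX f df N : nice f df ->
  nice (fun M => f M ^+ N) (fun M => (N%:R * f M ^+ N.-1) *: df M).
Proof.
move=> nf; elim: N => [|N ih].
  by apply: eq_nice (nice_cst 1) => M; rewrite ?expr0// mul0r scale0r.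
apply: eq_nice (niceM nf ih) => M; first by rewrite exprS.
rewrite scalerA -scalerDl; congr (_ *: _).
by case: N {ih} => [|N]; [rewrite mul0r mulr0 add0r expr0 mul1r|rewrite /= exprS -[N.+2%:R]natr1; ring].
Qed.

End Tame.

(** * Integration by parts for a Gaussian matrix *)

Section GaussianMatrix.
Context {d : measure_display} {T : measurableType d} {R : realType}.
Variables (P : probability T R) (l n : nat).

Definition upd (M : 'M[R]_(l, n)) i j (x : R) : 'M[R]_(l, n) :=
  \matrix_(a, b) if (a, b) == (i, j) then x else M a b.

Lemma upd_line M i j x t : upd M i j (x + t) = upd M i j x + t *: delta_mx i j.
Proof.
apply/matrixP => a b; rewrite !mxE xpair_eqE.
by case: (_ && _); rewrite /= ?mulr1 ?mulr0 ?addr0.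
Qed.

Lemma mx_size_upd M i j x : mx_size (upd M i j x) <= mx_size M * (1 + x ^+ 2).
Proof.
rewrite mulrDr mulr1 (@le_trans _ _ (mx_size M + x ^+ 2))//; last first.
  by rewrite lerD2l ler_peMl ?sqr_ge0// mx_size_ge1.
rewrite /mx_size -addrA lerD2l !pair_bigA/= (bigD1 (i, j))//= mxE eqxx.
rewrite [leRHS]addrC lerD2l [leRHS](bigD1 (i, j))//= -[leLHS]add0r lerD ?sqr_ge0//.
by apply: ler_sum => -[a b] abij /=; rewrite mxE (negbTE abij).
Qed.

Variable (X : 'I_l -> 'I_n -> {RV P >-> R}) (s : R).
Hypothesis indX : mutually_independent (fun ij : 'I_l * 'I_n => X ij.1 ij.2).
Hypothesis lawX : forall i j (B : set R), measurable B ->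
  distribution P (X i j) B = normal_prob 0 s B.
Hypothesis s0 : s != 0.

Let Y := random_matrix X.

Lemma coord_measurable_random_matrix : coord_measurable Y.
Proof. by move=> i j; under eq_fun do rewrite mxE; exact: measurable_funPT. Qed.

Let gP := (normal_prob 0 s \x P)%E.

Let Yupd i j (p : R * T) := upd (Y p.2) i j p.1.

Lemma coord_measurable_upd i j : coord_measurable (Yupd i j : (measurableTypeR R * T)%type -> _).
Proof.
move=> a b; have -> : (fun p => Yupd i j p a b) =
    (fun p => if (a, b) == (i, j) then p.1 else Y p.2 a b).
  by apply/funext => p; rewrite mxE.
case: eqP => _; first exact: measurable_fst.
exact: (measurableT_comp (coord_measurable_random_matrix a b) measurable_snd).
Qed.

Let prob_rect (J : {set 'I_l * 'I_n}) (B : 'I_l -> 'I_n -> set R) :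
  (forall i j, measurable (B i j)) ->
  P [set w | forall a b, (a, b) \in J -> B a b (Y w a b)] =
  (\prod_(ij in J) normal_prob 0 s (B ij.1 ij.2))%E.
Proof.
move=> mB; have := @indX J (fun ij => B ij.1 ij.2) (fun ij => mB _ _).
move=> E; transitivity (\prod_(ij in J) P (X ij.1 ij.2 @^-1` B ij.1 ij.2))%E; last first.
  by apply: eq_bigr => ij _; exact: (lawX ij.1 ij.2 (mB _ _)).
rewrite -E; congr (P _); apply/seteqP; split=> w /=.
  by move=> h [a b] abJ /=; have := h a b abJ; rewrite mxE.
by move=> h a b abJ; rewrite mxE; exact: (h (a, b)).
Qed.

(** Both sides are the normal probability of [B i j] times the probability of the constraints on the
    other entries. Independence is used for the whole index set and for the complement of (i, j). *)
Lemma law_upd i j (B : 'I_l -> 'I_n -> set R) : (forall a b, measurable (B a b)) ->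
  P [set w | forall a b, B a b (Y w a b)] =
  gP [set p | forall a b, B a b (Yupd i j p a b)].
Proof.
move=> mB.
transitivity (normal_prob 0 s (B i j) *
   P [set w | forall a b, (a, b) \in [set~ (i, j)]%SET -> B a b (Y w a b)])%E.
  rewrite prob_rect//.
  have -> : [set w | forall a b, B a b (Y w a b)] =
    [set w | forall a b, (a, b) \in [set: 'I_l * 'I_n]%SET -> B a b (Y w a b)].
    apply/seteqP; split=> w /= h a b; first by move=> _; exact: h.
    by apply: h; rewrite inE.
  rewrite prob_rect// (bigD1 (i, j)) ?inE//=; congr (_ * _)%E.
  by apply: eq_bigl => ab; rewrite !inE.
have -> : [set p | forall a b, B a b (Yupd i j p a b)] =
    B i j `*` [set w | forall a b, (a, b) \in [set~ (i, j)]%SET -> B a b (Y w a b)].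
  apply/seteqP; split=> -[x w] /=.
    move=> h; split; first by have := h i j; rewrite mxE eqxx.
    by move=> a b; rewrite !inE => abij; have := h a b; rewrite mxE (negbTE abij).
  move=> [Bx h] a b; rewrite /Yupd mxE; case: ifPn => [/eqP[-> ->]//|abij].
  by apply: h; rewrite !inE.
rewrite /gP product_measure1E//; first exact: mB.
rewrite (_ : [set w | _] = \bigcap_(ab in [set` [set~ (i, j)]%SET]) ((fun w => Y w ab.1 ab.2) @^-1` B ab.1 ab.2)).
  apply: fin_bigcap_measurable => // ab _; rewrite -[X in measurable X]setTI.
  exact: coord_measurable_random_matrix.
apply/seteqP; split=> w /=; first by move=> h [a b] /=; exact: h.
by move=> h a b abJ; exact: (h (a, b)).
Qed.

(* Replacing one entry by an independent normal variable preserves the law of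
   the matrix, which reduces integration by parts to one variable. *)
Lemma resample i j (f : 'M[R]_(l, n) -> R) : measurable_on_mx f ->
  P.-integrable setT (EFin \o f \o Y) ->
  gP.-integrable setT (EFin \o f \o Yupd i j) /\
  (\int[P]_w (f (Y w))%:E = \int[gP]_p (f (Yupd i j p))%:E)%E.
Proof.
move=> mf intf.
exact: (integral_same_law coord_measurable_random_matrix
  (@coord_measurable_upd i j) (@law_upd i j) mf intf).
Qed.

Lemma integrable_coordX i j N :
  P.-integrable setT (fun w => ((1 + Y w i j ^+ 2) ^+ N)%:E).
Proof.
have -> : (fun w => ((1 + Y w i j ^+ 2) ^+ N)%:E) =
    (fun x => ((1 + x ^+ 2) ^+ N)%:E) \o X i j.
  by apply/funext => w /=; rewrite mxE.
have mp : measurable_fun setT (fun x : R => (1 + x ^+ 2) ^+ N).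
  apply: measurable_funX; apply: measurable_funD; first exact: measurable_cst.
  exact: measurable_funX.
have ip : (normal_prob 0 s).-integrable setT (EFin \o (fun x : R => (1 + x ^+ 2) ^+ N)).
  apply: (@integrable_growth_normal_prob _ _ N 1) => // x.
  by rewrite mul1r ger0_norm// exprn_ge0// addr_ge0// sqr_ge0.
apply/integrableP; split.
  by apply/measurable_EFinP; exact: (measurableT_comp mp).
pose h (x : measurableTypeR R) := `|((1 + x ^+ 2) ^+ N)%:E|%E.
have mX : measurable_fun setT (X i j : T -> measurableTypeR R).
  by move=> mT B mB; exact: measurable_funPT.
have mq : measurable_fun setT h.
  by apply: measurableT_comp => //; exact/measurable_EFinP.
have := @ge0_integral_pushforward _ _ _ _ _ _ mX P setT h measurableT mq
  (fun _ _ => abse_ge0 _).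
rewrite preimage_setT => /esym /= ->.
have [_] := integrableP _ _ _ ip.
apply: le_lt_trans; rewrite le_eqVlt; apply/orP; left; apply/eqP.
by apply: eq_measure_integral => B mB _; exact: lawX.
Qed.

Let moments (g : T -> R) := [/\ forall w, 0 <= g w, measurable_fun setT g &
  forall N, P.-integrable setT (fun w => (g w ^+ N)%:E)].

Let momentsD g h : moments g -> moments h -> moments (fun w => g w + h w).
Proof.
move=> [g0 mg ig] [h0 mh ih]; split.
- by move=> w; rewrite addr_ge0.
- exact: measurable_funD.
(* (g + h)^N <= (2 max(g, h))^N <= 2^N (g^N + h^N). *)
- move=> N; apply: (@le_integrable _ _ _ _ _ measurableT _
    (fun w => ((2 ^+ N)%:E * (g w ^+ N)%:E + (2 ^+ N)%:E * (h w ^+ N)%:E))%E) => //=.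
  + by apply/measurable_EFinP; apply: measurable_funX; exact: measurable_funD.
  + move=> w _; rewrite lee_fin -mulrDr !ger0_norm; last 2 first.
    * by rewrite mulr_ge0 ?addr_ge0 ?exprn_ge0.
    * by rewrite exprn_ge0 ?addr_ge0.
    wlog gh : g h g0 h0 {mg mh ig ih} / g w <= h w => [hwlog|].
      have [|/ltW] := leP (g w) (h w); first exact: hwlog.
      by move=> /hwlog hw; rewrite addrC [X in _ * X]addrC; exact: hw.
    rewrite (@le_trans _ _ ((2 * h w) ^+ N))//.
      by rewrite lerXn2r ?nnegrE ?addr_ge0 ?mulr_ge0// mulr2n mulrDl !mul1r lerD2r.
    by rewrite exprMn ler_wpM2l ?exprn_ge0// lerDr exprn_ge0.
  + by apply: integrableD => //; exact: integrableZl.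
Qed.

Let moments_sum I (r : seq I) (F : I -> T -> R) : (forall i, moments (F i)) ->
  moments (fun w => \sum_(i <- r) F i w).
Proof.
move=> mF; elim: r => [|i r ih].
  under eq_fun do rewrite big_nil; split=> // N.
  exact: finite_measure_integrable_cst.
by under eq_fun do rewrite big_cons; exact: momentsD.
Qed.

Lemma integrable_tame f : tame f -> P.-integrable setT (EFin \o f \o Y).
Proof.
move=> [mf [C [N fC]]].
have [_ _ /(_ N) isz] : moments (fun w => mx_size (Y w)).
  apply: momentsD.
    by split=> // K; apply: finite_measure_integrable_cst.
  apply: moments_sum => i; apply: moments_sum => j; split=> [w||K].
  - exact: sqr_ge0.
  - by apply: measurable_funX; exact: coord_measurable_random_matrix.
  - apply: le_integrable (integrable_coordX i j K) => //=.
      apply/measurable_EFinP; do 2 apply: measurable_funX.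
      exact: coord_measurable_random_matrix.
    move=> w _; have Y0 := sqr_ge0 (Y w i j).
    have Y1 : 0 <= 1 + Y w i j ^+ 2 by rewrite addr_ge0.
    rewrite lee_fin !ger0_norm ?(exprn_ge0 _ Y0) ?(exprn_ge0 _ Y1)//.
    by apply: lerXn2r; rewrite ?nnegrE ?lerDr.
apply: (@le_integrable _ _ _ _ _ measurableT _
  (fun w => (C%:E * (mx_size (Y w) ^+ N)%:E)%E)) => //=.
- by apply/measurable_EFinP; apply: mf; exact: coord_measurable_random_matrix.
- by move=> w _; rewrite lee_fin (le_trans (fC _))// ler_norm.
- exact: integrableZl.
Qed.

End GaussianMatrix.

Lemma is_derive_shift (R : realType) (g : R -> R) x dg :
  is_derive (0 : R) 1 (fun t => g (x + t)) dg -> is_derive x 1 g dg.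
Proof.
move=> h; have -> : g = (fun t => g (x + t)) \o (fun y => y - x).
  by apply/funext => y /=; rewrite subrKC.
have h' : is_derive (x - x) 1 (fun t => g (x + t)) dg by rewrite subrr.
have := is_derive1_comp (f := fun t => g (x + t)) (g := fun y => y - x) (x := x).
move=> /(_ dg 1); rewrite mulr1; apply=> //.
by apply: is_derive_eq; rewrite subr0.
Qed.

Lemma continuous_shift (R : realType) (g : R -> R) (x : R) :
  {for 0, continuous (fun t => g (x + t))} -> {for x, continuous g}.
Proof.
rewrite /prop_for /continuous_at addr0 => h.
have -> : g = (fun t => g (x + t)) \o (fun y => y - x).
  by apply/funext => y /=; rewrite subrKC.
apply: cvg_comp; last by rewrite /= subrKC; exact: h.
have : (y - x) @[y --> x] --> x - x by apply: cvgB; [exact: cvg_id|exact: cvg_cst].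
by rewrite subrr.
Qed.

Lemma Rintegral_sum d (T : measurableType d) (R : realType)
    (mu : {measure set T -> \bar R}) I (r : seq I) (F : I -> T -> R) :
  (forall i, mu.-integrable setT (EFin \o F i)) ->
  mu.-integrable setT (EFin \o (fun w => \sum_(i <- r) F i w)) /\
  \int[mu]_w (\sum_(i <- r) F i w) = \sum_(i <- r) \int[mu]_w F i w.
Proof.
move=> intF; elim: r => [|i r [ihi ihe]].
  have -> : (fun w => \sum_(i <- [::]) F i w) = cst 0.
    by apply/funext => w; rewrite big_nil.
  by rewrite big_nil Rintegral_cst// mul0r; split=> //; exact: integrable0.
have -> : (fun w => \sum_(i <- i :: r) F i w) = (fun w => F i w + \sum_(i <- r) F i w).
  by apply/funext => w; rewrite big_cons.
split; last by rewrite big_cons RintegralD// ihe.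
exact: (integrableD measurableT (intF i) ihi).
Qed.

Section SteinMatrix.
Context {d : measure_display} {T : measurableType d} {R : realType}.
Variable P : probability T R.

(* All that is used about a Gaussian matrix of variance v; being stable under
   rotation (stein_mulmxr), it spares computing the law of X V. *)
Definition stein_matrix l n (v : R) (Y : T -> 'M[R]_(l, n)) := [/\
  coord_measurable Y,
  (forall f, tame f -> P.-integrable setT (EFin \o f \o Y)) &
  (forall f df i j, nice f df ->
     \int[P]_w (Y w i j * f (Y w)) = v * \int[P]_w (df (Y w) i j))].

Section Gaussian.
Variables (l n : nat) (X : 'I_l -> 'I_n -> {RV P >-> R}) (s : R).
Hypothesis indX : mutually_independent (fun ij : 'I_l * 'I_n => X ij.1 ij.2).
Hypothesis lawX : forall i j (B : set R), measurable B ->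
  distribution P (X i j) B = normal_prob 0 s B.
Hypothesis s0 : s != 0.
Let Y := random_matrix X.

Lemma nice_upd_stein (f : 'M[R]_(l, n) -> R) df (M : 'M[R]_(l, n)) i j : nice f df ->
  (\int[normal_prob 0 s]_x (x * f (upd M i j x))%:E =
   \int[normal_prob 0 s]_x (s ^+ 2 * df (upd M i j x) i j)%:E)%E.
Proof.
move=> [[_ /growthE[C [N [C0 fC]]]] /(_ i j)[_ /growthE[D [K [D0 dfD]]]] fD cdf].
have sz x : 0 <= 1 + x ^+ 2 :> R by rewrite addr_ge0 ?sqr_ge0.
(* The one-variable formula asks for a single polynomial bound valid for the function and its
   derivative. *)
pose E := (C + D) * mx_size M ^+ (N + K).
have bnd (g : 'M[R]_(l, n) -> R) B L : 0 <= B -> B <= C + D -> (L <= N + K)%N ->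
    (forall M, `|g M| <= B * mx_size M ^+ L) ->
    forall x, `|g (upd M i j x)| <= E * (1 + x ^+ 2) ^+ (N + K).
  move=> B0 BCD LNK gB x; apply: le_trans (gB _) _.
  rewrite /E -mulrA -exprMn ler_pM ?exprn_ge0 ?mx_size_ge0//.
  have u1 : 1 <= mx_size M * (1 + x ^+ 2).
    by apply: le_trans (mx_size_upd M i j x); exact: mx_size_ge1.
  apply: (@le_trans _ _ ((mx_size M * (1 + x ^+ 2)) ^+ L)).
    by rewrite lerXn2r ?nnegrE ?mulr_ge0 ?mx_size_ge0 ?mx_size_upd.
  by rewrite ler_weXn2l.
have dC : continuous (fun x => df (upd M i j x) i j).
  move=> x; have := cdf (upd M i j x) (delta_mx i j) i j; rewrite /prop_for.
  under eq_fun do rewrite -upd_line.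
  exact: (@continuous_shift _ (fun y => df (upd M i j y) i j)).
have bdf := bnd (fun M => df M i j) D K D0 _ _ dfD.
under [RHS]eq_integral do rewrite EFinM.
rewrite integralZl//; last first.
  apply: (@integrable_growth_normal_prob _ _ (N + K) E) => //.
    exact: continuous_measurable_fun.
  by apply: bdf; rewrite ?lerDr ?leq_addl.
apply: (@normal_stein _ _ _ _ (N + K) E) => // [x|x|x].
- have := fD (upd M i j x) (delta_mx i j).
  have -> : \sum_a \sum_b df (upd M i j x) a b * delta_mx i j a b = df (upd M i j x) i j.
    rewrite (bigD1 i)//= (bigD1 j)//= mxE !eqxx mulr1.
    rewrite big1 ?addr0; last by move=> b bj; rewrite mxE (negbTE bj) andbF mulr0.
    rewrite big1 ?addr0// => a ai.
    by rewrite big1// => b _; rewrite mxE (negbTE ai) mulr0.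
  by under eq_fun do rewrite -upd_line; exact: is_derive_shift.
- by apply: (bnd f C N) => //; rewrite ?lerDl ?leq_addr.
- by apply: bdf; rewrite ?lerDr ?leq_addl.
Qed.

(** After resampling entry (i, j), both sides are iterated integrals whose inner variable is that
    entry alone, the rest of the matrix being frozen; there the one-variable formula applies. *)
Lemma gaussian_stein : stein_matrix (s ^+ 2) Y.
Proof.
have int := integrable_tame lawX s0.
split; [exact: coord_measurable_random_matrix|exact: int|].
move=> f df i j nf; have [tf tdf _ _] := nf.
have tF : tame (fun M => M i j * f M) by apply: tameM => //; exact: tame_coord.
have [iF eF] := resample indX lawX i j tF.1 (int _ tF).
have tD : tame (fun M => s ^+ 2 * df M i j) by exact: (tameM (tame_cst _) (tdf i j)).
have [iD eD] := resample indX lawX i j tD.1 (int _ tD).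
rewrite -RintegralZl//; last exact: (int _ (tdf i j)).
congr fine; rewrite eF eD -(integral21_prod_meas1 iF) -(integral21_prod_meas1 iD).
apply: eq_integral => w _; rewrite /fubini_G/=.
rewrite -(nice_upd_stein (random_matrix X w) i j nf); apply: eq_integral => x _.
by rewrite mxE eqxx.
Qed.

End Gaussian.

Section Rotation.
Variables (l n p : nat) (v : R) (Y : T -> 'M[R]_(l, n)) (V : 'M[R]_(n, p)).
Hypotheses (steinY : stein_matrix v Y) (VV : V^T *m V = 1%:M).

Lemma tame_comp l' n' (f : 'M[R]_(l, p) -> R) (L : 'M[R]_(l', n') -> 'M[R]_(l, p)) :
  (forall i j, tame (fun M => L M i j)) -> tame f -> tame (fun M => f (L M)).
Proof.
move=> tL [mf /growthE[C [N [C0 fC]]]]; split.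
  by move=> d' T' Z mZ; apply: mf => i j; apply: (tL i j).1.
have [_ /growthE[D [K [D0 szD]]]] : tame (fun M => mx_size (L M)).
  apply: tameD; first exact: tame_cst.
  by do 2 apply: tame_sum => ?; exact: tameX.
exists (C * D ^+ N), (K * N)%N => M; apply: le_trans (fC _) _.
rewrite -mulrA ler_wpM2l// exprM -exprMn lerXn2r ?nnegrE ?mx_size_ge0//.
  by rewrite mulr_ge0// exprn_ge0// mx_size_ge0.
by apply: le_trans (szD M); exact: ler_norm.
Qed.

Let tameV i j : tame (fun M : 'M[R]_(l, n) => (M *m V) i j).
Proof.
under eq_fun do rewrite mxE; apply: tame_sum => a.
by apply: tameM; [exact: tame_coord|exact: tame_cst].
Qed.

Lemma nice_mulmxr f df : nice f df ->
  nice (fun M : 'M[R]_(l, n) => f (M *m V)) (fun M => df (M *m V) *m V^T).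
Proof.
move=> [tf tdf fD cdf]; split.
- exact: tame_comp.
- move=> i j; under eq_fun do rewrite mxE; apply: tame_sum => a.
  by apply: tameM; [exact: (tame_comp tameV (tdf i a))|exact: tame_cst].
- move=> M H; have := fD (M *m V) (H *m V).
  rewrite (_ : (fun t : R => f (M *m V + t *: (H *m V))) = (fun t => f ((M + t *: H) *m V))).
    move=> h; apply: is_derive_eq; apply: eq_bigr => i _.
    under eq_bigr do rewrite mxE mulr_sumr.
    rewrite exchange_big/=; apply: eq_bigr => j _; rewrite mxE mulr_suml.
    by apply: eq_bigr => a _; rewrite mxE mulrA mulrAC.
  by apply/funext => t; rewrite mulmxDl scalemxAl.
- move=> M H i j; rewrite /prop_for; under eq_fun do rewrite mxE.
  apply: cvg_big => [|a _]; first exact: add_continuous.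
  apply: cvgM; last exact: cvg_cst.
  have := cdf (M *m V) (H *m V) i a.
  by rewrite /prop_for; under eq_fun do rewrite scalemxAl -mulmxDl.
Qed.

(** Column j of Y V is the combination of the columns of Y with weights V_aj, and the gradient of
    f(. V) is df V^T; the two factors of V meet in V^T V = 1. As [V] may be rectangular with
    orthonormal columns, selecting some columns of Y is a special case. *)
Lemma stein_mulmxr : stein_matrix v (fun w => Y w *m V).
Proof.
have [mY iY sY] := steinY; split.
- by move=> i j; exact: (tameV i j).1.
- by move=> f tf; exact: (iY _ (tame_comp tameV tf)).
- move=> f df i j nf; have nV := nice_mulmxr nf; have [tf tdf _ _] := nf.
  have [tfV tdfV _ _] := nV.
  have tF a : tame (fun M => M i a * f (M *m V) * V a j).
    apply: tameM; last exact: tame_cst.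
    by apply: tameM => //; exact: tame_coord.
  have -> : (fun w => (Y w *m V) i j * f (Y w *m V)) =
      (fun w => \sum_a Y w i a * f (Y w *m V) * V a j).
    apply/funext => w; rewrite mxE mulr_suml.
    by apply: eq_bigr => a _; rewrite mulrAC.
  rewrite (proj2 (Rintegral_sum _ (fun a => iY _ (tF a)))).
  transitivity (\sum_a (v * \int[P]_w ((df (Y w *m V) *m V^T) i a)) * V a j).
    apply: eq_bigr => a _; rewrite RintegralZr//; last first.
      by apply: (iY (fun M => M i a * f (M *m V))); apply: tameM => //; exact: tame_coord.
    by rewrite (sY _ _ i a nV).
  under eq_bigr do rewrite -mulrA.
  rewrite -mulr_sumr; congr (v * _).
  transitivity (\sum_a \int[P]_w ((df (Y w *m V) *m V^T) i a * V a j)).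
    by apply: eq_bigr => a _; rewrite RintegralZr//; exact: (iY _ (tdfV i a)).
  have tG a : tame (fun M => (df (M *m V) *m V^T) i a * V a j).
    by apply: tameM; [exact: tdfV|exact: tame_cst].
  rewrite -(proj2 (Rintegral_sum _ (fun a => iY _ (tG a)))).
  apply: eq_Rintegral => w _.
  transitivity ((df (Y w *m V) *m V^T *m V) i j); first by rewrite [RHS]mxE.
  by rewrite -mulmxA VV mulmx1.
Qed.

End Rotation.
End SteinMatrix.

Lemma Rintegral_probability_cst d (T : measurableType d) (R : realType)
    (P : probability T R) (c : R) : \int[P]_w c = c.
Proof. by rewrite Rintegral_cst// [X in fine X](@probability_setT _ _ _ P) mulr1. Qed.

(** * Gaussian and chi-square moments of one row *)

Section SteinMoments.
Context {d : measure_display} {T : measurableType d} {R : realType}.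
Variables (P : probability T R) (l n : nat) (v : R) (Y : T -> 'M[R]_(l, n)).
Hypothesis steinY : stein_matrix P v Y.

Lemma stein_divergence (I : finType) (ij : I -> 'I_l * 'I_n)
    (F : I -> 'M[R]_(l, n) -> R) dF : (forall k, nice (F k) (dF k)) ->
  \int[P]_w (\sum_k Y w (ij k).1 (ij k).2 * F k (Y w)) =
  v * \int[P]_w (\sum_k dF k (Y w) (ij k).1 (ij k).2).
Proof.
move=> nF; have [_ iY sY] := steinY.
have tF k : tame (fun M => M (ij k).1 (ij k).2 * F k M).
  by apply: tameM; [exact: tame_coord|case: (nF k)].
have tD k : tame (fun M => dF k M (ij k).1 (ij k).2) by case: (nF k).
rewrite (proj2 (Rintegral_sum _ (fun k => iY _ (tF k)))).
rewrite (proj2 (Rintegral_sum _ (fun k => iY _ (tD k)))) mulr_sumr.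
by apply: eq_bigr => k _; exact: sY.
Qed.

Section RowMoments.
Variable i0 : 'I_l.

Definition row_form (u : 'cV[R]_n) (M : 'M[R]_(l, n)) : R := \sum_j u j 0 * M i0 j.
Definition row_sqr (M : 'M[R]_(l, n)) : R := \sum_j M i0 j ^+ 2.

Lemma nice_row_form u : nice (row_form u) (fun=> \sum_j u j 0 *: delta_mx i0 j).
Proof. by apply: nice_sum => j; apply: niceZ; exact: nice_coord. Qed.

Lemma nice_row_sqr : nice row_sqr
  (fun M => \sum_j (2%:R * M i0 j ^+ 1) *: delta_mx i0 j).
Proof. by apply: nice_sum => j; apply: (niceX 2); exact: nice_coord. Qed.

Let row_coef (c : 'I_n -> R) j : (\sum_k c k *: delta_mx i0 k : 'M[R]_(l, n)) i0 j = c j.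
Proof.
rewrite summxE (bigD1 j)//= !mxE !eqxx mulr1 big1 ?addr0// => k kj.
by rewrite !mxE eq_sym (negbTE kj) andbF mulr0.
Qed.

(** The field u_j (u . row)^(2a+1) has divergence (2a+1) |u|^2 (u . row)^(2a); the product is the
    double factorial (2a-1)!!. *)
Lemma row_form_moment u a :
  \int[P]_w (row_form u (Y w) ^+ (2 * a)) =
  (\prod_(j < a) (2 * j + 1)%:R) * (v * \sum_j u j 0 ^+ 2) ^+ a.
Proof.
elim: a => [|a ih].
  rewrite muln0 big_ord0 expr0 mulr1; under eq_Rintegral do rewrite expr0.
  by rewrite Rintegral_probability_cst.
have nF j := niceZ (u j 0) (niceX (2 * a).+1 (nice_row_form u)).
have := stein_divergence (fun j => (i0, j)) nF => /=.
under eq_Rintegral => w _.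
  have -> : \sum_k Y w i0 k * (u k 0 * row_form u (Y w) ^+ (2 * a).+1) =
      row_form u (Y w) ^+ (2 * a.+1).
    rewrite mulnS !addSn add0n [in RHS]exprS {2}/row_form mulr_suml.
    by apply: eq_bigr => k _; rewrite mulrCA mulrA.
  over.
move=> ->.
have [_ iY _] := steinY.
under eq_Rintegral => w _.
  have -> : \sum_k (u k 0 *: (((2 * a).+1%:R * row_form u (Y w) ^+ (2 * a)) *:
      \sum_j u j 0 *: delta_mx i0 j)) i0 k =
      ((2 * a).+1%:R * (\sum_j u j 0 ^+ 2)) * row_form u (Y w) ^+ (2 * a).
    under eq_bigr => k _ do rewrite !mxE row_coef.
    rewrite mulr_sumr mulr_suml; apply: eq_bigr => k _; rewrite expr2; ring.
  over.
rewrite RintegralZl//; last by apply: (iY _ (tameX _ _)); case: (nice_row_form u).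
by rewrite ih big_ord_recr/= exprS addn1; ring.
Qed.

(** The field row_j |row|^(2a) has divergence (n + 2a) |row|^(2a): these are the moments of a scaled
    chi-square variable with n degrees of freedom. *)
Lemma row_sqr_moment a :
  \int[P]_w (row_sqr (Y w) ^+ a) = \prod_(j < a) (v * (n + 2 * j)%:R).
Proof.
elim: a => [|a ih].
  rewrite big_ord0; under eq_Rintegral do rewrite expr0.
  by rewrite Rintegral_probability_cst.
have nF j := niceM (nice_coord i0 j) (niceX a nice_row_sqr).
have := stein_divergence (fun j => (i0, j)) nF => /=.
under eq_Rintegral => w _.
  have -> : \sum_k Y w i0 k * (Y w i0 k * row_sqr (Y w) ^+ a) = row_sqr (Y w) ^+ a.+1.
    rewrite [in RHS]exprS {2}/row_sqr mulr_suml.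
    by apply: eq_bigr => k _; rewrite mulrA expr2.
  over.
move=> ->.
have [_ iY _] := steinY.
under eq_Rintegral => w _.
  have -> : \sum_k (Y w i0 k *: ((a%:R * row_sqr (Y w) ^+ a.-1) *:
      \sum_j (2%:R * Y w i0 j ^+ 1) *: delta_mx i0 j) +
      row_sqr (Y w) ^+ a *: delta_mx i0 k) i0 k = (n + 2 * a)%:R * row_sqr (Y w) ^+ a.
    under eq_bigr => k _ do rewrite !mxE row_coef !eqxx mulr1.
    rewrite big_split/= sumr_const card_ord -[_ *+ n]mulr_natl natrD mulrDl [RHS]addrC.
    congr (_ + _).
    transitivity (2%:R * (a%:R * row_sqr (Y w) ^+ a.-1) * \sum_k Y w i0 k ^+ 2).
      by rewrite mulr_sumr; apply: eq_bigr => k _; rewrite expr1 expr2; ring.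
    rewrite -/(row_sqr (Y w)) natrM.
    by case: (a) => [|b]; [rewrite !(mul0r, mulr0)|rewrite /= exprS; ring].
  over.
rewrite RintegralZl//; last by apply: (iY _ (tameX _ _)); case: nice_row_sqr.
by rewrite ih big_ord_recr/=; ring.
Qed.

End RowMoments.
End SteinMoments.

(** * The regularized resolvent *)

Section ColumnNorm.
Context {R : realType}.

Definition sqn n (x : 'cV[R]_n) : R := \sum_i x i 0 ^+ 2.
Definition dotv n (x y : 'cV[R]_n) : R := \sum_i x i 0 * y i 0.

Lemma sqn_ge0 n (x : 'cV[R]_n) : 0 <= sqn x.
Proof. by apply: sumr_ge0 => i _; exact: sqr_ge0. Qed.

Lemma dotvE n (x y : 'cV[R]_n) : dotv x y = (x^T *m y) 0 0.
Proof. by rewrite !mxE; apply: eq_bigr => i _; rewrite mxE. Qed.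

Lemma dotvv n (x : 'cV[R]_n) : dotv x x = sqn x.
Proof. by apply: eq_bigr => i _; rewrite expr2. Qed.

Lemma dotvC n (x y : 'cV[R]_n) : dotv x y = dotv y x.
Proof. by apply: eq_bigr => i _; rewrite mulrC. Qed.

Lemma dotvDl n (x y z : 'cV[R]_n) : dotv (x + y) z = dotv x z + dotv y z.
Proof. by rewrite -big_split; apply: eq_bigr => i _; rewrite mxE mulrDl. Qed.

Lemma dotvDr n (x y z : 'cV[R]_n) : dotv z (x + y) = dotv z x + dotv z y.
Proof. by rewrite dotvC dotvDl !(dotvC _ z). Qed.

Lemma dotvZl n (c : R) (x y : 'cV[R]_n) : dotv (c *: x) y = c * dotv x y.
Proof. by rewrite mulr_sumr; apply: eq_bigr => i _; rewrite mxE mulrA. Qed.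

Lemma dotvZr n (c : R) (x y : 'cV[R]_n) : dotv x (c *: y) = c * dotv x y.
Proof. by rewrite dotvC dotvZl dotvC. Qed.

Lemma dotv_mul m n (A : 'M[R]_(m, n)) (x : 'cV[R]_m) (y : 'cV[R]_n) :
  dotv x (A *m y) = dotv (A^T *m x) y.
Proof. by rewrite !dotvE trmx_mul trmxK mulmxA. Qed.

Lemma sqn_eq0 n (x : 'cV[R]_n) : (sqn x == 0) = (x == 0).
Proof.
apply/idP/eqP => [|->]; last by rewrite /sqn big1// => i _; rewrite mxE expr0n.
rewrite psumr_eq0 => [/allP h|i _]; last exact: sqr_ge0.
apply/colP => i; rewrite mxE; apply/eqP.
by have := h i (mem_index_enum i); rewrite /= sqrf_eq0.
Qed.

Lemma coord_sqr_le_sqn n (x : 'cV[R]_n) i : x i 0 ^+ 2 <= sqn x.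
Proof.
by rewrite /sqn (bigD1 i)//= lerDl sumr_ge0// => j _; exact: sqr_ge0.
Qed.

Lemma sqnZ n (c : R) (x : 'cV[R]_n) : sqn (c *: x) = c ^+ 2 * sqn x.
Proof. by rewrite -!dotvv dotvZl dotvZr mulrA expr2. Qed.

Lemma sqnD n (x y : 'cV[R]_n) : sqn (x + y) = sqn x + 2 * dotv x y + sqn y.
Proof. by rewrite -!dotvv dotvDl !dotvDr (dotvC y x); ring. Qed.

End ColumnNorm.

Section Resolvent.
Context {R : realType} (l r m : nat) (eps : R).
Hypothesis eps_gt0 : 0 < eps.
Implicit Types (M H : 'M[R]_(l, r + m)) (z : 'cV[R]_r).

(* With U the first r columns of M, eps makes U^T U + eps invertible for every M,
   so that its inverse is smooth, unlike the pseudo-inverse of U. *)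
Definition gram M : 'M[R]_r := (lsubmx M)^T *m lsubmx M + eps%:M.
Definition rsv M : 'M[R]_r := invmx (gram M).

Lemma gram_sym M : (gram M)^T = gram M.
Proof. by rewrite /gram linearD /= trmx_mul trmxK tr_scalar_mx. Qed.

Lemma dotv_gram M (y : 'cV[R]_r) : dotv y (gram M *m y) = sqn (lsubmx M *m y) + eps * sqn y.
Proof.
by rewrite /gram mulmxDl dotvDr -mulmxA dotv_mul trmxK dotvv mul_scalar_mx dotvZr dotvv.
Qed.

Lemma gram_unit M : gram M \in unitmx.
Proof.
rewrite -row_free_unit; apply/row_freeP.
suff h : forall y : 'cV[R]_r, gram M *m y = 0 -> y = 0.
  have : \rank (cokermx (gram M)) == 0%N.
    rewrite mxrank_eq0; apply/eqP/matrixP => i j.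
    have := h (cokermx (gram M) *m delta_mx j 0); rewrite mulmxA mulmx_coker mul0mx.
    by move=> /(_ erefl); rewrite -colE => /colP/(_ i); rewrite !mxE.
  rewrite mxrank_coker subn_eq0 => rk.
  have : row_free (gram M) by rewrite /row_free eqn_leq rank_leq_row.
  by move/row_freeP.
move=> y yE; have := dotv_gram M y; rewrite yE.
rewrite (_ : dotv y 0 = 0); last by rewrite /dotv big1// => i _; rewrite mxE mulr0.
move=> /esym/eqP; rewrite paddr_eq0 ?mulr_ge0 ?sqn_ge0 ?ltW// => /andP[_].
by rewrite mulf_eq0 gt_eqF//= sqn_eq0 => /eqP.
Qed.

Lemma gram_rsv M : gram M *m rsv M = 1%:M. Proof. exact: mulmxV (gram_unit M). Qed.
Lemma rsv_gram M : rsv M *m gram M = 1%:M. Proof. exact: mulVmx (gram_unit M). Qed.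

Lemma rsv_sym M : (rsv M)^T = rsv M.
Proof. by rewrite /rsv trmx_inv gram_sym. Qed.

Lemma rsvC M a b : rsv M a b = rsv M b a.
Proof. by rewrite -{1}rsv_sym mxE. Qed.

Definition rvec z M : 'cV[R]_r := rsv M *m z.
Definition xvec z M : 'cV[R]_l := lsubmx M *m rvec z M.
(** This is z^T R z of the overview; without the regularization it would equal |U R z|^2. *)
Definition phi z M : R := dotv z (rvec z M).

Lemma phiE z M : phi z M = sqn (xvec z M) + eps * sqn (rvec z M).
Proof. by rewrite -dotv_gram /rvec mulmxA gram_rsv mul1mx dotvC. Qed.

Lemma phi_ge0 z M : 0 <= phi z M.
Proof. by rewrite phiE addr_ge0 ?mulr_ge0 ?sqn_ge0// ltW. Qed.

Lemma sqn_xvec_le z M : sqn (xvec z M) <= phi z M.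
Proof. by rewrite phiE lerDl mulr_ge0 ?sqn_ge0// ltW. Qed.

Lemma sqn_rvec_le z M : eps * sqn (rvec z M) <= phi z M.
Proof. by rewrite phiE lerDr sqn_ge0. Qed.

(** Expand |z - eps R z|^2 >= 0 and bound eps |R z|^2 by z^T R z. *)
Lemma phi_le z M : eps * phi z M <= sqn z.
Proof.
have := sqn_ge0 (z + (- eps) *: rvec z M).
rewrite sqnD dotvZr sqnZ sqrrN -/(phi z M).
have := ler_wpM2l (ltW eps_gt0) (sqn_rvec_le z M); rewrite expr2; lra.
Qed.

Lemma xvec_lsubmx z M : dotv (xvec z M) (lsubmx M *m z) = sqn z - eps * phi z M.
Proof.
rewrite dotv_mul /xvec mulmxA (_ : _ *m lsubmx M = gram M - eps%:M); last first.
  by rewrite /gram addrK.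
rewrite mulmxBl /rvec mulmxA gram_rsv mul1mx mul_scalar_mx -scaleN1r.
by rewrite dotvDl scaleN1r -scaleNr dotvZl dotvv dotvC mulNr.
Qed.

(** The bound blows up as [eps] tends to 0, but it only serves to place the resolvent among the tame
    functions and to show its continuity; no final estimate contains it. *)
Lemma rsv_entry_le M a b : `|rsv M a b| <= eps^-1.
Proof.
have e2 : eps ^+ 2 * sqn (rvec (delta_mx b 0) M) <= 1.
  apply: (@le_trans _ _ (sqn (delta_mx b 0 : 'cV[R]_r))).
    by rewrite expr2 -mulrA (le_trans _ (phi_le _ M))// ler_pM2l// sqn_rvec_le.
  rewrite /sqn (bigD1 b)//= big1 => [|i ib]; first by rewrite mxE !eqxx expr1n addr0.
  by rewrite mxE (negbTE ib) expr0n.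
have -> : rsv M a b = rvec (delta_mx b 0) M a 0 by rewrite /rvec -colE mxE.
rewrite -[_^-1]mul1r ler_pdivlMr// -(@expr_le1 _ 2)//; last first.
  by rewrite mulr_ge0// ltW.
rewrite exprMn real_normK ?num_real// mulrC (le_trans _ e2)//.
by rewrite ler_wpM2l ?sqr_ge0// coord_sqr_le_sqn.
Qed.

Lemma rsv_trace_ge0 M : 0 <= \tr (rsv M).
Proof.
apply: sumr_ge0 => i _; have := phi_ge0 (delta_mx i 0) M.
rewrite /phi /rvec -colE /dotv (bigD1 i)//= big1 => [|j ji].
  by rewrite !mxE !eqxx mul1r addr0.
by rewrite mxE (negbTE ji) mul0r.
Qed.

(** U R U^T is the regularized projector onto the columns of U; its trace is r - eps tr R. *)
Lemma hat_trace_le M : \tr (lsubmx M *m rsv M *m (lsubmx M)^T) <= r%:R.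
Proof.
rewrite mxtrace_mulC mulmxA (_ : _ *m lsubmx M = gram M - eps%:M); last first.
  by rewrite /gram addrK.
rewrite mulmxBl gram_rsv mul_scalar_mx linearB/= mxtrace1 linearZ/=.
by rewrite gerBl mulr_ge0 ?rsv_trace_ge0// ltW.
Qed.

End Resolvent.

(** Caratheodory's form of the derivative, suited to the resolvent because the resolvent identity
    gives its difference quotient in closed form. *)
Lemma is_derive_increment (R : realType) (f g : R -> R) :
  (forall t, f t = f 0 + t * g t) -> {for 0, continuous g} ->
  is_derive (0 : R) 1 f (g 0).
Proof.
move=> fE cg.
have h : (h^-1 *: ((f \o shift 0) (h *: 1) - f 0)) @[h --> 0^'] --> g 0.
  apply: (@cvg_trans _ (g h @[h --> 0^'])); last exact: cvg_within_filter cg.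
  apply: near_eq_cvg; near=> h => /=.
  rewrite addr0 /GRing.scale/= mulr1 fE addrC addKr mulKf//.
  by near: h; exact: nbhs_dnbhs_neq.
by apply: DeriveDef; [exact: cvgP h|exact: cvg_lim h].
Unshelve. all: by end_near. Qed.

Section TameDeterminant.
Context {R : realType} (l n : nat).

Lemma tame_prod I (s : seq I) (F : I -> 'M[R]_(l, n) -> R) :
  (forall i, tame (F i)) -> tame (fun M => \prod_(i <- s) F i M).
Proof.
move=> tF; elim: s => [|i s ih].
  by under eq_fun do rewrite big_nil; exact: tame_cst.
by under eq_fun do rewrite big_cons; exact: tameM.
Qed.

Lemma tame_det k (L : 'M[R]_(l, n) -> 'M[R]_k) :
  (forall i j, tame (fun M => L M i j)) -> tame (fun M => \det (L M)).
Proof.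
move=> tL; rewrite /determinant; apply: tame_sum => s; apply: tameM.
  exact: tame_cst.
by apply: tame_prod => i; exact: tL.
Qed.

(** The inverse is written x (x^2)^(-1), with a nonnegative base for the real power function; both
    expressions are 0 at x = 0. *)
Lemma measurable_fun_invr d (T : measurableType d) (g : T -> R) :
  measurable_fun setT g -> measurable_fun setT (fun w => (g w)^-1).
Proof.
move=> mg; have -> : (fun w => (g w)^-1) = (fun w => g w * (g w ^+ 2) `^ (-1)).
  apply/funext => w; rewrite powR_inv1 ?sqr_ge0// expr2 invfM.
  by have [->|g0] := eqVneq (g w) 0; rewrite ?invr0 ?mul0r// mulVKf.
apply: measurable_funM => //.
apply: (@measurableT_comp _ _ _ _ _ _ (@powR R ^~ (-1)) _ (fun w => g w ^+ 2)) => //.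
exact: measurable_funX.
Qed.

End TameDeterminant.

Section NiceResolvent.
Context {R : realType} (l r m : nat) (eps : R).
Hypothesis eps_gt0 : 0 < eps.
Implicit Types (M H : 'M[R]_(l, r + m)) (z : 'cV[R]_r).
Local Notation rsv := (@rsv R l r m eps).
Local Notation gram := (@gram R l r m eps).

Let tame_lsubmx i j : tame (fun M : 'M[R]_(l, r + m) => lsubmx M i j).
Proof. by under eq_fun do rewrite mxE; exact: tame_coord. Qed.

Let tame_gram i j : tame (fun M : 'M[R]_(l, r + m) => gram M i j).
Proof.
rewrite /gram; under eq_fun do rewrite !mxE.
apply: tameD; last exact: tame_cst.
under eq_fun do under eq_bigr do rewrite mxE.
by apply: tame_sum => k; exact: tameM.
Qed.

(** Growth is the uniform bound by 1/eps. Measurability comes from Cramer's rule, the determinant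
    and the cofactors being polynomials in the entries. *)
Lemma tame_rsv a b : tame (fun M : 'M[R]_(l, r + m) => rsv M a b).
Proof.
split; last first.
  exists eps^-1, 0%N => M; rewrite expr0 mulr1; exact: rsv_entry_le.
have -> : (fun M => rsv M a b) = (fun M => (\det (gram M))^-1 * cofactor (gram M) b a).
  by apply/funext => M; rewrite /rsv /invmx gram_unit// !mxE.
move=> d T Y mY; apply: measurable_funM.
  by apply: measurable_fun_invr; exact: (tame_det tame_gram).1.
rewrite /cofactor; apply: measurable_funM; first exact: measurable_cst.
have tc : tame (fun M => \det (row' b (col' a (gram M)))).
  by apply: tame_det => i j; under eq_fun do rewrite 2!mxE; exact: tame_gram.
exact: tc.1.
Qed.

Let gram_line M H t : gram (M + t *: H) = gram M + t *:
  ((lsubmx H)^T *m lsubmx M + (lsubmx M)^T *m lsubmx H +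
   t *: ((lsubmx H)^T *m lsubmx H)).
Proof.
have -> : gram (M + t *: H) = (lsubmx M + t *: lsubmx H)^T *m
    (lsubmx M + t *: lsubmx H) + eps%:M by rewrite -linearZ/= -linearD.
rewrite [(_ + _)^T]linearD/= linearZ/= mulmxDl !mulmxDr /gram.
rewrite [RHS]addrAC -!scalemxAl -!scalemxAr !scalerDr; congr (_ + _).
by rewrite -!addrA; congr (_ + _); rewrite addrCA.
Qed.

(** By the resolvent identity R' - R = - R' (G' - G) R, with G the Gram matrix, this is minus the
    difference quotient along H; at t = 0 it gives the derivative. *)
Let slope M H t := rsv (M + t *: H) *m
   ((lsubmx H)^T *m lsubmx M + (lsubmx M)^T *m lsubmx H +
   t *: ((lsubmx H)^T *m lsubmx H)) *m rsv M.

Let rsv_line M H t : rsv (M + t *: H) = rsv M - t *: slope M H t.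
Proof.
rewrite /slope; set K := (X in _ *m X *m _).
have -> : t *: (rsv (M + t *: H) *m K *m rsv M) =
    rsv (M + t *: H) *m (gram (M + t *: H) - gram M) *m rsv M.
  by rewrite gram_line (addrC (gram M)) addrK -scalemxAr -scalemxAl.
rewrite mulmxBr mulmxBl rsv_gram// mul1mx -mulmxA gram_rsv// mulmx1.
by rewrite opprB subrKC.
Qed.

Let rsv_line_entry M H t a b :
  rsv (M + t *: H) a b = rsv M a b - t * slope M H t a b.
Proof.
by rewrite rsv_line mxE; congr (_ + _); rewrite mxE; congr (- _); rewrite mxE.
Qed.

Let cvg_mulmx p q s (A : R -> 'M[R]_(p, q)) (B : R -> 'M[R]_(q, s)) :
  (forall i j, {for 0, continuous (fun t => A t i j)}) ->
  (forall i j, {for 0, continuous (fun t => B t i j)}) ->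
  forall i j, {for 0, continuous (fun t => (A t *m B t) i j)}.
Proof.
move=> cA cB i j; rewrite /prop_for; under eq_fun do rewrite mxE.
apply: cvg_big => [|k _]; first exact: add_continuous.
by apply: cvgM; [exact: cA|exact: cB].
Qed.

Let continuous_entry M H i j : {for 0, continuous (fun t : R => (M + t *: H) i j)}.
Proof. exact: nice_continuous (nice_coord i j). Qed.

Let rsv_continuous M H a b : {for 0, continuous (fun t : R => rsv (M + t *: H) a b)}.
Proof.
pose K t := (lsubmx H)^T *m lsubmx M + (lsubmx M)^T *m lsubmx H +
   t *: ((lsubmx H)^T *m lsubmx H).
pose B i j := `|((lsubmx H)^T *m lsubmx M + (lsubmx M)^T *m lsubmx H) i j| +
  `|((lsubmx H)^T *m lsubmx H) i j|.
have KB t i j : `|t| <= 1 -> `|K t i j| <= B i j.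
  move=> t1; rewrite /K mxE (le_trans (ler_normD _ _))// lerD2l mxE normrM.
  by rewrite ler_piMl.
pose C := \sum_j (\sum_k eps^-1 * B k j) * eps^-1.
(* The uniform bound on the moving resolvent bounds the slope near 0, so the increment of the
   resolvent is O(t) and continuity follows before anything is differentiated. *)
have slopeB t : `|t| <= 1 -> `|slope M H t a b| <= C.
  move=> t1; rewrite /slope -/(K t) mxE (le_trans (ler_norm_sum _ _ _))//.
  apply: ler_sum => j _; rewrite normrM ler_pM ?rsv_entry_le// mxE.
  rewrite (le_trans (ler_norm_sum _ _ _))//; apply: ler_sum => k _.
  by rewrite normrM ler_pM ?rsv_entry_le ?KB.
have C0 : 0 <= C by apply: le_trans (slopeB 0 _); rewrite ?normr0.
rewrite /prop_for /continuous_at scale0r addr0.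
apply/cvgrPdist_lt => e e0; near=> t.
rewrite rsv_line_entry opprB subrKC normrM.
have t1 : `|t| <= 1.
  near: t; apply: (@cvgr0_norm_le _ _ _ _ _ id) => //; exact: cvg_id.
apply: (@le_lt_trans _ _ (`|t| * C)); first by rewrite ler_wpM2l ?(slopeB _ t1).
apply: (@le_lt_trans _ _ (`|t| * (C + 1))); first by rewrite ler_wpM2l ?lerDl.
rewrite -ltr_pdivlMr ?ltr_wpDl//.
near: t; apply: (@cvgr0_norm_lt _ _ _ _ _ id); [exact: cvg_id|].
by rewrite divr_gt0 ?ltr_wpDl//.
Unshelve. all: by end_near. Qed.

(** Entrywise form of dR = - R (dU^T U + U^T dU) R; the second block is 0 because R depends on U
    alone. *)
Definition rsv_grad a b M : 'M[R]_(l, r + m) :=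
  row_mx (\matrix_(i, j) - ((lsubmx M *m rsv M) i b * rsv M a j +
                            (lsubmx M *m rsv M) i a * rsv M b j)) 0.

Lemma nice_rsv a b : nice (fun M => rsv M a b) (rsv_grad a b).
Proof.
have tUR i k : tame (fun M => (lsubmx M *m rsv M) i k).
  under eq_fun do rewrite mxE; apply: tame_sum => j; apply: tameM => //.
  exact: tame_rsv.
split; first exact: tame_rsv.
- move=> i j; rewrite /rsv_grad; case: (split_ordP j) => k ->.
    under eq_fun do rewrite row_mxEl mxE -mulN1r.
    apply: tameM; first exact: tame_cst.
    by apply: tameD; apply: tameM; solve [exact: tUR|exact: tame_rsv].
  by under eq_fun do rewrite row_mxEr mxE; exact: tame_cst.
- move=> M H.
  have -> : \sum_i \sum_j rsv_grad a b M i j * H i j = - slope M H 0 a b.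
    rewrite /slope !scale0r !addr0 mulmxDr mulmxDl [in RHS]mxE opprD.
    have e1 : (rsv M *m ((lsubmx H)^T *m lsubmx M) *m rsv M) a b =
        \sum_i \sum_j (lsubmx M *m rsv M) i b * rsv M a j * lsubmx H i j.
      rewrite mulmxA -mulmxA mxE; apply: eq_bigr => i _.
      rewrite mulrC [X in _ * X]mxE mulr_sumr; apply: eq_bigr => j _.
      by rewrite [X in _ * (_ * X)]mxE mulrA.
    have e2 : (rsv M *m ((lsubmx M)^T *m lsubmx H) *m rsv M) a b =
        \sum_i \sum_j (lsubmx M *m rsv M) i a * rsv M b j * lsubmx H i j.
      rewrite mulmxA -mulmxA mxE; apply: eq_bigr => i _.
      have -> : (rsv M *m (lsubmx M)^T) a i = (lsubmx M *m rsv M) i a.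
        by rewrite -[in LHS]rsv_sym -trmx_mul mxE.
      rewrite [X in _ * X]mxE mulr_sumr; apply: eq_bigr => j _.
      by rewrite rsvC mulrAC mulrA.
    rewrite e1 e2 -!sumrN -big_split/=; apply: eq_bigr => i _.
    rewrite big_split_ord/= [X in _ + X]big1 ?addr0; last first.
      by move=> j _; rewrite /rsv_grad row_mxEr mxE mul0r.
    rewrite -!sumrN -big_split/=; apply: eq_bigr => j _.
    rewrite /rsv_grad row_mxEl [X in X * _]mxE.
    have -> : H i (lshift m j) = lsubmx H i j by rewrite mxE.
    by ring.
  apply: (is_derive_increment (g := fun t => - slope M H t a b)).
    by move=> t; rewrite scale0r addr0 rsv_line_entry mulrN.
  rewrite /prop_for; apply: cvgN; rewrite /slope.
  apply: cvg_mulmx => [c e|c e]; last exact: cvg_cst.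
  apply: cvg_mulmx => [{}c {}e|{}c {}e]; first exact: rsv_continuous.
  rewrite /prop_for; under eq_fun do rewrite mxE [X in _ + X]mxE.
  by apply: cvgD; [exact: cvg_cst|apply: cvgM; [exact: cvg_id|exact: cvg_cst]].
- move=> M H i j; rewrite /rsv_grad; case: (split_ordP j) => k ->.
    rewrite /prop_for; under eq_fun do rewrite row_mxEl mxE.
    have cUR c e : {for 0, continuous (fun t : R => (lsubmx (M + t *: H) *m rsv (M + t *: H)) c e)}.
      apply: cvg_mulmx => [i' j'|i' j']; last exact: rsv_continuous.
      by rewrite /prop_for; under eq_fun do rewrite mxE; exact: continuous_entry.
    by apply: cvgN; apply: cvgD; apply: cvgM; solve [exact: cUR|exact: rsv_continuous].
  by rewrite /prop_for; under eq_fun do rewrite row_mxEr mxE; exact: cvg_cst.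
Qed.
End NiceResolvent.

(** * Moment recursions *)

Section ResolventMoments.
Context {R : realType} (l r m : nat) (eps : R).
Hypothesis eps_gt0 : 0 < eps.
Implicit Types (M H : 'M[R]_(l, r + m)).
Local Notation rsv := (@rsv R l r m eps).
Variable z : 'cV[R]_r.
Local Notation y := (@rvec R l r m eps z).
Local Notation x := (@xvec R l r m eps z).
Local Notation phi := (@phi R l r m eps z).

Definition lgrad (G : 'I_l -> 'I_r -> R) : 'M[R]_(l, r + m) :=
  row_mx (\matrix_(i, j) G i j) 0.

Lemma lgradE G i j : lgrad G i (lshift m j) = G i j.
Proof. by rewrite /lgrad row_mxEl mxE. Qed.

Lemma lgrad0 G i c : lgrad G i (rshift r c) = 0.
Proof. by rewrite /lgrad row_mxEr mxE. Qed.

Lemma rvecE M a : y M a 0 = \sum_b rsv M a b * z b 0.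
Proof. by rewrite /rvec mxE. Qed.

Lemma xvecE M i : x M i 0 = \sum_b (lsubmx M *m rsv M) i b * z b 0.
Proof. by rewrite /xvec /rvec mulmxA mxE. Qed.

Lemma nice_rvec a : nice (fun M => y M a 0) (fun M => lgrad (fun i j =>
  - (x M i 0 * rsv M a j + (lsubmx M *m rsv M) i a * y M j 0))).
Proof.
have n1 := nice_sum (index_enum 'I_r) (fun b => niceZ (z b 0) (@nice_rsv R l r m eps eps_gt0 a b)).
apply: eq_nice n1 => M.
  by rewrite rvecE; apply: eq_bigr => b _; rewrite mulrC.
apply/matrixP => i j; rewrite summxE; case: (split_ordP j) => k ->; last first.
  by rewrite lgrad0 big1// => b _; rewrite mxE /rsv_grad row_mxEr mxE mulr0.
rewrite lgradE.
rewrite xvecE rvecE mulr_suml mulr_sumr -big_split/= -sumrN; apply: eq_bigr => b _.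
by rewrite mxE /rsv_grad row_mxEl [X in _ * X]mxE (rsvC _ _ b k); ring.
Qed.

Lemma nice_phi : nice phi (fun M => lgrad (fun i j => - 2 * (x M i 0 * y M j 0))).
Proof.
have n1 := nice_sum (index_enum 'I_r) (fun a => niceZ (z a 0) (nice_rvec a)).
apply: eq_nice n1 => M //.
apply/matrixP => i j; rewrite summxE; case: (split_ordP j) => k ->; last first.
  by rewrite lgrad0 big1// => b _; rewrite mxE lgrad0 mulr0.
under eq_bigr do rewrite mxE lgradE mulrN mulrDr.
rewrite sumrN big_split/= lgradE.
have -> : \sum_a z a 0 * (x M i 0 * rsv M a k) = x M i 0 * y M k 0.
  by rewrite rvecE mulr_sumr; apply: eq_bigr => a _; rewrite (rsvC _ _ a k); ring.
have -> : \sum_a z a 0 * ((lsubmx M *m rsv M) i a * y M k 0) = x M i 0 * y M k 0.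
  by rewrite xvecE mulr_suml; apply: eq_bigr => a _; ring.
ring.
Qed.

Lemma nice_xvec i' : nice (fun M => x M i' 0) (fun M => lgrad (fun i j =>
   (i == i')%:R * y M j 0 - x M i 0 * (lsubmx M *m rsv M) i' j -
   (lsubmx M *m rsv M *m (lsubmx M)^T) i' i * y M j 0)).
Proof.
have n1 := nice_sum (index_enum 'I_r) (fun a => niceM (nice_coord i' (lshift m a)) (nice_rvec a)).
apply: eq_nice n1 => M.
  by rewrite /xvec [RHS]mxE; apply: eq_bigr => a _; rewrite [lsubmx _ _ _]mxE.
apply/matrixP => i j; rewrite summxE; case: (split_ordP j) => k ->; last first.
  rewrite lgrad0 big1// => a _; rewrite mxE [X in X + _]mxE lgrad0 [X in _ + X]mxE.
  by rewrite [delta_mx _ _ _ _]mxE eq_rlshift andbF !mulr0 addr0.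
rewrite lgradE.
transitivity (\sum_a (M i' (lshift m a) * - (x M i 0 * rsv M a k + (lsubmx M *m rsv M) i a * y M k 0) + y M a 0 * ((i == i') && (k == a))%:R)).
  apply: eq_bigr => a _; rewrite mxE [X in X + _]mxE lgradE [X in _ + X]mxE.
  by rewrite [delta_mx _ _ _ _]mxE eq_lshift.
rewrite big_split/= addrC -addrA; congr (_ + _).
  rewrite (bigD1 k)//= eqxx andbT mulrC big1 ?addr0// => a ak.
  by rewrite (eq_sym k) (negbTE ak) andbF mulr0.
under eq_bigr do rewrite mulrN mulrDr opprD.
rewrite big_split/= !sumrN; congr (- _ - _).
  rewrite [X in _ = _ * X]mxE mulr_sumr; apply: eq_bigr => a _.
  by rewrite [lsubmx _ _ _]mxE; ring.
rewrite -mulmxA [X in _ = X * _]mxE mulr_suml; apply: eq_bigr => a _.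
have -> : (rsv M *m (lsubmx M)^T) a i = (lsubmx M *m rsv M) i a.
  by rewrite -[in LHS]rsv_sym -trmx_mul mxE.
by rewrite [lsubmx _ _ _]mxE mulrA.
Qed.

(** The divergence is (l - tr(U R U^T)) phi^(b+1) - (1 + 2b) |x|^2 phi^b, and both tr(U R U^T) <= r
    and |x|^2 <= phi go in the favourable direction. For eps = 0 and U of full column rank it would
    be an equality. *)
Lemma phi_divergence_ge b M :
  (l%:R - r%:R - 1 - 2 * b%:R) * phi M ^+ b.+1 <= \sum_(k : 'I_l * 'I_r) (z k.2 0 *:
   (x M k.1 0 *: ((b%:R * phi M ^+ b.-1) *: lgrad (fun i j => - 2 * (x M i 0 * y M j 0)))
   + phi M ^+ b *: lgrad (fun i j =>
   (i == k.1)%:R * y M j 0 - x M i 0 * (lsubmx M *m rsv M) k.1 j -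
   (lsubmx M *m rsv M *m (lsubmx M)^T) k.1 i * y M j 0))) k.1 (lshift m k.2).
Proof.
set hat := (lsubmx M *m rsv M *m (lsubmx M)^T).
pose t i j := z j 0 * (x M i 0 * (b%:R * phi M ^+ b.-1 * (- 2 * (x M i 0 * y M j 0))) +
   phi M ^+ b * (y M j 0 - x M i 0 * (lsubmx M *m rsv M) i j - hat i i * y M j 0)).
rewrite (eq_bigr (fun k => t k.1 k.2)); last first.
  move=> [i j] _ /=; rewrite mxE [X in _ * X]mxE [X in X + _]mxE [X in _ * (_ + X)]mxE.
  by rewrite [X in _ * (_ * X + _)]mxE !lgradE eqxx mul1r.
rewrite -(pair_bigA _ t)/=.
have tE i : \sum_j t i j = phi M ^+ b * phi M - phi M ^+ b * x M i 0 ^+ 2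
    - phi M ^+ b * phi M * hat i i - 2 * (b%:R * phi M ^+ b.-1 * phi M) * x M i 0 ^+ 2.
  transitivity (\sum_j (phi M ^+ b - phi M ^+ b * hat i i - 2 * (b%:R * phi M ^+ b.-1) * x M i 0 ^+ 2) * (z j 0 * y M j 0)
     - \sum_j (phi M ^+ b * x M i 0) * ((lsubmx M *m rsv M) i j * z j 0)).
    by rewrite -sumrB; apply: eq_bigr => j _; rewrite /t; ring.
  by rewrite -!mulr_sumr -xvecE -/(dotv z (y M)) -/(phi M); ring.
rewrite (eq_bigr _ (fun i _ => tE i)) !sumrB sumr_const card_ord -!mulr_sumr.
rewrite -/(sqn (x M)) -/(\tr hat).
have -> : b%:R * phi M ^+ b.-1 * phi M = b%:R * phi M ^+ b.
  by case: (b) => [|c]; [rewrite !mul0r|rewrite /= -mulrA -exprSr].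
have h1 := sqn_xvec_le eps_gt0 z M; have h2 := hat_trace_le eps_gt0 M.
have h0 := phi_ge0 eps_gt0 z M.
have hb := exprn_ge0 b h0.
rewrite exprSr -mulr_natr.
have b0 : 0 <= b%:R :> R by exact: ler0n.
have k1 := ler_wpM2l hb h1.
have k2 := ler_wpM2l (mulr_ge0 hb h0) h2; rewrite -/hat in k2.
have k3 := ler_wpM2l (mulr_ge0 b0 hb) h1.
lra.
Qed.

(* Integration by parts of U against the field x_i z_j phi^b, with x = U R z. *)
Lemma resolvent_moment_step d (T : measurableType d) (P : probability T R)
    (v : R) (Y : T -> 'M[R]_(l, r + m)) b :
  stein_matrix P v Y -> 0 <= v ->
  v * (l%:R - r%:R - 1 - 2 * b%:R) * \int[P]_w (phi (Y w) ^+ b.+1) <=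
  sqn z * \int[P]_w (phi (Y w) ^+ b).
Proof.
move=> sY v0; have [_ iY _] := sY.
have tphi k : tame (fun M => phi M ^+ k) by apply: tameX; case: nice_phi.
have nF (k : 'I_l * 'I_r) := niceZ (z k.2 0) (niceM (nice_xvec k.1) (niceX b nice_phi)).
have := stein_divergence sY (fun k => (k.1, lshift m k.2)) nF => /= E.
have tL : tame (fun M => \sum_(k : 'I_l * 'I_r)
    M k.1 (lshift m k.2) * (z k.2 0 * (x M k.1 0 * phi M ^+ b))).
  apply: tame_sum => k; apply: tameM; first exact: tame_coord.
  by case: (nF k).
have tD : tame (fun M => \sum_(k : 'I_l * 'I_r) (z k.2 0 *:
   (x M k.1 0 *: ((b%:R * phi M ^+ b.-1) *: lgrad (fun i j => - 2 * (x M i 0 * y M j 0)))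
   + phi M ^+ b *: lgrad (fun i j =>
   (i == k.1)%:R * y M j 0 - x M i 0 * (lsubmx M *m rsv M) k.1 j -
   (lsubmx M *m rsv M *m (lsubmx M)^T) k.1 i * y M j 0))) k.1 (lshift m k.2)).
  by apply: tame_sum => k; case: (nF k).
rewrite -[leRHS]RintegralZl//; last exact: (iY _ (tphi b)).
apply: (@le_trans _ _ (v * \int[P]_w (\sum_(k : 'I_l * 'I_r) (z k.2 0 *:
   (x (Y w) k.1 0 *: ((b%:R * phi (Y w) ^+ b.-1) *: lgrad (fun i j => - 2 * (x (Y w) i 0 * y (Y w) j 0)))
   + phi (Y w) ^+ b *: lgrad (fun i j =>
   (i == k.1)%:R * y (Y w) j 0 - x (Y w) i 0 * (lsubmx (Y w) *m rsv (Y w)) k.1 j -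
   (lsubmx (Y w) *m rsv (Y w) *m (lsubmx (Y w))^T) k.1 i * y (Y w) j 0))) k.1 (lshift m k.2)))).
  rewrite -mulrA ler_wpM2l// -RintegralZl//; last exact: (iY _ (tphi b.+1)).
  apply: le_Rintegral => //.
  - exact: (iY _ (tameM (tame_cst _) (tphi b.+1))).
  - exact: (iY _ tD).
  by move=> w _; exact: phi_divergence_ge.
rewrite -E; apply: le_Rintegral => //.
- exact: (iY _ tL).
- exact: (iY _ (tameM (tame_cst _) (tphi b))).
move=> w _; move: (Y w) => M.
rewrite (_ : \sum_(k : 'I_l * 'I_r) _ = (sqn z - eps * phi M) * phi M ^+ b).
  rewrite ler_wpM2r ?exprn_ge0 ?phi_ge0// gerBl mulr_ge0 ?phi_ge0// ltW//.
rewrite -xvec_lsubmx// -(pair_bigA _ (fun i j => M i (lshift m j) * (z j 0 * (x M i 0 * phi M ^+ b))))/=.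
rewrite /dotv mulr_suml; apply: eq_bigr => i _.
rewrite [X in _ = _ * X * _]mxE mulr_sumr mulr_suml; apply: eq_bigr => j _.
by rewrite [lsubmx _ _ _]mxE; ring.
Qed.

End ResolventMoments.

Lemma leibniz_entry (R : realType) p q (a p1 p2 p3 p4 p5 p6 p7 p8 : R)
    (G1 G2 G3 G4 : 'M[R]_(p, q)) i j :
  (a *: (p1 *: (p2 *: G1) + p3 *: (p4 *: (p5 *: G2) + p6 *: (p7 *: G3 + p8 *: G4)))) i j =
  a * (p1 * (p2 * G1 i j) + p3 * (p4 * (p5 * G2 i j) + p6 * (p7 * G3 i j + p8 * G4 i j))).
Proof. by rewrite !mxE. Qed.

Section QuadraticMoments.
Context {R : realType} (l r m : nat) (eps : R).
Hypothesis eps_gt0 : 0 < eps.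
Implicit Types (M : 'M[R]_(l, r + m)).
Variables (z : 'cV[R]_r) (dl : 'I_m -> R) (s2 : R).
Hypotheses (dl_ge0 : forall c, 0 <= dl c) (dl_le : forall c, dl c <= s2) (s2_ge0 : 0 <= s2).
Local Notation x := (@xvec R l r m eps z).
Local Notation phi := (@phi R l r m eps z).

(* tform M = | diag(b'') N^T U R z |^2, where dl c = b''_c ^ 2 and N is the block
   of the last m columns of M. *)
Definition tcoef M c : R := \sum_i M i (rshift r c) * x M i 0.
Definition tform M : R := \sum_c dl c * tcoef M c ^+ 2.

Lemma tform_ge0 M : 0 <= tform M.
Proof. by apply: sumr_ge0 => c _; rewrite mulr_ge0 ?sqr_ge0. Qed.

(** The gradient stays existential: this block is only integrated by parts along N, and only those
    entries are specified. There x = U R z is constant and the derivative is immediate. *)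
Lemma nice_tcoef c : exists dt, nice (fun M => tcoef M c) dt /\
  forall M i c', dt M i (rshift r c') = (c' == c)%:R * x M i 0.
Proof.
eexists; split.
  exact: (nice_sum (index_enum 'I_l) (fun i =>
    niceM (nice_coord i (rshift r c)) (@nice_xvec R l r m eps eps_gt0 z i))).
move=> M i c' /=; rewrite summxE (bigD1 i)//= big1 ?addr0 => [|j ji].
  rewrite mxE [X in X + _]mxE lgrad0 mulr0 add0r mxE [delta_mx _ _ _ _]mxE eqxx.
  by rewrite eq_rshift mulrC.
rewrite mxE [X in X + _]mxE lgrad0 mulr0 add0r mxE [delta_mx _ _ _ _]mxE.
by rewrite eq_sym (negbTE ji) mulr0.
Qed.

Lemma nice_tform : exists dQ, nice tform dQ /\
  forall M i c, dQ M i (rshift r c) = 2 * (dl c * tcoef M c * x M i 0).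
Proof.
have [dt /all_and2[ndt dtE]] := choice nice_tcoef.
eexists; split.
  exact: (nice_sum (index_enum 'I_m) (fun c => niceZ (dl c) (niceX 2 (ndt c)))).
move=> M i c /=; rewrite summxE (bigD1 c)//= big1 ?addr0 => [|c' cc'].
  by rewrite 2!mxE dtE eqxx mul1r expr1; ring.
by rewrite 2!mxE dtE eq_sym (negbTE cc') mul0r !mulr0.
Qed.

Variables (d : measure_display) (T : measurableType d) (P : probability T R).
Variables (v : R) (Y : T -> 'M[R]_(l, r + m)).
Hypotheses (sY : stein_matrix P v Y) (v_gt0 : 0 < v).
Local Notation F2 := (\sum_c dl c).

Lemma tame_tform_phi a e : tame (fun M => tform M ^+ a * phi M ^+ e).
Proof.
have [dQ [[tQ _ _ _] _]] := nice_tform.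
apply: tameM; apply: tameX => //.
by case: (@nice_phi R l r m eps eps_gt0 z).
Qed.

(* Integration by parts of N against the field
   dl_c x_i (N^T x)_c tform^b phi^e. *)
Lemma tform_moment_step b e :
  \int[P]_w (tform (Y w) ^+ b.+1 * phi (Y w) ^+ e) <=
  v * (F2 + 2 * b%:R * s2) * \int[P]_w (tform (Y w) ^+ b * phi (Y w) ^+ e.+1).
Proof.
have [_ iY _] := sY.
have [dt /all_and2[ndt dtE]] := choice nice_tcoef.
have [dQ [nQ dQE]] := nice_tform.
have nx := @nice_xvec R l r m eps eps_gt0 z.
have nphi := @nice_phi R l r m eps eps_gt0 z.
have nF (k : 'I_l * 'I_m) := niceZ (dl k.2) (niceM (niceM (niceM (nx k.1) (ndt k.2))
  (niceX b nQ)) (niceX e nphi)).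
have tD (k : 'I_l * 'I_m) : tame (fun M => dl k.2 * (x M k.1 0 ^+ 2 *
   (tform M ^+ b + 2 * b%:R * dl k.2 * (tform M ^+ b.-1 * tcoef M k.2 ^+ 2))) * phi M ^+ e).
  have [[tx _ _ _] [tt _ _ _]] := (nx k.1, ndt k.2).
  have [[tQ _ _ _] [tphi _ _ _]] := (nQ, nphi).
  apply: tameM; last exact: tameX.
  apply: tameM; first exact: tame_cst.
  apply: tameM; first exact: tameX.
  apply: tameD; first exact: tameX.
  apply: tameM; first exact: tame_cst.
  by apply: tameM; exact: tameX.
have := stein_divergence sY (fun k => (k.1, rshift r k.2)) nF => /=.
rewrite (eq_Rintegral P (g := fun w => tform (Y w) ^+ b.+1 * phi (Y w) ^+ e)); last first.
  move=> w _; move: (Y w) => M.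
  rewrite -(pair_bigA _ (fun i c => M i (rshift r c) * (dl c * (x M i 0 * tcoef M c * tform M ^+ b * phi M ^+ e))))/=.
  rewrite exchange_big/=.
  transitivity (tform M * (tform M ^+ b * phi M ^+ e)); last by rewrite mulrA -exprS.
  rewrite [X in _ = X * _]/tform mulr_suml; apply: eq_bigr => c _.
  transitivity ((dl c * tcoef M c * tform M ^+ b * phi M ^+ e) *
    \sum_i M i (rshift r c) * x M i 0).
    by rewrite mulr_sumr; apply: eq_bigr => i _; ring.
  by rewrite -/(tcoef M c); ring.
move=> ->; rewrite -mulrA ler_wpM2l ?(ltW v_gt0)// -RintegralZl//; last first.
  exact: (iY _ (tame_tform_phi b e.+1)).
rewrite (eq_Rintegral P (g := fun w => \sum_(k : 'I_l * 'I_m) dl k.2 * (x (Y w) k.1 0 ^+ 2 *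
   (tform (Y w) ^+ b + 2 * b%:R * dl k.2 * (tform (Y w) ^+ b.-1 * tcoef (Y w) k.2 ^+ 2))) * phi (Y w) ^+ e)); last first.
  move=> w _; move: (Y w) => M; apply: eq_bigr => -[i c] _ /=.
  by rewrite leibniz_entry !lgrad0 dQE dtE eqxx mul1r; ring.
apply: le_Rintegral => //.
- exact: (iY _ (tame_sum (index_enum _) xpredT tD)).
- exact: (iY _ (tameM (tame_cst _) (tame_tform_phi b e.+1))).
move=> w _; move: (Y w) => M.
rewrite -(pair_bigA _ (fun i c => dl c * (x M i 0 ^+ 2 *
   (tform M ^+ b + 2 * b%:R * dl c * (tform M ^+ b.-1 * tcoef M c ^+ 2))) * phi M ^+ e))/=.
rewrite exchange_big/=.
have -> : \sum_c \sum_i dl c * (x M i 0 ^+ 2 *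
   (tform M ^+ b + 2 * b%:R * dl c * (tform M ^+ b.-1 * tcoef M c ^+ 2))) * phi M ^+ e =
   phi M ^+ e * sqn (x M) * (F2 * tform M ^+ b +
     2 * (\sum_c dl c * (dl c * tcoef M c ^+ 2)) * (b%:R * tform M ^+ b.-1)).
  transitivity (\sum_c phi M ^+ e * sqn (x M) * (dl c * tform M ^+ b +
     2 * (dl c * (dl c * tcoef M c ^+ 2)) * (b%:R * tform M ^+ b.-1))).
    apply: eq_bigr => c _; transitivity ((phi M ^+ e * (dl c *
       (tform M ^+ b + 2 * b%:R * dl c * (tform M ^+ b.-1 * tcoef M c ^+ 2)))) * \sum_i x M i 0 ^+ 2).
      by rewrite mulr_sumr; apply: eq_bigr => i _; ring.
    by rewrite -/(sqn (x M)); ring.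
  by rewrite -mulr_sumr big_split/= -!mulr_suml -mulr_sumr.
have hx := sqn_xvec_le eps_gt0 z M; have hp := phi_ge0 eps_gt0 z M.
have hQ := tform_ge0 M.
have -> : (F2 + 2 * b%:R * s2) * (tform M ^+ b * phi M ^+ e.+1) =
  phi M ^+ e * phi M * (F2 * tform M ^+ b + 2 * (s2 * tform M) * (b%:R * tform M ^+ b.-1)).
  have -> : 2 * (s2 * tform M) * (b%:R * tform M ^+ b.-1) = 2 * s2 * (b%:R * tform M ^+ b).
    by case: (b) => [|k]; [rewrite !mul0r !mulr0|rewrite /= exprS; ring].
  by rewrite [_ ^+ e.+1]exprS; ring.
(* Differentiating the power of [tform] produces a second factor [dl c], which is bounded by [s2];
   the remaining sum is [tform] again and closes the recursion. *)
have dS : \sum_c dl c * (dl c * tcoef M c ^+ 2) <= s2 * tform M.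
  rewrite /tform mulr_sumr; apply: ler_sum => c _.
  by rewrite ler_wpM2r// mulr_ge0 ?sqr_ge0.
have dS0 : 0 <= \sum_c dl c * (dl c * tcoef M c ^+ 2).
  by apply: sumr_ge0 => c _; do 2 apply: mulr_ge0 => //; exact: sqr_ge0.
have F20 : 0 <= F2 by exact: sumr_ge0.
have q0 : 0 <= b%:R * tform M ^+ b.-1 by rewrite mulr_ge0// exprn_ge0.
apply: ler_pM.
- by rewrite mulr_ge0 ?sqn_ge0// exprn_ge0.
- by apply: addr_ge0; apply: mulr_ge0 => //; [exact: exprn_ge0|exact: mulr_ge0].
- by rewrite ler_wpM2l// exprn_ge0.
- by rewrite lerD2l ler_wpM2r// ler_wpM2l.
Qed.

(** Each step trades one factor [tform] for one factor [phi], so after a steps only moments of [phi]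
    remain. *)
Lemma tform_phi_moment a e :
  \int[P]_w (tform (Y w) ^+ a * phi (Y w) ^+ e) <=
  \prod_(j < a) (v * (F2 + 2 * j%:R * s2)) * \int[P]_w (phi (Y w) ^+ (a + e)).
Proof.
have F20 : 0 <= F2 by exact: sumr_ge0.
elim: a e => [|a ih] e.
  by rewrite big_ord0 mul1r; under eq_Rintegral do rewrite expr0 mul1r.
apply: le_trans (tform_moment_step a e) _.
rewrite big_ord_recr/= [X in _ <= X * _]mulrC -[leRHS]mulrA ler_wpM2l//.
  by rewrite mulr_ge0 ?(ltW v_gt0)// addr_ge0// !mulr_ge0.
by rewrite addSnnS; exact: ih.
Qed.

Lemma phi_moment a : (forall j : 'I_a, 0 < l%:R - r%:R - 1 - 2 * j%:R :> R) ->
  \int[P]_w (phi (Y w) ^+ a) <=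
  \prod_(j < a) (sqn z / (v * (l%:R - r%:R - 1 - 2 * j%:R))).
Proof.
elim: a => [|a ih] ka.
  by rewrite big_ord0; under eq_Rintegral do rewrite expr0; rewrite Rintegral_probability_cst.
have := resolvent_moment_step eps_gt0 z a sY (ltW v_gt0).
have k0 : 0 < v * (l%:R - r%:R - 1 - 2 * a%:R) by rewrite mulr_gt0//; exact: (ka ord_max).
rewrite -ler_pdivlMl// => /le_trans; apply.
have ia : \int[P]_w (phi (Y w) ^+ a) <=
    \prod_(j < a) (sqn z / (v * (l%:R - r%:R - 1 - 2 * j%:R))).
  by apply: ih => j; exact: (ka (widen_ord (leqnSn a) j)).
rewrite big_ord_recr/=; set Pi := \prod_(j < a) _ in ia *.
rewrite [leRHS](_ : _ = (v * (l%:R - r%:R - 1 - 2 * a%:R))^-1 * (sqn z * Pi)); last first.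
  by rewrite mulrA mulrC [Pi * _]mulrC.
by rewrite ler_wpM2l ?invr_ge0 ?(ltW k0)// ler_wpM2l// sqn_ge0.
Qed.

(** The recursion along N contributes v^a and the one along U contributes v^(-a): the variance
    cancels. *)
Lemma tform_moment a : (forall j : 'I_a, 0 < l%:R - r%:R - 1 - 2 * j%:R :> R) ->
  \int[P]_w (tform (Y w) ^+ a) <=
  sqn z ^+ a * \prod_(j < a) ((F2 + 2 * j%:R * s2) / (l%:R - r%:R - 1 - 2 * j%:R)).
Proof.
move=> ka; have := tform_phi_moment a 0.
under eq_Rintegral do rewrite expr0 mulr1.
rewrite addn0 => /le_trans; apply.
have F20 : 0 <= F2 by exact: sumr_ge0.
have p0 : 0 <= \prod_(j < a) (v * (F2 + 2 * j%:R * s2)).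
  by apply: prodr_ge0 => j _; rewrite mulr_ge0 ?(ltW v_gt0)// addr_ge0// !mulr_ge0.
apply: le_trans (ler_wpM2l p0 (phi_moment ka)) _.
rewrite -big_split/= -[X in sqn z ^+ X](card_ord a) -prodr_const -big_split/=.
rewrite le_eqVlt; apply/orP; left; apply/eqP; apply: eq_bigr => j _.
have : l%:R - r%:R - 1 - 2 * j%:R != 0 :> R by rewrite gt_eqF.
move: (l%:R - r%:R - 1 - 2 * j%:R) => K K0.
have v0 : v != 0 by rewrite gt_eqF.
by field; apply/andP.
Qed.

End QuadraticMoments.

(** * Leading coordinates of kernel vectors, and averaging over a Gaussian direction *)

Section CauchySchwarz.
Context {R : realType} (n : nat).
Implicit Types x y : 'cV[R]_n.

Lemma dotv_sqr_le x y : dotv x y ^+ 2 <= sqn x * sqn y.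
Proof.
have [/eqP|y0] := eqVneq (sqn y) 0.
  rewrite sqn_eq0 => /eqP ->; rewrite (_ : dotv x 0 = 0) ?expr0n.
    by rewrite mulr_ge0 ?sqn_ge0.
  by rewrite /dotv big1// => i _; rewrite mxE mulr0.
have yp : 0 < sqn y by rewrite lt_neqAle eq_sym y0 sqn_ge0.
have := sqn_ge0 (sqn y *: x + (- dotv x y) *: y).
rewrite sqnD !sqnZ dotvZl dotvZr.
have -> : sqn y ^+ 2 * sqn x + 2 * (sqn y * (- dotv x y * dotv x y)) +
  (- dotv x y) ^+ 2 * sqn y = sqn y * (sqn x * sqn y - dotv x y ^+ 2) by ring.
by rewrite pmulr_rge0// subr_ge0.
Qed.

Lemma enormE x : enorm x = Num.sqrt (sqn x). Proof. by []. Qed.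

Lemma enorm_ge0 x : 0 <= enorm x. Proof. exact: sqrtr_ge0. Qed.

Lemma enorm_sqr x : enorm x ^+ 2 = sqn x.
Proof. by rewrite enormE sqr_sqrtr// sqn_ge0. Qed.

Lemma dotv_le x y : dotv x y <= enorm x * enorm y.
Proof.
rewrite !enormE -sqrtrM ?sqn_ge0//; apply: le_trans (ler_norm _) _.
by rewrite -sqrtr_sqr ler_sqrt ?mulr_ge0 ?sqn_ge0// dotv_sqr_le.
Qed.

Lemma enormD x y : enorm (x + y) <= enorm x + enorm y.
Proof.
rewrite -(@ler_pXn2r _ 2)// ?nnegrE ?addr_ge0 ?enorm_ge0//.
rewrite enorm_sqr sqnD sqrrD !enorm_sqr -mulr_natr.
by have := dotv_le x y; lra.
Qed.

Lemma enormZ (c : R) x : enorm (c *: x) = `|c| * enorm x.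
Proof. by rewrite !enormE sqnZ sqrtrM ?sqr_ge0// sqrtr_sqr. Qed.

End CauchySchwarz.

Section KernelVector.
Context {R : realType} (l r m : nat) (eps : R).
Hypothesis eps_gt0 : 0 < eps.
Variables (bt : 'I_m -> R) (M : 'M[R]_(l, r + m)).

Definition wcol (c : 'cV[R]_m) : 'cV[R]_m := \col_i (bt i * c i 0).
Definition pvec (c : 'cV[R]_m) : 'cV[R]_r :=
  rsv eps M *m ((lsubmx M)^T *m (rsubmx M *m wcol c)).

(** Multiply U y1 = - N w by U^T and replace U^T U by the Gram matrix minus eps. Thus y1 is minus
    the ridge-regression solution [pvec c], up to the regularization error eps R y1. *)
Lemma kernel_vector (y1 : 'cV[R]_r) (c : 'cV[R]_m) :
  lsubmx M *m y1 + rsubmx M *m wcol c = 0 ->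
  y1 = - pvec c + eps *: (rsv eps M *m y1).
Proof.
move=> /eqP; rewrite addr_eq0 => /eqP E.
rewrite /pvec -mulmxN -mulmxN -E scalemxAr -mulmxDr -[LHS]mul1mx -(rsv_gram eps_gt0 M).
by rewrite -mulmxA /gram mulmxDl mul_scalar_mx mulmxA.
Qed.

(** Transposition moves the whole operator onto z, and Cauchy-Schwarz then separates c from a
    quantity that involves only z and M. *)
Lemma dotv_pvec z c : dotv z (pvec c) ^+ 2 <=
  sqn c * tform eps z (fun i => bt i ^+ 2) M.
Proof.
have -> : dotv z (pvec c) = dotv c (\col_i (bt i * tcoef eps z M i)).
  rewrite /pvec dotv_mul rsv_sym dotv_mul trmxK -/(rvec eps z M) -/(xvec eps z M).
  rewrite dotv_mul dotvC; apply: eq_bigr => i _; rewrite !mxE mulrCA -mulrA.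
  congr (_ * (_ * _)); rewrite /tcoef; apply: eq_bigr => j _.
  by rewrite !mxE.
apply: le_trans (dotv_sqr_le _ _) _; rewrite ler_wpM2l ?sqn_ge0//.
by apply: ler_sum => i _; rewrite mxE exprMn.
Qed.

(** Row by row: (R y)_i = (R e_i) . y and eps |R e_i|^2 <= R_ii. Hence |eps R y| is at most sqrt(eps
    tr R) |y|, which tends to 0 in mean, whereas R <= 1/eps would leave a bound of order one. *)
Lemma rsv_mul_le (y : 'cV[R]_r) :
  eps * sqn (rsv eps M *m y) <= \tr (rsv eps M) * sqn y.
Proof.
rewrite /sqn mulr_sumr /mxtrace mulr_suml; apply: ler_sum => i _.
have -> : (rsv eps M *m y) i 0 = dotv (rvec eps (delta_mx i 0) M) y.
  by rewrite mxE; apply: eq_bigr => j _; rewrite /rvec -colE mxE rsvC.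
apply: le_trans (ler_wpM2l (ltW eps_gt0) (dotv_sqr_le _ _)) _.
rewrite mulrA ler_wpM2r ?sqn_ge0//; apply: le_trans (sqn_rvec_le eps_gt0 _ _) _.
rewrite /phi /rvec -colE /dotv (bigD1 i)//= big1 => [|j ji].
  by rewrite !mxE !eqxx mul1r addr0.
by rewrite mxE (negbTE ji) mul0r.
Qed.

End KernelVector.

Section Averaging.
Context {d : measure_display} {T : measurableType d} {R : realType}.
Variables (P : probability T R) (l l' r m : nat) (v eps s2 : R).
Variables (Y : T -> 'M[R]_(l, r + m)) (Z : T -> 'M[R]_(l', r)) (i0 : 'I_l').
Variables (bt : 'I_m -> R) (a : nat).
Hypotheses (sY : stein_matrix P v Y) (sZ : stein_matrix P v Z).
Hypotheses (eps_gt0 : 0 < eps) (v_gt0 : 0 < v) (s2_ge0 : 0 <= s2).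
Hypothesis bt_le : forall c, bt c ^+ 2 <= s2.
Hypothesis ka : forall j : 'I_a, 0 < l%:R - r%:R - 1 - 2 * j%:R :> R.
Local Notation dl := (fun c => bt c ^+ 2).
Local Notation F2 := (\sum_c bt c ^+ 2).

Definition zrow (N : 'M[R]_(l', r)) : 'cV[R]_r := \col_j N i0 j.

Lemma tame_tform_zrow (M : 'M[R]_(l, r + m)) : tame (fun N => tform eps (zrow N) dl M ^+ a).
Proof.
apply: tameX; apply: tame_sum => c; apply: tameM; first exact: tame_cst.
apply: tameX; rewrite /tcoef; apply: tame_sum => i; apply: tameM; first exact: tame_cst.
under eq_fun do rewrite xvecE; apply: tame_sum => b; apply: tameM; first exact: tame_cst.
by under eq_fun do rewrite mxE; exact: tame_coord.
Qed.

Let g (p : T * T) : R := tform eps (zrow (Z p.2)) dl (Y p.1) ^+ a.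

Let measurable_g : measurable_fun setT g.
Proof.
have [mY _ _] := sY; have [mZ _ _] := sZ.
have mY1 : coord_measurable (fun p : T * T => Y p.1).
  by move=> i j; exact: (measurableT_comp (mY i j) measurable_fst).
have mZ2 i j : measurable_fun setT (fun p : T * T => Z p.2 i j).
  exact: (measurableT_comp (mZ i j) measurable_snd).
apply: measurable_funX; apply: measurable_sum => c.
apply: measurable_funM; first exact: measurable_cst.
apply: measurable_funX; apply: measurable_sum => i.
apply: measurable_funM; first exact: mY1.
under eq_fun do rewrite xvecE.
apply: measurable_sum => b; apply: measurable_funM; last first.
  by under eq_fun do rewrite mxE; exact: mZ2.
under eq_fun do rewrite mxE; apply: measurable_sum => e.
apply: measurable_funM; last exact: (proj1 (@tame_rsv R l r m eps eps_gt0 e b) _ _ _ mY1).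
by under eq_fun do rewrite mxE; exact: mY1.
Qed.

Let dfact : R := \prod_(j < a) (2 * j + 1)%:R.
Let dfact_gt0 : 0 < dfact.
Proof. by apply: prodr_gt0 => j _; rewrite ltr0n addn1. Qed.

(* Row i0 of Z at an independent point w' plays the Gaussian vector z; dividing by
   E[g^(2a)] = (2a-1)!! v^a turns the mean of (z . p)^(2a) into |p|^(2a). *)
Definition psi w : R := (\int[P]_w' g (w, w')) / (dfact * v ^+ a).

Let g_ge0 p : 0 <= g p.
Proof. by rewrite exprn_ge0// tform_ge0// => c; exact: sqr_ge0. Qed.

Lemma psi_ge0 w : 0 <= psi w.
Proof.
rewrite divr_ge0//; last by rewrite mulr_ge0 ?exprn_ge0 ?ltW.
by apply: Rintegral_ge0 => w' _; exact: g_ge0.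
Qed.

Let int_g w : P.-integrable setT (fun w' => (g (w, w'))%:E).
Proof. by have [_ iZ _] := sZ; exact: (iZ _ (tame_tform_zrow (Y w))). Qed.

(** Average the a-th power of [dotv_pvec] over z: the left side is an exact Gaussian moment of a
    linear form. As [psi] does not involve c, this bounds the operator norm at each sample point. *)
Lemma sqn_pvec_le w c : sqn (pvec eps bt (Y w) c) ^+ a <= sqn c ^+ a * psi w.
Proof.
set p := pvec _ _ _ _.
have := row_form_moment sZ i0 p a; rewrite -/dfact -/(sqn p) => E.
have : \int[P]_w' (row_form i0 p (Z w') ^+ (2 * a)) <=
    \int[P]_w' (sqn c ^+ a * g (w, w')).
  have [_ iZ _] := sZ; apply: le_Rintegral => //.
  - by apply: (iZ _ (tameX _ _)); case: (nice_row_form i0 p).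
  - exact: (iZ _ (tameM (tame_cst _) (tame_tform_zrow (Y w)))).
  move=> w' _; rewrite exprM -exprMn lerXn2r ?nnegrE ?sqr_ge0//.
    by apply: mulr_ge0; [exact: sqn_ge0|apply: tform_ge0 => i; exact: sqr_ge0].
  have -> : row_form i0 p (Z w') = dotv (zrow (Z w')) p.
    by apply: eq_bigr => j _; rewrite [zrow _ _ _]mxE mulrC.
  exact: dotv_pvec.
rewrite E (RintegralZl _ measurableT (int_g w)) /psi exprMn => h.
rewrite mulrA ler_pdivlMr; last by rewrite mulr_gt0// exprn_gt0.
by rewrite mulrC -mulrA.
Qed.

Lemma measurable_psi : measurable_fun setT psi.
Proof.
apply: measurable_funM; last exact: measurable_cst.
have mG : measurable_fun setT (fun w => \int[P]_w' (g (w, w'))%:E)%E.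
  apply: (@measurable_fun_fubini_tonelli_F _ _ T T R P (EFin \o g)) => //.
    exact/measurable_EFinP.
exact: (measurableT_comp (fine_measurable measurableT) mG).
Qed.

(** By Tonelli the mean over Y is taken first, for fixed z, where [tform_moment] applies; what is
    left is a chi-square moment of |z|^2. Its factors v (r + 2j) are divided by the v (2j + 1) of
    the normalization of [psi]. *)
Lemma integral_psi_le : (\int[P]_w (psi w)%:E <=
  (\prod_(j < a) ((r%:R + 2 * j%:R) * (F2 + 2 * j%:R * s2) /
     ((2 * j%:R + 1) * (l%:R - r%:R - 1 - 2 * j%:R))))%:E)%E.
Proof.
pose K := \prod_(j < a) ((F2 + 2 * j%:R * s2) / (l%:R - r%:R - 1 - 2 * j%:R)).
have F20 : 0 <= F2 by apply: sumr_ge0 => c _; exact: sqr_ge0.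
have K0 : 0 <= K.
  by apply: prodr_ge0 => j _; rewrite divr_ge0 ?(ltW (ka j))// addr_ge0// !mulr_ge0.
have [_ iY _] := sY; have [_ iZ _] := sZ.
have c0 : 0 < dfact * v ^+ a by rewrite mulr_gt0// exprn_gt0.
under eq_integral => w _.
  rewrite /psi mulrC EFinM.
  have -> : ((\int[P]_w' g (w, w'))%:E = \int[P]_w' (g (w, w'))%:E)%E.
    by rewrite fineK// integrable_fin_num.
  over.
rewrite ge0_integralZl//=; last 3 first.
- apply: (@measurable_fun_fubini_tonelli_F _ _ T T R P (EFin \o g)) => //.
    exact/measurable_EFinP.
- by move=> w _; apply: integral_ge0 => w' _; rewrite lee_fin.
- by rewrite lee_fin invr_ge0 ltW.
rewrite (@fubini_tonelli _ _ T T R P P (EFin \o g))//=; last exact/measurable_EFinP.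
apply: (@le_trans _ _ ((dfact * v ^+ a)^-1%:E *
   \int[P]_w' (K * row_sqr i0 (Z w') ^+ a)%:E)%E).
  apply: lee_wpmul2l; first by rewrite lee_fin invr_ge0 ltW.
  apply: ge0_le_integral => //.
  - by move=> w' _; apply: integral_ge0 => w _; rewrite lee_fin.
  - apply: (@measurable_fun_fubini_tonelli_G _ _ T T R P (EFin \o g)) => //.
      exact/measurable_EFinP.
  - apply/measurable_EFinP; apply: measurable_funM; first exact: measurable_cst.
    apply: measurable_funX; apply: measurable_sum => j; apply: measurable_funX.
    by have [mZ _ _] := sZ; exact: mZ.
  move=> w' _.
  have tq : tame (fun M : 'M[R]_(l, r + m) => tform eps (zrow (Z w')) dl M).
    by have [dQ [[]]] := @nice_tform R l r m eps eps_gt0 (zrow (Z w')) dl.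
  have ti : P.-integrable setT (fun w => (g (w, w'))%:E) := iY _ (tameX a tq).
  rewrite -[leLHS]fineK ?integrable_fin_num// lee_fin.
  have := tform_moment eps_gt0 (zrow (Z w')) (fun c => sqr_ge0 (bt c)) bt_le s2_ge0 sY v_gt0 ka.
  rewrite -/K mulrC (_ : sqn (zrow (Z w')) = row_sqr i0 (Z w'))//.
  by apply: eq_bigr => j _; rewrite mxE.
have tK : tame (fun N : 'M[R]_(l', r) => K * row_sqr i0 N ^+ a).
  apply: tameM; first exact: tame_cst.
  by apply: tameX; case: (@nice_row_sqr R l' r i0).
have := integrable_fin_num measurableT (iZ _ tK) => /fineK /= <-.
rewrite -EFinM lee_fin.
have -> : fine (\int[P]_w' (K * row_sqr i0 (Z w') ^+ a)%:E)%E =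
   K * \prod_(j < a) (v * (r + 2 * j)%:R).
  rewrite -[LHS]/(\int[P]_w' (K * row_sqr i0 (Z w') ^+ a)) RintegralZl//.
    by rewrite (row_sqr_moment sZ).
  by apply: (iZ _ (tameX _ _)); case: (@nice_row_sqr R l' r i0).
rewrite /K /dfact -[X in v ^+ X](card_ord a) -prodr_const -big_split/= -prodfV.
rewrite -!big_split/= le_eqVlt; apply/orP; left; apply/eqP.
apply: eq_bigr => j _; have kj := ka j.
move: (l%:R - r%:R - 1 - 2 * j%:R) kj => K1 kj.
rewrite [(2 * j + 1)%:R]natrD [(r + 2 * j)%:R]natrD [(2 * j)%:R]natrM.
have j0 : 0 <= j%:R :> R by exact: ler0n.
by field; rewrite !gt_eqF//=; lra.
Qed.

(** R_ii is [phi] at a basis vector, and its first moment is bounded independently of [eps]; this is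
    what lets the regularization be removed at the end. *)
Lemma integral_trace_le : (0 < a)%N ->
  (\int[P]_w (\tr (rsv eps (Y w)))%:E <=
   (r%:R / (v * (l%:R - r%:R - 1)))%:E)%E.
Proof.
move=> a0.
have k1 (j : 'I_1) : 0 < l%:R - r%:R - 1 - 2 * j%:R :> R.
  by have := ka (Ordinal a0); rewrite (ord1 j).
have [_ iY _] := sY.
have ti i : P.-integrable setT (EFin \o (fun w => rsv eps (Y w) i i)).
  exact: (iY _ (@tame_rsv R l r m eps eps_gt0 i i)).
have [ts sE] := Rintegral_sum (index_enum 'I_r) ti.
rewrite -[leLHS]fineK ?(integrable_fin_num measurableT ts)// lee_fin.
rewrite -[leLHS]/(\int[P]_w (\sum_i rsv eps (Y w) i i)) sE.
have -> : r%:R / (v * (l%:R - r%:R - 1)) = \sum_(i < r) (v * (l%:R - r%:R - 1))^-1.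
  by rewrite sumr_const card_ord mulr_natl.
apply: ler_sum => i _.
have := phi_moment eps_gt0 (delta_mx i 0) sY v_gt0 k1.
rewrite big_ord1 mulr0 subr0.
have -> : sqn (delta_mx i 0 : 'cV[R]_r) = 1.
  rewrite /sqn (bigD1 i)//= big1 => [|j ji]; first by rewrite mxE !eqxx expr1n addr0.
  by rewrite mxE (negbTE ji) expr0n.
rewrite mul1r; under eq_Rintegral => w _.
  rewrite expr1 /phi /rvec -colE /dotv (bigD1 i)//= big1 => [|j ji]; last first.
    by rewrite mxE (negbTE ji) mul0r.
  rewrite !mxE !eqxx mul1r addr0.
  over.
by [].
Qed.

End Averaging.

(** * Spectral decomposition and singular values *)

Section SymmetricSpectral.
Context {R : realType}.

(* For a singular value s and v != 0 with v A^2 = s^2 v, either v A + s v is an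
   eigenvector for s, or it vanishes and v is one for - s. *)
Lemma symmetric_eigenvector n (A : 'M[R]_n.+1) : A^T = A ->
  exists (u : 'cV[R]_n.+1) a, sqn u = 1 /\ A *m u = a *: u.
Proof.
move=> symA.
suff [v [a [v0 va]]] : exists (v : 'rV[R]_n.+1) a, v != 0 /\ v *m A = a *: v.
  have vT : A *m v^T = a *: v^T by rewrite -[A]symA -trmx_mul va linearZ.
  have s0 : 0 < sqn v^T.
    rewrite lt_neqAle sqn_ge0 andbT eq_sym sqn_eq0.
    by apply: contra v0 => /eqP vT0; rewrite -[v]trmxK vT0 trmx0.
  exists ((Num.sqrt (sqn v^T))^-1 *: v^T), a; split.
    by rewrite sqnZ exprVn sqr_sqrtr ?ltW// mulVf ?gt_eqF.
  by rewrite -scalemxAr vT scalerA mulrC -scalerA.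
have := char_poly_singular_values A; have := size_singular_values A.
case: (singular_values A) => // s t _ cpE.
have : eigenvalue (A^T *m A) (s ^+ 2).
  by rewrite eigenvalue_root_char cpE big_cons rootM root_XsubC eqxx.
move=> /eigenvalueP[v vE v0]; rewrite symA mulmxA in vE.
have [w0|w0] := eqVneq (v *m A + s *: v) 0.
  by exists v, (- s); split=> //; rewrite scaleNr; apply/eqP; rewrite -addr_eq0 w0.
exists (v *m A + s *: v), s; split=> //.
by rewrite mulmxDl vE -scalemxAl scalerDr scalerA -expr2 addrC.
Qed.

(** The reflection along u - e exchanges the unit vectors u and e; for u = e the identity is
    taken. *)
Lemma householder n (u : 'cV[R]_n.+1) : sqn u = 1 ->
  exists H : 'M[R]_n.+1, [/\ H^T = H, H *m H = 1%:M & H *m delta_mx 0 0 = u].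
Proof.
move=> u1; set e := (delta_mx 0 0 : 'cV[R]_n.+1).
have e1 : sqn e = 1.
  rewrite /sqn (bigD1 0)//= big1 => [|j j0]; first by rewrite mxE !eqxx expr1n addr0.
  by rewrite mxE (negbTE j0) expr0n.
have [ue|ue] := eqVneq u e.
  by exists 1%:M; rewrite trmx1 !mul1mx ue.
pose w := u - e.
have w0 : sqn w != 0 by rewrite sqn_eq0 subr_eq0.
have wE : sqn w = 2 - 2 * dotv u e.
  by rewrite /w -scaleN1r sqnD sqnZ dotvZr u1 e1; ring.
have wTw : w^T *m w = (sqn w)%:M.
  by apply/matrixP => i j; rewrite !ord1 -dotvE dotvv mxE eqxx mulr1n.
exists (1%:M - (2 / sqn w) *: (w *m w^T)); split.
- by rewrite linearB/= linearZ/= trmx1 trmx_mul trmxK.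
- rewrite mulmxBl mul1mx mulmxBr mulmx1 -scalemxAl -scalemxAr -mulmxA.
  rewrite (mulmxA w^T) wTw mul_scalar_mx -scalemxAr !scalerA.
  have -> : 2 / sqn w * (2 / sqn w * sqn w) = 2 / sqn w + 2 / sqn w by field.
  by rewrite scalerDl opprB addrK subrK.
- rewrite mulmxBl mul1mx -scalemxAl -mulmxA.
  have -> : w^T *m e = (dotv w e)%:M.
    by apply/matrixP => i j; rewrite !ord1 -dotvE mxE eqxx mulr1n.
  rewrite mul_mx_scalar scalerA.
  have -> : 2 / sqn w * dotv w e = -1.
    have we : dotv w e = dotv u e - 1.
      by rewrite /w dotvDl -scaleN1r dotvZl dotvv e1 mulN1r.
    by rewrite we; move: wE w0 => ->; move: (dotv u e) => a a0; field.
  by rewrite scaleN1r opprK /w addrC subrK.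
Qed.

(** Deflation: the reflection carrying the first basis vector to an eigenvector makes the first row
    and column diagonal, and induction treats the remaining symmetric block, entirely over the
    reals. *)
Lemma symmetric_diagonalization n (A : 'M[R]_n) : A^T = A ->
  exists (V : 'M[R]_n) (a : 'rV[R]_n), V^T *m V = 1%:M /\ A = V *m diag_mx a *m V^T.
Proof.
elim: n A => [|n ih] A symA.
  by exists 1%:M, 0; split; apply/matrixP => -[].
have [u [a [u1 ua]]] := symmetric_eigenvector symA.
have [H [HT HH He]] := householder u1.
pose B : 'M[R]_(1 + n) := H *m A *m H.
have BT : B^T = B by rewrite /B !trmx_mul HT symA mulmxA.
have Be : (H *m A *m H) *m delta_mx 0 0 = a *: (delta_mx 0 0 : 'cV[R]_n.+1).
  by rewrite -mulmxA He -mulmxA ua -scalemxAr -He mulmxA HH mul1mx.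
have Bcol (i : 'I_n.+1) : B i (0 : 'I_n.+1) = a * (i == 0)%:R.
  have := congr1 (fun M : 'cV_n.+1 => M i 0) Be.
  by rewrite -colE mxE [in RHS]mxE [in X in _ * X]mxE eqxx andbT.
have [V [b [VV drE]]] := ih (drsubmx B) (etrans (trmx_drsub B) (congr1 drsubmx BT)).
have l0 : @lshift 1 n 0 = (0 : 'I_n.+1) by exact: val_inj.
have r0 (i : 'I_n) : (@rshift 1 n i == (0 : 'I_n.+1)) = false by [].
have BE : B = block_mx a%:M 0 0 (V *m diag_mx b *m V^T).
  rewrite -[LHS]submxK -drE; congr block_mx.
  - apply/matrixP => i j; rewrite !ord1 2!mxE l0 Bcol eqxx mulr1.
    by rewrite mxE eqxx mulr1n.
  - apply/matrixP => i j; rewrite ord1 2!mxE -[in LHS]BT [LHS]mxE l0 Bcol r0 mulr0.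
    by rewrite mxE.
  - apply/matrixP => i j; rewrite (ord1 j) 2!mxE l0 Bcol r0 mulr0.
    by rewrite mxE.
pose Q : 'M[R]_(1 + n) := block_mx 1%:M 0 0 V.
have QT : Q^T = block_mx 1%:M 0 0 V^T by rewrite /Q tr_block_mx !trmx0 trmx1.
have QQ : Q^T *m Q = 1%:M.
  rewrite QT /Q mulmx_block !mulmx0 !mul0mx mul1mx VV !addr0 add0r.
  by rewrite -scalar_mx_block.
have BQ : B = Q *m diag_mx (row_mx a%:M b) *m Q^T.
  rewrite BE QT /Q diag_mx_row !mulmx_block !mulmx0 !mul0mx !addr0 !add0r.
  rewrite !mul0mx mul1mx mulmx1; congr block_mx.
  by apply/matrixP => i j; rewrite !ord1 !mxE eqxx.
exists (H *m Q), (row_mx a%:M b); split.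
  by rewrite trmx_mul HT -mulmxA (mulmxA H) HH mul1mx.
have -> : A = H *m B *m H by rewrite /B !mulmxA HH mul1mx -mulmxA HH mulmx1.
by rewrite BQ trmx_mul HT !mulmxA.
Qed.

End SymmetricSpectral.

Section SortedSpectrum.
Context {R : realType} (n : nat).
Implicit Types (V A C : 'M[R]_n) (a b c : 'rV[R]_n).

Definition conj_diag V c : 'M[R]_n := V *m diag_mx c *m V^T.

Lemma conj_diagM V a b : V^T *m V = 1%:M ->
  conj_diag V a *m conj_diag V b = conj_diag V (\row_i (a 0 i * b 0 i)).
Proof.
move=> VV; rewrite /conj_diag -!mulmxA (mulmxA V^T) VV mul1mx (mulmxA (diag_mx a)).
by rewrite mulmx_diag.
Qed.

Lemma conj_diagX V a q : V^T *m V = 1%:M ->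
  conj_diag V a ^+ q = conj_diag V (\row_i (a 0 i ^+ q)).
Proof.
move=> VV; elim: q => [|q ih].
  rewrite expr0 /conj_diag (_ : \row_i _ = const_mx 1); last first.
    by apply/rowP => i; rewrite !mxE expr0.
  by rewrite diag_const_mx mulmx1 (mulmx1C VV).
rewrite exprS ih -[_ * _]/(_ *m _) conj_diagM//; congr conj_diag.
by apply/rowP => i; rewrite !mxE exprS.
Qed.

Lemma conj_diagD V a b : conj_diag V a + conj_diag V b = conj_diag V (a + b).
Proof. by rewrite /conj_diag -mulmxDl -mulmxDr -linearD. Qed.

Lemma conj_diag_scalar V (mu : R) : V^T *m V = 1%:M -> conj_diag V (const_mx mu) = mu%:M.
Proof.
move=> VV; rewrite /conj_diag diag_const_mx mul_mx_scalar -scalemxAl.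
by rewrite (mulmx1C VV) scalemx1.
Qed.

Lemma conj_diagT V c : (conj_diag V c)^T = conj_diag V c.
Proof. by rewrite /conj_diag !trmx_mul trmxK tr_diag_mx mulmxA. Qed.

Lemma char_poly_conj_diag V c : V^T *m V = 1%:M ->
  char_poly (conj_diag V c) = \prod_i ('X - (c 0 i)%:P).
Proof.
move=> VV; have VV' := mulmx1C VV.
have -> : char_poly (conj_diag V c) = char_poly (diag_mx c).
  rewrite /char_poly /char_poly_mx.
  have -> : 'X%:M - map_mx polyC (conj_diag V c) =
    map_mx polyC V *m ('X%:M - map_mx polyC (diag_mx c)) *m map_mx polyC V^T.
    rewrite mulmxBr mulmxBl !map_mxM; congr (_ - _).
    by rewrite scalar_mxC -mulmxA -map_mxM VV' map_mx1 mulmx1.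
  by rewrite !det_mulmx mulrAC -det_mulmx -map_mxM VV' map_mx1 det1 mul1r.
rewrite char_poly_trig; last by apply: diag_mx_is_trig.
by apply: eq_bigr => i _; rewrite mxE eqxx mulr1n.
Qed.

(** The characteristic polynomial of C^T C shows that the squared singular values are the c_i^2 up
    to order; two sorted lists that are permutations of each other coincide. *)
Lemma singular_values_conj_diag V c : V^T *m V = 1%:M ->
  (forall i j : 'I_n, (i <= j)%N -> `|c 0 j| <= `|c 0 i|) ->
  singular_values (conj_diag V c) = [seq `|c 0 i| | i <- enum 'I_n].
Proof.
move=> VV cs; set C := conj_diag V c.
have : perm_eq [seq s ^+ 2 | s <- singular_values C] [seq `|c 0 i| ^+ 2 | i <- enum 'I_n].
  apply: prod_XsubC_eq; rewrite 2!big_map -char_poly_singular_values.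
  rewrite conj_diagT conj_diagM// char_poly_conj_diag// big_enum/=.
  by apply: eq_bigr => i _; rewrite mxE real_normK ?num_real// expr2.
have e1 : map Num.sqrt [seq s ^+ 2 | s <- singular_values C] = singular_values C.
  rewrite -map_comp -[RHS]map_id; apply/eq_in_map => s sC /=.
  by rewrite sqrtr_sqr ger0_norm//; exact: (allP (singular_values_ge0 C)).
have e2 : map Num.sqrt [seq `|c 0 i| ^+ 2 | i <- enum 'I_n] = [seq `|c 0 i| | i <- enum 'I_n].
  by rewrite -map_comp; apply: eq_map => i /=; rewrite sqrtr_sqr normr_id.
move=> /(perm_map Num.sqrt); rewrite e1 e2.
apply: (sorted_eq (leT := >=%R)).
- by move=> y x z /= xy yz; exact: (le_trans yz xy).
- by move=> x y /andP[/= yx xy]; apply/eqP; rewrite eq_le yx xy.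
- exact: singular_values_sorted.
- rewrite sorted_map; apply: (@sub_sorted _ (fun i j : 'I_n => (i <= j)%N)).
    by move=> i j; exact: cs.
  by have := iota_sorted 0 n; rewrite -val_enum_ord sorted_map.
Qed.

Lemma sigma_conj_diag V c (i : 'I_n) : V^T *m V = 1%:M ->
  (forall i j : 'I_n, (i <= j)%N -> `|c 0 j| <= `|c 0 i|) ->
  sigma (conj_diag V c) i.+1 = `|c 0 i|.
Proof.
move=> VV cs; rewrite /sigma singular_values_conj_diag//=.
by rewrite (nth_map i) ?size_enum_ord// nth_ord_enum.
Qed.

(** The order is taken through [f] because two orders of the same eigenvalues are needed, which may
    differ: by |a_i| for the singular values of A, and by |(a_i + mu) a_i^q| for those of A_mu
    A^q. *)
Lemma sorted_diagonalization A (f : R -> R) : A^T = A ->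
  forall V a, V^T *m V = 1%:M -> A = conj_diag V a ->
  exists V' (p : 'S_n), let a' := \row_i a 0 (p i) in
    [/\ V'^T *m V' = 1%:M, A = conj_diag V' a' &
      forall i j : 'I_n, (i <= j)%N -> `|f (a' 0 j)| <= `|f (a' 0 i)|].
Proof.
move=> symA V a VV AE.
pose t := [tuple `|f (a 0 i)| | i < n].
have /tuple_permP[p pE] : perm_eq (sort >=%R t) t by rewrite perm_sort.
exists (col_perm p V), p; split.
- apply/matrixP => i j; rewrite !mxE.
  under eq_bigr do rewrite !mxE.
  have := congr1 (fun M : 'M[R]_n => M (p i) (p j)) VV; rewrite !mxE (inj_eq perm_inj) => <-.
  by apply: eq_bigr => k _; rewrite mxE.
- rewrite AE /conj_diag; apply/matrixP => i j; rewrite !mul_mx_diag !mxE.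
  rewrite (reindex_inj (@perm_inj _ p))/=.
  by apply: eq_bigr => k _; rewrite !mxE.
- move=> i j ij; rewrite !mxE.
  have st : sorted >=%R (sort >=%R t) by apply: sort_sorted => x y; exact: le_total.
  have e (k : 'I_n) : nth 0 (sort >=%R t) k = `|f (a 0 (p k))|.
    by rewrite pE (nth_map k) ?size_enum_ord// nth_ord_enum tnth_mktuple.
  rewrite -!e; apply: (sorted_leq_nth (leT := >=%R)) => //.
  + by move=> y x z /= xy yz; exact: (le_trans yz xy).
  + by move=> x /=.
  + by rewrite inE size_sort size_tuple.
  + by rewrite inE size_sort size_tuple.
Qed.

End SortedSpectrum.

Section SigmaBound.
Context {R : realType} (n : nat).

Lemma card_ord_lt (i : 'I_n) : #|[set j : 'I_n | (j < i)%N]%SET| = i.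
Proof.
rewrite -sum1_card; under eq_bigl do rewrite inE.
by rewrite -(big_ord_widen _ (fun=> 1%N) (ltnW (ltn_ord i))) sum1_card card_ord.
Qed.

Lemma card_ord_le (i : 'I_n) : #|[set j : 'I_n | (j <= i)%N]%SET| = i.+1.
Proof.
rewrite -sum1_card; under eq_bigl do rewrite inE.
by rewrite -(big_ord_widen _ (fun=> 1%N) (ltn_ord i)) sum1_card card_ord.
Qed.

(* Pigeonhole: otherwise the i + 1 entries a_0, ..., a_i would all exceed
   sigma A i.+1 in absolute value. *)
Lemma sigma_shifted_power_le (V A : 'M[R]_n) (a : 'rV[R]_n) (mu : R) q (i : 'I_n) :
  A^T = A -> V^T *m V = 1%:M -> A = conj_diag V a ->
  (forall i j : 'I_n, (i <= j)%N ->
     `|(a 0 j + mu) * a 0 j ^+ q| <= `|(a 0 i + mu) * a 0 i ^+ q|) ->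
  `|(a 0 i + mu) * a 0 i ^+ q| <= sigma A i.+1 ^+ q * (sigma A i.+1 + `|mu|).
Proof.
move=> symA VV AE bs.
have [V' [p []]] := sorted_diagonalization id symA VV AE.
set a' := \row_i _ => VV' AE' as'.
have -> : sigma A i.+1 = `|a 0 (p i)| by rewrite AE' sigma_conj_diag// mxE.
set s := `|a 0 (p i)|; have s0 : 0 <= s by exact: normr_ge0.
rewrite leNgt; apply/negP => lt_b.
have sub1 : [set j : 'I_n | (j <= i)%N]%SET \subset [set j | s < `|a 0 j|]%SET.
  apply/fintype.subsetP => j; rewrite !inE => ji; rewrite ltNge; apply/negP => ajs.
  have := lt_le_trans lt_b (bs _ _ ji); apply/negP; rewrite -leNgt.
  rewrite normrM normrX mulrC ler_pM ?exprn_ge0//.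
    by rewrite lerXn2r ?nnegrE.
  by apply: le_trans (ler_normD _ _) _; rewrite lerD2r.
have sub2 : p @^-1: [set j | s < `|a 0 j|]%SET \subset [set j : 'I_n | (j < i)%N]%SET.
  apply/fintype.subsetP => j; rewrite !inE ltnNge => saj; apply/negP => ij.
  have := as' _ _ ij; rewrite !mxE -/s => /(lt_le_trans saj).
  by rewrite ltxx.
have := leq_trans (subset_leq_card sub1) _; rewrite card_ord_le.
move=> /(_ _ (_ : (_ <= i)%N)); rewrite ltnn; move=> h; apply: notF; apply: h.
apply: leq_trans (_ : _ <= #|[set j : 'I_n | (j < i)%N]%SET|)%N _; last by rewrite card_ord_lt.
apply: leq_trans (subset_leq_card sub2).
rewrite card_preimset//; exact: perm_inj.
Qed.

End SigmaBound.

(** * Deterministic bounds on the residual *)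

Section Deterministic.
Context {R : realType}.

(** The graph of a convex power lies above its tangent at y. Multiplying the induction hypothesis by
    x leaves the surplus (q+1) y^q (x - y)^2. This replaces Jensen's inequality, both for the
    spectral measure of u and for the expectation. *)
Lemma power_tangent (x y : R) q : 0 <= x -> 0 <= y ->
  y ^+ q.+1 + q.+1%:R * y ^+ q * (x - y) <= x ^+ q.+1.
Proof.
move=> x0 y0; elim: q => [|q ih]; first by rewrite expr0 !expr1; lra.
have h1 : 0 <= (q.+1%:R * y ^+ q) * (x - y) ^+ 2.
  by apply: mulr_ge0; [apply: mulr_ge0; [exact: ler0n|exact: exprn_ge0]|exact: sqr_ge0].
have := ler_wpM2l x0 ih; rewrite -exprS; apply: le_trans.
rewrite -subr_ge0 -[q.+2%:R]natr1 (_ : _ - _ = (q.+1%:R * y ^+ q) * (x - y) ^+ 2)//.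
by rewrite [y ^+ q.+2]exprS [y ^+ q.+1]exprS; ring.
Qed.

Lemma power_mean n (x : 'I_n -> R) (u : 'cV[R]_n) (t : R) q :
  (forall i, 0 <= x i) -> 0 < t ->
  \sum_i x i ^+ q.+1 * u i 0 ^+ 2 <= t ^+ q.+1 * sqn u ->
  \sum_i x i * u i 0 ^+ 2 <= t * sqn u.
Proof.
move=> x0 t0 h.
have k0 : 0 < q.+1%:R * t ^+ q by rewrite mulr_gt0// exprn_gt0.
rewrite -(ler_pM2l k0) -subr_le0.
apply: (@le_trans _ _ (\sum_i x i ^+ q.+1 * u i 0 ^+ 2 - t ^+ q.+1 * sqn u)); last first.
  by rewrite subr_le0.
rewrite /sqn !mulr_sumr -!sumrB; apply: ler_sum => i _.
have := ler_wpM2r (sqr_ge0 (u i 0)) (power_tangent q (x0 i) (ltW t0)); lra.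
Qed.

Lemma enorm_le n (x y : 'cV[R]_n) : (forall i, `|x i 0| <= `|y i 0|) -> enorm x <= enorm y.
Proof.
move=> xy; rewrite !enormE ler_sqrt ?sqn_ge0//; apply: ler_sum => i _.
rewrite -[x i 0 ^+ 2]real_normK ?num_real// -[y i 0 ^+ 2]real_normK ?num_real//.
by apply: lerXn2r; rewrite ?nnegrE.
Qed.

Lemma enorm_orth m n (V : 'M[R]_(m, n)) (x : 'cV[R]_n) : V^T *m V = 1%:M -> enorm (V *m x) = enorm x.
Proof.
by move=> VV; rewrite !enormE -!dotvv dotv_mul mulmxA VV mul1mx.
Qed.

Lemma shifted_power_le n (V : 'M[R]_n) (a : 'rV[R]_n) (mu tau : R) q (u : 'cV[R]_n) :
  V^T *m V = 1%:M -> 0 < tau ->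
  enorm (conj_diag V (\row_i ((a 0 i + mu) * a 0 i ^+ q)) *m u) <= tau * enorm u ->
  enorm (conj_diag V (\row_i (a 0 i + mu)) *m u) <=
    (`|mu| + tau `^ (q.+1%:R)^-1) * enorm u.
Proof.
move=> VV tau0 hB; have VV' := mulmx1C VV.
pose c := V^T *m u.
have cu : enorm c = enorm u by rewrite /c enorm_orth// trmxK.
pose dc (b : 'I_n -> R) : 'cV[R]_n := \col_i (b i * c i 0).
have diagE (b : 'I_n -> R) : enorm (conj_diag V (\row_i b i) *m u) = enorm (dc b).
  rewrite /conj_diag -!mulmxA enorm_orth//; congr enorm.
  by apply/colP => i; rewrite mul_diag_mx !mxE; congr (_ * _); rewrite /c mxE.
move: hB; rewrite !diagE => hB.
(* Being below both |a_i| and |a_i + mu|, this satisfies w_i^(q+1) <= |(a_i + mu) a_i^q|, while |a_i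
   + mu| <= w_i + |mu|: the shift is paid for once, outside the convexity argument. *)
pose w i : R := Num.max 0 (`|a 0 i + mu| - `|mu|).
have w0 i : 0 <= w i by rewrite /w le_max lexx.
have wa i : w i <= `|a 0 i|.
  rewrite /w ge_max normr_ge0/= lerBlDr.
  exact: ler_normD.
have wam i : w i <= `|a 0 i + mu|.
  by rewrite /w ge_max normr_ge0/= gerBl.
have amw i : `|a 0 i + mu| <= w i + `|mu|.
  by rewrite -lerBlDr /w le_max lexx orbT.
pose th := tau `^ (q.+1%:R)^-1.
have th0 : 0 < th by exact: powR_gt0.
have thq : th ^+ q.+1 = tau.
  by rewrite -powR_mulrn ?powR_ge0// -powRrM mulVf ?powRr1 ?ltW// pnatr_eq0.
have wle : enorm (dc w) <= th * enorm u.
  rewrite -cu -(@ler_pXn2r _ 2)// ?nnegrE ?mulr_ge0 ?enorm_ge0 ?(ltW th0)//.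
  rewrite exprMn !enorm_sqr /sqn.
  under eq_bigr do rewrite mxE exprMn.
  (* The mean inequality is applied to the squares w_i^2 and th^2, since the norms are Euclidean. *)
  apply: (power_mean (q := q)); [by move=> i; exact: sqr_ge0|by rewrite exprn_gt0|].
  rewrite -exprM mulnC exprM thq -enorm_sqr -exprMn.
  have hB2 : enorm (dc (fun i => (a 0 i + mu) * a 0 i ^+ q)) ^+ 2 <= (tau * enorm c) ^+ 2.
    by rewrite lerXn2r ?nnegrE ?mulr_ge0 ?enorm_ge0 ?(ltW tau0)// cu.
  apply: le_trans hB2; rewrite enorm_sqr; apply: ler_sum => i _.
  rewrite [in leRHS]mxE [leRHS]exprMn ler_wpM2r ?sqr_ge0// -exprM mulnC exprM.
  rewrite -[leRHS]real_normK ?num_real// lerXn2r ?nnegrE ?exprn_ge0//.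
  rewrite exprS normrM normrX ler_pM ?exprn_ge0//.
  by rewrite lerXn2r ?nnegrE.
apply: (@le_trans _ _ (enorm ((\col_i (w i * `|c i 0|)) + (\col_i (`|mu| * `|c i 0|)) : 'cV[R]_n))).
  apply: enorm_le => i; rewrite !mxE normrM -mulrDl (le_trans _ (ler_norm _))// ler_wpM2r//.
apply: le_trans (enormD _ _) _; rewrite addrC mulrDl lerD//.
  rewrite (_ : \col_i _ = `|mu| *: (\col_i `|c i 0|)); last first.
    by apply/colP => i; rewrite !mxE.
  rewrite enormZ normr_id ler_wpM2l// -cu.
  by apply: enorm_le => i; rewrite mxE normr_id.
by apply: le_trans wle; apply: enorm_le => i; rewrite !mxE !normrM normr_id.
Qed.

End Deterministic.

Section Residual.
Context {R : realType}.

Lemma orthoproj_compl_idem n p (M : 'M[R]_(n, p)) :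
  let Q := 1%:M - orthoproj M in [/\ Q^T = Q, Q *m Q = Q & M^T *m Q = 0].
Proof.
have [PT PP /eqmxP/andP[_ /submxP[Z MZ]]] := orthoprojP M.
have QQ : orthoproj M *m (1%:M - orthoproj M) = 0.
  by rewrite mulmxBr mulmx1 PP subrr.
split; first by rewrite linearB/= trmx1 PT.
  by rewrite mulmxBl mul1mx QQ subr0.
by rewrite MZ PT -mulmxA QQ mulmx0.
Qed.

(** For xi = Q A x, symmetry of Q and A gives |xi|^2 = <A xi, x> <= |A xi| |x|, and xi is killed by
    M^T; one factor |xi| then cancels. *)
Lemma residual_le n p (M : 'M[R]_(n, p)) (Am : 'M[R]_n) (kappa : R) :
  Am^T = Am -> 0 <= kappa ->
  (forall u : 'cV[R]_n, M^T *m u = 0 -> enorm (Am *m u) <= kappa * enorm u) ->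
  spectral_norm ((1%:M - orthoproj M) *m Am) <= kappa.
Proof.
move=> symA kappa0 hM; have [QT QQ MQ] := orthoproj_compl_idem M.
set Q := 1%:M - orthoproj M in QT QQ MQ *.
apply: ge_sup.
  exists (enorm (Q *m Am *m 0)), 0 => //=.
  by rewrite enormE /sqn big1 ?sqrtr0// => i _; rewrite mxE expr0n.
move=> _ [x /= x1 <-]; set xi := Q *m Am *m x.
have Qxi : Q *m xi = xi by rewrite /xi !mulmxA QQ.
have Axi : enorm (Am *m xi) <= kappa * enorm xi.
  by apply: hM; rewrite /xi -mulmxA mulmxA MQ mul0mx.
have : enorm xi ^+ 2 <= enorm xi * kappa.
  rewrite enorm_sqr -dotvv {2}/xi -mulmxA dotv_mul QT Qxi dotv_mul symA.
  apply: le_trans (dotv_le _ _) _; rewrite mulrC [leRHS]mulrC.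
  by apply: le_trans Axi; rewrite ler_piMl ?enorm_ge0.
have [->//|x0] := eqVneq (enorm xi) 0.
by rewrite expr2 ler_pM2l// lt_neqAle eq_sym x0 enorm_ge0.
Qed.

Lemma enorm_col_mx p q (x : 'cV[R]_p) (y : 'cV[R]_q) :
  enorm (col_mx x y) <= enorm x + enorm y.
Proof.
have -> : col_mx x y = col_mx x 0 + col_mx 0 y by rewrite add_col_mx addr0 add0r.
have sq (p' q' : nat) (x' : 'cV[R]_p') (y' : 'cV[R]_q') : sqn (col_mx x' y') = sqn x' + sqn y'.
  rewrite /sqn big_split_ord/=; congr (_ + _); apply: eq_bigr => i _.
    by rewrite col_mxEu.
  by rewrite col_mxEd.
have sq0 p' : sqn (0 : 'cV[R]_p') = 0 by rewrite /sqn big1// => i _; rewrite mxE expr0n.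
apply: le_trans (enormD _ _) _.
by rewrite !enormE !sq !sq0 addr0 add0r.
Qed.

(** The last coordinates of diag(b) c are at most s |c|; the first r are determined by them up to
    the regularization error. The three summands are s, a majorant of S, and that error. *)
Lemma kernel_image_le l r m (eps s psi : R) a (M : 'M[R]_(l, r + m)) (b : 'I_(r + m) -> R)
    (c : 'cV[R]_(r + m)) :
  0 < eps -> (0 < a)%N -> 0 <= psi -> 0 <= s ->
  (forall i, `|b (rshift r i)| <= s) ->
  (forall e, sqn (pvec eps (fun i => b (rshift r i)) M e) ^+ a <= sqn e ^+ a * psi) ->
  M *m \col_i (b i * c i 0) = 0 ->
  enorm (\col_i (b i * c i 0)) <= (s + psi `^ (2 * a)%:R^-1 +
     Num.sqrt (eps * (\tr (rsv eps M) * \sum_i b i ^+ 2))) * enorm c.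
Proof.
move=> e0 a0 psi0 s0 bs pv; set y := \col_i _.
rewrite -{1}[M]hsubmxK -{1}[y]vsubmxK mul_row_col => My.
have y2E : dsubmx y = wcol (fun i => b (rshift r i)) (dsubmx c).
  by apply/colP => i; rewrite !mxE.
rewrite y2E in My; have y1E := kernel_vector e0 My.
have ec2 : enorm (dsubmx c) <= enorm c.
  rewrite !enormE ler_sqrt ?sqn_ge0// /sqn [leRHS]big_split_ord/= ler_wpDl//.
    by apply: sumr_ge0 => i _; exact: sqr_ge0.
  by apply: ler_sum => i _; rewrite mxE.
have ey2 : enorm (dsubmx y) <= s * enorm (dsubmx c).
  rewrite -[s]ger0_norm// -enormZ; apply: enorm_le => i.
  by rewrite !mxE !normrM (ger0_norm s0) ler_wpM2r.
have pvle : enorm (pvec eps (fun i => b (rshift r i)) M (dsubmx c)) <=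
    psi `^ (2 * a)%:R^-1 * enorm (dsubmx c).
  have a2 : (0 < 2 * a)%N by rewrite muln_gt0.
  rewrite -(@ler_pXn2r _ (2 * a))// ?nnegrE ?mulr_ge0 ?powR_ge0 ?enorm_ge0//.
  rewrite [leRHS]exprMn -[X in _ <= X * _]powR_mulrn ?powR_ge0// -powRrM.
  rewrite mulVf ?pnatr_eq0 -?lt0n// powRr1// !exprM !enorm_sqr mulrC.
  exact: pv.
have ry : enorm (eps *: (rsv eps M *m usubmx y)) <=
    Num.sqrt (eps * (\tr (rsv eps M) * \sum_i b i ^+ 2)) * enorm c.
  rewrite !enormE -sqrtrM; last first.
    by rewrite !mulr_ge0 ?(ltW e0) ?rsv_trace_ge0// sumr_ge0// => i _; exact: sqr_ge0.
  rewrite ler_sqrt; last first.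
    by rewrite !mulr_ge0 ?sqn_ge0 ?(ltW e0) ?rsv_trace_ge0// sumr_ge0// => i _; exact: sqr_ge0.
  rewrite sqnZ expr2 -mulrA -[leRHS]mulrA ler_pM2l//.
  apply: le_trans (rsv_mul_le e0 _ _) _.
  rewrite -mulrA ler_wpM2l ?rsv_trace_ge0//.
  rewrite /sqn [in leRHS]big_distrl/= [leRHS]big_split_ord/= ler_wpDr//.
    by apply: sumr_ge0 => i _; rewrite mulr_ge0 ?sqr_ge0 ?sqn_ge0.
  apply: ler_sum => i _; rewrite mxE mxE exprMn ler_wpM2l ?sqr_ge0//.
  exact: coord_sqr_le_sqn.
have y1 : enorm (usubmx y) <= psi `^ (2 * a)%:R^-1 * enorm (dsubmx c) +
    Num.sqrt (eps * (\tr (rsv eps M) * \sum_i b i ^+ 2)) * enorm c.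
  rewrite [in leLHS]y1E; apply: le_trans (enormD _ _) _; apply: lerD => //.
  by rewrite -scaleN1r enormZ normrN1 mul1r.
rewrite -[leLHS](congr1 (@enorm R _) (vsubmxK y)).
apply: le_trans (enorm_col_mx _ _) _.
have k1 := ler_wpM2l s0 ec2.
have k2 := ler_wpM2l (powR_ge0 psi (2 * a)%:R^-1) ec2.
by rewrite !mulrDl; lra.
Qed.

End Residual.

(** * Measurability of the residual *)

Section CountableQuantifiers.
Context {d : measure_display} {T : measurableType d} (J : countType).

Lemma measurable_forall (F : J -> set T) : (forall i, measurable (F i)) ->
  measurable [set w | forall i, F i w].
Proof.
move=> mF; pose G k := if @unpickle J k is Some i then F i else setT.
have -> : [set w | forall i, F i w] = \bigcap_k G k.
  apply/seteqP; split=> w /=; first by move=> h k _; rewrite /G; case: unpickle.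
  by move=> h i; have := h (pickle i) I; rewrite /G pickleK.
by apply: bigcapT_measurable => k; rewrite /G; case: unpickle.
Qed.

Lemma measurable_exists (F : J -> set T) : (forall i, measurable (F i)) ->
  measurable [set w | exists i, F i w].
Proof.
move=> mF; pose G k := if @unpickle J k is Some i then F i else set0.
have -> : [set w | exists i, F i w] = \bigcup_k G k.
  apply/seteqP; split=> w /=; first by move=> [i Fi]; exists (pickle i); rewrite // /G pickleK.
  by move=> [k _]; rewrite /G; case: unpickle => // i Fi; exists i.
by apply: bigcupT_measurable => k; rewrite /G; case: unpickle.
Qed.

End CountableQuantifiers.

Section ResidualMeasurability.
Context {R : realType}.

Lemma enorm_mul_le m n (M : 'M[R]_(m, n)) (x : 'cV[R]_n) :
  enorm (M *m x) <= Num.sqrt (\sum_i \sum_j M i j ^+ 2) * enorm x.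
Proof.
have F0 : 0 <= \sum_i \sum_j M i j ^+ 2.
  by do 2 (apply: sumr_ge0 => ? _); exact: sqr_ge0.
rewrite !enormE -sqrtrM// ler_sqrt; last by rewrite mulr_ge0// sqn_ge0.
rewrite {1}/sqn mulr_suml; apply: ler_sum => i _.
have -> : (M *m x) i 0 = dotv (row i M)^T x.
  by rewrite mxE; apply: eq_bigr => j _; rewrite !mxE.
apply: le_trans (dotv_sqr_le _ _) _; rewrite ler_wpM2r ?sqn_ge0// ler_sum// => j _.
by rewrite !mxE.
Qed.

Lemma rational_approx n (x : 'cV[R]_n) (e : R) : 0 < e ->
  exists y : 'cV[rat]_n, enorm (x - map_mx ratr y) <= e.
Proof.
move=> e0; pose dl := e / n.+1%:R.
have dl0 : 0 < dl by rewrite divr_gt0.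
have /choice[q qE] (i : 'I_n) : exists q : rat, `|x i 0 - ratr q| < dl.
  have : x i 0 - dl < x i 0 + dl by rewrite ltrD2l gtrN.
  move=> /rat_in_itvoo[q]; rewrite in_itv/= => /andP[h1 h2]; exists q.
  by rewrite ltr_norml; apply/andP; split; lra.
exists (\col_i q i).
have dln : dl *+ n <= e.
  by rewrite -mulr_natr /dl -mulrA ler_piMr ?(ltW e0)// ler_pdivrMl// mulr1 ler_nat.
apply: le_trans dln.
rewrite -(@ler_pXn2r _ 2)// ?nnegrE ?enorm_ge0 ?mulrn_wge0 ?(ltW dl0)// enorm_sqr.
apply: (@le_trans _ _ (\sum_(i < n) dl ^+ 2)).
  apply: ler_sum => i _; rewrite !mxE -[leLHS]real_normK ?num_real//.
  by rewrite lerXn2r ?nnegrE ?(ltW dl0)// ltW.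
rewrite sumr_const card_ord exprMn_n; apply: ler_wpMn2l; first exact: sqr_ge0.
by case: (n) => // k; rewrite -mulnn leq_pmulr.
Qed.

Lemma spectral_norm_ge0 m n (C : 'M[R]_(m, n)) : 0 <= spectral_norm C.
Proof.
apply: (@le_trans _ _ (enorm (C *m 0))); first exact: enorm_ge0.
apply: ub_le_sup; last first.
  by exists 0 => //=; rewrite enormE /sqn big1 ?sqrtr0// => i _; rewrite mxE expr0n.
exists (Num.sqrt (\sum_i \sum_j C i j ^+ 2)) => _ [x /= x1 <-].
by apply: le_trans (enorm_mul_le _ _) _; rewrite ler_piMr ?sqrtr_ge0.
Qed.

Lemma enorm_le_spectral_norm m n (C : 'M[R]_(m, n)) (x : 'cV[R]_n) :
  enorm (C *m x) <= spectral_norm C * enorm x.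
Proof.
have [/eqP x0|x0] := eqVneq (enorm x) 0.
  by apply: le_trans (enorm_mul_le _ _) _; rewrite (eqP x0) !mulr0.
have xp : 0 < enorm x by rewrite lt_neqAle eq_sym x0 enorm_ge0.
rewrite -ler_pdivrMr// mulrC -[X in X * _]ger0_norm ?invr_ge0 ?enorm_ge0//.
rewrite -enormZ scalemxAr; apply: ub_le_sup; last first.
  exists ((enorm x)^-1 *: x) => //=.
  by rewrite enormZ ger0_norm ?invr_ge0 ?enorm_ge0// mulVf.
exists (Num.sqrt (\sum_i \sum_j C i j ^+ 2)) => _ [y /= y1 <-].
by apply: le_trans (enorm_mul_le _ _) _; rewrite ler_piMr ?sqrtr_ge0.
Qed.

Lemma spectral_norm_le m n (C : 'M[R]_(m, n)) kappa : 0 <= kappa ->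
  (forall x, enorm (C *m x) <= kappa * enorm x) -> spectral_norm C <= kappa.
Proof.
move=> k0 hC; apply: ge_sup.
  exists (enorm (C *m 0)), 0 => //=.
  by rewrite enormE /sqn big1 ?sqrtr0// => i _; rewrite mxE expr0n.
move=> _ [x /= x1 <-]; apply: le_trans (hC x) _.
by rewrite ler_piMr.
Qed.

(* Only countable quantifiers and no projector on the right-hand side: the residual
   at x is the distance from Am x to the range of G. *)
Lemma residual_leP n p (G : 'M[R]_(n, p)) (Am : 'M[R]_n) (kappa : R) : 0 <= kappa ->
  spectral_norm ((1%:M - orthoproj G) *m Am) <= kappa <->
  forall (x : 'cV[rat]_n) (j : nat), exists y : 'cV[rat]_p,
    enorm (Am *m map_mx ratr x - G *m map_mx ratr y) <
      kappa * enorm (map_mx ratr x : 'cV[R]_n) + j.+1%:R^-1.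
Proof.
move=> k0; have [QT QQ GQ] := orthoproj_compl_idem G.
have [PT PP /eqmxP/andP[/submxP[Z PZ] _]] := orthoprojP G.
set Q := 1%:M - orthoproj G in QT QQ GQ *.
have QG : Q *m G = 0 by rewrite -[LHS]trmxK trmx_mul QT GQ trmx0.
have Qc v : enorm (Q *m v) <= enorm v.
  have [->|v0] := eqVneq (enorm (Q *m v)) 0; first exact: enorm_ge0.
  rewrite -(@ler_pM2l _ (enorm (Q *m v))) ?lt_neqAle ?(eq_sym 0) ?v0 ?enorm_ge0//.
  rewrite -expr2 enorm_sqr -dotvv dotv_mul QT mulmxA QQ; exact: dotv_le.
split=> [hk x j|h].
  set xr : 'cV[R]_n := map_mx ratr x.
  (* Here [orthoproj G] = G Z^T, so G y0 is the projection of the vector to be approximated and y0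
     attains the distance. *)
  pose y0 := Z^T *m (Am *m xr).
  pose K := Num.sqrt (\sum_i \sum_j G i j ^+ 2).
  have K0 : 0 <= K by exact: sqrtr_ge0.
  (* Taking j + 2 instead of j + 1 makes the final inequality strict. *)
  have jK : 0 < (j.+2%:R * (K + 1))^-1 :> R by rewrite invr_gt0 mulr_gt0// ltr_wpDl.
  have [y yE] := rational_approx y0 jK; exists y.
  have -> : Am *m xr - G *m map_mx ratr y =
      Q *m Am *m xr + G *m (y0 - map_mx ratr y).
    rewrite mulmxBr /y0 mulmxA -[G *m Z^T]trmxK trmx_mul trmxK -PZ trmxK.
    by rewrite addrA /Q mulmxBl mul1mx mulmxBl -[orthoproj G *m Am *m xr]mulmxA subrK.
  apply: le_lt_trans (enormD _ _) _; apply: ler_ltD.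
    apply: le_trans (enorm_le_spectral_norm _ _) _.
    by rewrite ler_wpM2r ?enorm_ge0.
  apply: le_lt_trans (enorm_mul_le _ _) _; rewrite -/K.
  apply: le_lt_trans (ler_wpM2l K0 yE) _.
  apply: (@le_lt_trans _ _ (j.+2%:R^-1)).
    rewrite invfM mulrCA ler_piMr ?invr_ge0// ler_pdivrMr ?mul1r ?lerDl//.
    by rewrite ltr_wpDl.
  by rewrite ltf_pV2 ?posrE ?ltr0n// ltr_nat.
apply: spectral_norm_le => // x.
have hr (x' : 'cV[rat]_n) : enorm (Q *m Am *m map_mx ratr x') <= kappa * enorm (map_mx ratr x' : 'cV[R]_n).
  apply/ler_addgt0Pr => e e0.
  have [j je] : exists j : nat, j.+1%:R^-1 < e.
    exists (Num.truncn e^-1); rewrite -[ltRHS]invrK ltf_pV2 ?posrE ?invr_gt0//.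
    exact: truncnS_gt.
  have [y yE] := h x' j.
  apply: le_trans (_ : _ <= enorm (Am *m map_mx ratr x' - G *m map_mx ratr y)) _.
    by apply: le_trans (Qc _); rewrite mulmxBr !mulmxA QG mul0mx subr0.
  by apply: le_trans (ltW yE) _; rewrite lerD2l ltW.
apply/ler_addgt0Pr => e e0.
pose K := spectral_norm (Q *m Am).
have K0 : 0 <= K by exact: spectral_norm_ge0.
have e1 : 0 < e / (kappa + K + 1) by rewrite divr_gt0// ltr_wpDl// addr_ge0.
have [x' xE] := rational_approx x e1.
set xr : 'cV[R]_n := map_mx ratr x' in xE.
have -> : x = xr + (x - xr) by rewrite subrKC.
rewrite mulmxDr; apply: le_trans (enormD _ _) _.
have h1 := hr x'; rewrite -/xr in h1.
have h2 : enorm (Q *m Am *m (x - xr)) <= K * (e / (kappa + K + 1)).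
  by apply: le_trans (enorm_le_spectral_norm _ _) _; rewrite ler_wpM2l.
have h3 : enorm xr <= enorm (xr + (x - xr)) + e / (kappa + K + 1).
  have := enormD x (-1 *: (x - xr)).
  rewrite enormZ normrN1 mul1r scaleN1r opprB subrKC => /le_trans; apply.
  by rewrite subrKC lerD2l.
have h4 := ler_wpM2l k0 h3.
have h5 : (kappa + K) * (e / (kappa + K + 1)) <= e.
  rewrite mulrCA ler_piMr ?(ltW e0)// ler_pdivrMr ?mul1r ?lerDl//.
  by rewrite ltr_wpDl// addr_ge0.
rewrite mulrDl in h5; rewrite mulrDr in h4.
by lra.
Qed.

Lemma measurable_residual d (T : measurableType d) n p (G : T -> 'M[R]_(n, p)) (Am : 'M[R]_n) :
  coord_measurable G ->
  measurable_fun setT (fun w => spectral_norm ((1%:M - orthoproj (G w)) *m Am)).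
Proof.
move=> mG; apply: (@measurability _ _ _ _ _ _ (@RGenOInfty.G R)) => //.
  exact: RGenOInfty.measurableE.
move=> _ [_ [kappa ->] <-]; rewrite setTI.
set err := fun w => _.
have -> : err @^-1` `]kappa, +oo[%classic = ~` [set w | err w <= kappa].
  apply/seteqP; split=> w /=; rewrite in_itv/= andbT ltNge; first by move/negP.
  by move=> h; apply/negP.
apply: measurableC; have [k0|k0] := leP 0 kappa; last first.
  rewrite (_ : [set w | _] = set0)//; apply/seteqP; split=> w //= h.
  have := lt_le_trans k0 (spectral_norm_ge0 ((1%:M - orthoproj (G w)) *m Am)).
  by move=> /lt_le_trans/(_ h); rewrite ltxx.
have -> : [set w | err w <= kappa] = [set w | forall (x : 'cV[rat]_n) (j : nat), exists y : 'cV[rat]_p,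
    enorm (Am *m map_mx ratr x - G w *m map_mx ratr y) <
      kappa * enorm (map_mx ratr x : 'cV[R]_n) + j.+1%:R^-1].
  by apply/seteqP; split=> w /= /(residual_leP _ _ k0).
apply: measurable_forall => x; apply: measurable_forall => j.
apply: measurable_exists => y.
rewrite -[X in measurable X]setTI.
have mf : measurable_fun setT (fun w => enorm (Am *m map_mx ratr x - G w *m map_mx ratr y)).
  under eq_fun do rewrite enormE -powR12_sqrt ?sqn_ge0//.
  apply: (@measurableT_comp _ _ _ _ _ _ (@powR R ^~ 2^-1) _
    (fun w => sqn (Am *m map_mx ratr x - G w *m map_mx ratr y))) => //.
  apply: measurable_sum => i; apply: measurable_funX.
  under eq_fun do rewrite mxE [X in _ + X]mxE; apply: measurable_funB; first exact: measurable_cst.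
  under eq_fun do rewrite mxE; apply: measurable_sum => k.
  by apply: measurable_funM; [exact: mG|exact: measurable_cst].
have := mf measurableT `]-oo, (kappa * enorm (map_mx ratr x : 'cV[R]_n) + j.+1%:R^-1)[%classic (measurable_itv _).
by congr (measurable _); apply/seteqP; split=> w /=; rewrite in_itv.
Qed.

End ResidualMeasurability.

(** * Numerical constants *)

Section MomentConstant.
Context {R : realType}.
Implicit Types (kk : R) (a : nat).

(** What remains of the bound on the moment once (F2 + 2 j s2) / k has been taken out of each
    factor. The argument is real, so that k = 2a and k = 2a - 1 go through the same recursion. *)
Definition gamma_prod kk a : R :=
  \prod_(j < a) ((kk - 1 + 2 * j%:R) * kk / ((2 * j%:R + 1) * (kk + 2 - 2 * j%:R))).

(** (1 + 2/k)^a <= exp(2a/k) <= exp(6/5) < 7/2. The ratio 6/5 is (k + 1)/k at k = 5, the worst odd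
    case in the induction. *)
Lemma pow_ratio_le kk a : 4 <= kk -> 2 * a%:R <= 6 / 5 * kk ->
  ((kk + 2) / kk) ^+ a <= 7 / 2.
Proof.
move=> k4 ak; have k0 : 0 < kk by lra.
have h1 : (kk + 2) / kk <= expR (2 / kk).
  by apply: le_trans (expR_ge1Dx _); rewrite mulrDl divff ?gt_eqF.
apply: (@le_trans _ _ (expR (2 / kk) ^+ a)).
  by rewrite lerXn2r ?nnegrE ?expR_ge0// divr_ge0//; lra.
rewrite -expRM_natr.
(* The exponent 6/5 is cut into 20 parts, so that the crude bound exp(x) <= 1/(1 - x) at x = 3/50 is
   accurate enough. *)
have h2 : 2 / kk * a%:R <= 3 / 50 * 20%:R.
  by rewrite mulrAC ler_pdivrMr//; lra.
apply: (@le_trans _ _ (expR (3 / 50 * 20%:R))); first by rewrite ler_expR.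
rewrite expRM_natr.
have h3 : expR (3 / 50) <= 50 / 47 :> R.
  have := expR_ge1Dx (- (3 / 50) : R); rewrite expRN => h.
  rewrite -[expR _]invrK -[50 / 47]invrK lef_pV2 ?posrE ?invr_gt0 ?expR_gt0 ?divr_gt0//.
  by apply: le_trans h; lra.
apply: (@le_trans _ _ ((50 / 47) ^+ 20)).
  by rewrite lerXn2r ?nnegrE ?expR_ge0// divr_ge0.
have s1 : (50 / 47) ^+ 5 <= 15 / 11 :> R by rewrite !exprS expr0; lra.
have s2 : (50 / 47 : R) ^+ 20 = ((50 / 47) ^+ 5) ^+ 4 by rewrite -exprM.
rewrite s2; apply: (@le_trans _ _ ((15 / 11) ^+ 4)).
  by rewrite lerXn2r ?nnegrE// ?exprn_ge0// divr_ge0.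
by rewrite !exprS expr0; lra.
Qed.

(** Replacing (k, a) by (k + 2, a + 1) makes the products telescope: the quotient is a rational
    function [rho] <= 4 times ((k + 2)/k)^a <= 7/2, hence the factor 14. *)
Lemma gamma_prod_step kk a : 4 <= kk ->
  kk = 2 * a%:R \/ kk = 2 * a%:R - 1 /\ 5 <= kk ->
  gamma_prod (kk + 2) a.+1 <= 14 * gamma_prod kk a.
Proof.
move=> k4 ka; have k0 : 0 < kk by lra.
pose P1 x b : R := \prod_(j < b) (x - 1 + 2 * j%:R).
pose P2 b : R := \prod_(j < b) (2 * j%:R + 1).
pose P3 x b : R := \prod_(j < b) (x + 2 - 2 * j%:R).
have gE x b : gamma_prod x b = P1 x b * x ^+ b / (P2 b * P3 x b).
  rewrite /gamma_prod /P1 /P2 /P3 -[X in x ^+ X](card_ord b) -prodr_const.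
  by rewrite -!big_split/= -prodfV -big_split.
have p1 : P1 (kk + 2) a.+1 * (kk - 1) = P1 kk a * (kk - 1 + 2 * a%:R) * (kk + 1 + 2 * a%:R).
  transitivity (P1 kk a.+2).
    rewrite [in RHS]/P1 big_ord_recl mulr0 addr0 mulrC; congr (_ * _).
    by apply: eq_bigr => j _; rewrite lift0 -[j.+1%:R]natr1; ring.
  by rewrite /P1 !big_ord_recr/= -[a.+1%:R]natr1; ring.
have p3 : P3 (kk + 2) a.+1 = (kk + 4) * P3 kk a.
  rewrite /P3 big_ord_recl mulr0 subr0; congr (_ * _); first ring.
  by apply: eq_bigr => j _; rewrite lift0 -[j.+1%:R]natr1; ring.
have p2 : P2 a.+1 = P2 a * (2 * a%:R + 1) by rewrite /P2 big_ord_recr.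
have a0 : 0 <= a%:R :> R by exact: ler0n.
have ja (j : 'I_a) : j%:R + 1 <= a%:R :> R by rewrite natr1 ler_nat.
have P10 : 0 <= P1 kk a.
  by apply: prodr_ge0 => j _; have j0 : 0 <= j%:R :> R := ler0n _ _; lra.
have P20 : 0 < P2 a.
  by apply: prodr_gt0 => j _; have j0 : 0 <= j%:R :> R := ler0n _ _; lra.
have P30 : 0 < P3 kk a.
  by apply: prodr_gt0 => j _; have := ja j; case: ka => [|[]]; lra.
have pr : ((kk + 2) / kk) ^+ a <= 7 / 2.
  by apply: pow_ratio_le => //; case: ka => [|[]]; lra.
set rho := (kk - 1 + 2 * a%:R) * (kk + 1 + 2 * a%:R) * (kk + 2) / ((kk - 1) * (2 * a%:R + 1) * (kk + 4)).
have rho4 : rho <= 4.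
  rewrite /rho ler_pdivrMr; last by rewrite !mulr_gt0//; lra.
  case: ka => [e|[e k5]].
    rewrite -e; have h : 0 <= (kk - 4) * (kk - 4) by apply: mulr_ge0; lra.
    by lra.
  have -> : 2 * a%:R = kk + 1 by lra.
  have h : 0 <= (kk + 2) * (kk - 2) by apply: mulr_ge0; lra.
  by lra.
have rho0 : 0 <= rho.
  by rewrite /rho divr_ge0// !mulr_ge0//; lra.
have E : gamma_prod (kk + 2) a.+1 = rho * ((kk + 2) / kk) ^+ a * gamma_prod kk a.
  rewrite !gE p2 p3 exprS expr_div_n /rho.
  have -> : P1 (kk + 2) a.+1 = P1 kk a * (kk - 1 + 2 * a%:R) * (kk + 1 + 2 * a%:R) / (kk - 1).
    by rewrite -p1 mulfK// gt_eqF//; lra.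
  have kn : kk ^+ a != 0 by rewrite expf_neq0// gt_eqF.
  have d1 : kk - 1 != 0 by rewrite gt_eqF//; lra.
  have d2 : 2 * a%:R + 1 != 0 :> R by rewrite gt_eqF//; lra.
  have d3 : kk + 4 != 0 by rewrite gt_eqF//; lra.
  have d4 : P2 a != 0 by rewrite gt_eqF.
  have d5 : P3 kk a != 0 by rewrite gt_eqF.
  move: (P1 kk a) (P2 a) (P3 kk a) d4 d5 => x1 x2 x3 d4 d5.
  move: (kk ^+ a) ((kk + 2) ^+ a) kn => y1 y2 kn.
  by field; rewrite kn d1 d2 d3 d4 d5.
have g0 : 0 <= gamma_prod kk a.
  by rewrite gE divr_ge0 ?mulr_ge0 ?exprn_ge0 ?(ltW k0) ?(ltW P20) ?(ltW P30).
rewrite E ler_wpM2r//.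
have q0 : 0 <= ((kk + 2) / kk) ^+ a by rewrite exprn_ge0// divr_ge0//; lra.
apply: le_trans (ler_pM rho0 q0 rho4 pr) _; lra.
Qed.

Lemma gamma_prod_even a : gamma_prod (2 * a.+2%:R) a.+2 <= 14 ^+ a.+2.
Proof.
elim: a => [|a ih].
  rewrite /gamma_prod !big_ord_recr big_ord0/= [leLHS](_ : _ = 10 / 3); last by field.
  by rewrite !exprS expr0; lra.
have a2 : 2 <= a.+2%:R :> R by rewrite ler_nat.
have -> : 2 * a.+3%:R = 2 * a.+2%:R + 2 :> R by rewrite -[a.+3%:R]natr1; ring.
apply: le_trans (gamma_prod_step _ _) _; [lra|by left|].
by rewrite exprS ler_wpM2l.
Qed.

Lemma gamma_prod_odd a : gamma_prod (2 * a.+2%:R - 1) a.+2 <= 14 ^+ a.+2.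
Proof.
elim: a => [|[|a] ih].
- rewrite /gamma_prod !big_ord_recr big_ord0/= [leLHS](_ : _ = 8 / 5); last by field.
  by rewrite !exprS expr0; lra.
(* k = 5 is a second base case, because the step from k = 3 is not covered by [gamma_prod_step]. *)
- rewrite /gamma_prod !big_ord_recr big_ord0/= [leLHS](_ : _ = 320 / 21); last by field.
  by rewrite !exprS expr0; lra.
have a2 : 3 <= a.+3%:R :> R by rewrite ler_nat.
have -> : 2 * a.+4%:R - 1 = (2 * a.+3%:R - 1) + 2 :> R by rewrite -[a.+4%:R]natr1; ring.
apply: le_trans (gamma_prod_step _ _) _; [lra|right; split=> //; lra|].
by rewrite exprS ler_wpM2l.
Qed.

Lemma gamma_prod_le k : (3 <= k)%N -> gamma_prod k%:R (uphalf k) <= 14 ^+ uphalf k.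
Proof.
move=> k3; have := odd_double_half k; have [ko|ke] := boolP (odd k).
  have -> : uphalf k = (k./2).+1 by rewrite uphalf_half ko.
  case: (k./2) => [|b] kE; first by move: k3; rewrite -kE.
  have -> : k%:R = 2 * b.+2%:R - 1 :> R.
    by rewrite -kE natrD -mul2n natrM -[b.+2%:R]natr1 /=; ring.
  exact: gamma_prod_odd.
have -> : uphalf k = k./2 by rewrite uphalf_half (negbTE ke).
case: (k./2) => [|[|b]] kE; [by move: k3; rewrite -kE|by move: k3; rewrite -kE|].
have -> : k%:R = 2 * b.+2%:R :> R by rewrite -kE natrD -mul2n natrM add0r.
exact: gamma_prod_even.
Qed.

(** The product of the (F2 + 2 j s2) / k is bounded by the power of their arithmetic mean F2/k + (a
    - 1) s2/k, and 2a <= k + 1 gives (a - 1)/k <= 1/2. *)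
Lemma moment_constant_le k (F2 s2 : R) : (3 <= k)%N -> 0 <= F2 -> 0 <= s2 ->
  \prod_(j < uphalf k) ((k%:R - 1 + 2 * j%:R) * (F2 + 2 * j%:R * s2) /
     ((2 * j%:R + 1) * (k%:R + 2 - 2 * j%:R))) <=
  (14 * (F2 / k%:R + s2 / 2)) ^+ uphalf k.
Proof.
move=> k3 F20 s20; have k0 : 3 <= k%:R :> R by rewrite ler_nat.
set a := uphalf k.
have a0 : (0 < a)%N by rewrite /a uphalf_gt0; case: (k) k3.
have ak : 2 * a%:R <= k%:R + 1 :> R.
  rewrite natr1 -natrM ler_nat mul2n /a uphalf_half doubleD.
  rewrite -[X in (_ <= X.+1)%N](odd_double_half k).
  by case: (odd k) => /=; rewrite ?add0n ?leqnSn.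
have -> : \prod_(j < a) ((k%:R - 1 + 2 * j%:R) * (F2 + 2 * j%:R * s2) /
     ((2 * j%:R + 1) * (k%:R + 2 - 2 * j%:R))) =
    gamma_prod k%:R a * \prod_(j < a) ((F2 + 2 * j%:R * s2) / k%:R).
  rewrite /gamma_prod -big_split/=; apply: eq_bigr => j _.
  have kn : k%:R != 0 :> R by rewrite gt_eqF//; lra.
  by rewrite mulrACA -[X in _ = X * _]mulrA; move: (_^-1) => i1; field.
rewrite exprMn ler_pM ?gamma_prod_le//.
- apply: prodr_ge0 => j _; have j0 : 0 <= j%:R :> R := ler0n _ _.
  have ja : j%:R + 1 <= a%:R :> R by rewrite natr1 ler_nat.
  by rewrite divr_ge0// mulr_ge0//; lra.
- apply: prodr_ge0 => j _; have j0 : 0 <= j%:R :> R := ler0n _ _.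
  by rewrite divr_ge0// addr_ge0// !mulr_ge0.
have [] := (@leif_AGM R 'I_a predT (fun j => (F2 + 2 * j%:R * s2) / k%:R) _).
  move=> j _; have j0 : 0 <= j%:R :> R := ler0n _ _.
  by rewrite divr_ge0// addr_ge0// !mulr_ge0.
move=> + _; rewrite card_ord => /le_trans; apply.
have an : a%:R != 0 :> R by rewrite pnatr_eq0 -lt0n.
have kn : k%:R != 0 :> R by rewrite gt_eqF//; lra.
rewrite lerXn2r ?nnegrE//.
- apply: divr_ge0 => //; apply: sumr_ge0 => j _; have j0 : 0 <= j%:R :> R := ler0n _ _.
  by rewrite divr_ge0// addr_ge0// !mulr_ge0.
- by rewrite addr_ge0// divr_ge0.
have -> : \sum_(j in predT) (F2 + 2 * (j : 'I_a)%:R * s2) / k%:R =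
    a%:R * (F2 / k%:R) + a%:R * (a%:R - 1) * (s2 / k%:R).
  have sj b : \sum_(j < b) (2 * j%:R) = b%:R * (b%:R - 1) :> R.
    elim: b => [|b ihb]; first by rewrite big_ord0 mul0r.
    by rewrite big_ord_recr/= ihb -[b.+1%:R]natr1; ring.
  rewrite -sj mulr_suml -[a in a%:R * (F2 / _)]card_ord mulr_natl -sumr_const -big_split/=.
  by apply: eq_bigr => j _; ring.
have -> : (a%:R * (F2 / k%:R) + a%:R * (a%:R - 1) * (s2 / k%:R)) / a%:R =
   F2 / k%:R + (a%:R - 1) * (s2 / k%:R) by field; rewrite kn an.
rewrite lerD2l mulrA ler_pdivrMr; last by lra.
have := ler_wpM2r s20 ak; lra.
Qed.

End MomentConstant.

(** * From moments to tail and expectation *)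

Section Root.
Context {R : realType}.
Implicit Types x y z c : R.

Lemma exp_root n x : (0 < n)%N -> 0 <= x -> (x `^ n%:R^-1) ^+ n = x.
Proof.
move=> n0 x0; rewrite -powR_mulrn ?powR_ge0// -powRrM mulVf ?powRr1//.
by rewrite pnatr_eq0 -lt0n.
Qed.

Lemma root_exp n x : (0 < n)%N -> 0 <= x -> (x ^+ n) `^ n%:R^-1 = x.
Proof.
move=> n0 x0; rewrite -powR_mulrn// -powRrM mulfV ?powRr1//.
by rewrite pnatr_eq0 -lt0n.
Qed.

Lemma ler_root n x y : 0 <= x -> x <= y -> x `^ n%:R^-1 <= y `^ n%:R^-1.
Proof.
move=> x0 xy; apply: ge0_ler_powR => //; rewrite ?nnegrE//.
exact: le_trans xy.
Qed.

Lemma root_le n x z : (0 < n)%N -> 0 <= z -> x <= z ^+ n -> 0 <= x -> x `^ n%:R^-1 <= z.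
Proof. by move=> n0 z0 xz x0; rewrite -[leRHS](root_exp n0 z0) ler_root. Qed.

Lemma le_root n x z : (0 < n)%N -> 0 <= x -> z ^+ n <= x -> z <= x `^ n%:R^-1.
Proof.
move=> n0 x0 zx; have [z0|/ltW z0] := leP z 0; first exact: le_trans (powR_ge0 _ _).
by rewrite -[leLHS](root_exp n0 z0) ler_root// exprn_ge0.
Qed.

Lemma le_root_addgt0 n c z : (0 < n)%N -> 0 <= c ->
  (forall e, 0 < e -> z <= (c + e) `^ n%:R^-1) -> z <= c `^ n%:R^-1.
Proof.
move=> n0 c0 zc; have [z0|/ltW z0] := leP z 0; first exact: le_trans (powR_ge0 _ _).
apply: le_root => //; apply/ler_addgt0Pr => e e0.
have ce0 : 0 <= c + e by rewrite addr_ge0// ltW.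
by rewrite -(exp_root n0 ce0) lerXn2r ?nnegrE ?powR_ge0// zc.
Qed.

End Root.

Lemma measurable_superlevel d (T : measurableType d) (R : realType) (f : T -> R) (y : R) :
  measurable_fun setT f -> measurable [set w | y < f w].
Proof.
move=> mf; have := mf measurableT `]y, +oo[%classic (measurable_itv _).
by rewrite setTI; congr measurable; apply/seteqP; split=> w /=; rewrite in_itv/= andbT.
Qed.

Section Majorant.
Context {d : measure_display} {T : measurableType d} {R : realType}.
Variables (P : probability T R) (err : T -> R) (M s K C : R) (a q : nat).

(* psi stands for S^(2a) and rho for the cost of the regularization. *)
Definition root_majorized := forall eta, 0 < eta -> exists psi rho : T -> R,
  [/\ (measurable_fun setT psi /\ measurable_fun setT rho),
      ((forall w, 0 <= psi w) /\ (forall w, 0 <= rho w)),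
      (forall w dl, 0 < dl -> err w <= M +
        (s + psi w `^ (2 * a)%:R^-1 + rho w + dl) `^ q.+1%:R^-1),
      (\int[P]_w (psi w)%:E <= (K ^+ a)%:E)%E &
      (\int[P]_w (rho w)%:E <= (eta * C)%:E)%E].

Hypotheses (majE : root_majorized) (merr : measurable_fun setT err).
Hypotheses (a_gt0 : (0 < a)%N) (s_ge0 : 0 <= s) (K_ge0 : 0 <= K) (C_ge0 : 0 <= C) (M_ge0 : 0 <= M).

Lemma exists_gt0_mul_le e : 0 < e -> exists2 eta, 0 < eta & eta * C <= e.
Proof.
move=> e0; have C1 : 0 < C + 1 by rewrite ltr_wpDl.
exists (e / (C + 1)); first by rewrite divr_gt0.
by rewrite -mulrA ler_piMr ?(ltW e0)// mulrC ler_pdivrMr// mul1r; lra.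
Qed.

Lemma integral_lincomb (f g : T -> R) (x y : R) :
  measurable_fun setT f -> measurable_fun setT g ->
  (forall w, 0 <= f w) -> (forall w, 0 <= g w) -> 0 <= x -> 0 <= y ->
  (\int[P]_w (x * f w + y * g w)%:E = x%:E * \int[P]_w (f w)%:E + y%:E * \int[P]_w (g w)%:E)%E.
Proof.
move=> mf mg f0 g0 x0 y0.
under eq_integral do rewrite EFinD !EFinM.
rewrite ge0_integralD//=.
- rewrite !ge0_integralZl//; do ?[exact/measurable_EFinP|by move=> w _; rewrite lee_fin].
- by move=> w _; rewrite -EFinM lee_fin mulr_ge0.
- by apply/measurable_EFinP; exact: measurable_funM.
- by move=> w _; rewrite -EFinM lee_fin mulr_ge0.
- by apply/measurable_EFinP; exact: measurable_funM.
Qed.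

(** On the event either [psi] or [rho] is large. Markov's inequality for [psi] yields 36^(-a), and
    for [rho] a term that vanishes with eta. *)
Lemma tail_event_le t dl : s <= t -> 36 * K <= (t - s) ^+ 2 -> 0 < dl ->
  (P [set w | M + (t + dl) `^ q.+1%:R^-1 < err w]%R <= (36 ^- a)%:E)%E.
Proof.
move=> st Kt dl0; set E := [set w | _].
have mE : measurable E by exact: measurable_superlevel.
apply/lee_addgt0Pr => e e0.
have [eta eta0 etaC] := exists_gt0_mul_le (mulr_gt0 e0 (divr_gt0 dl0 (ltr0n _ 3))).
have [psi [rho [[mp mr] [p0 r0] err_le ip ir]]] := majE eta0.
(* The margin [dl] is shared in thirds by the root of [psi], [rho] and the slack in the pointwise
   bound. *)
pose u := t - s + dl / 3.
have u0 : 0 < u by rewrite /u ltr_wpDl ?subr_ge0// divr_gt0.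
have u2a0 : 0 < u ^+ (2 * a) by rewrite exprn_gt0.
(* Union bound and Markov's inequality in one pointwise estimate of the indicator function. *)
have ple w : E w -> 1 <= (u ^+ (2 * a))^-1 * psi w + (3 / dl) * rho w.
  move=> Ew; have d3 : 0 < dl / 3 by rewrite divr_gt0.
  have x0 : 0 <= (u ^+ (2 * a))^-1 * psi w by rewrite mulr_ge0// invr_ge0 ltW.
  have y0 : 0 <= 3 / dl * rho w by rewrite mulr_ge0// divr_ge0// ltW.
  have [rl|rl] := leP (dl / 3) (rho w).
    have : 1 <= 3 / dl * rho w; last by lra.
    by rewrite mulrAC ler_pdivlMr// mul1r; lra.
  have [pl|pl] := leP (u ^+ (2 * a)) (psi w).
    have : 1 <= (u ^+ (2 * a))^-1 * psi w; last by lra.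
    by rewrite mulrC ler_pdivlMr// mul1r.
  exfalso; have := err_le w _ d3; apply/negP; rewrite -ltNge.
  apply: le_lt_trans Ew; rewrite lerD2l; apply: ler_root.
    by rewrite !addr_ge0 ?powR_ge0 ?(ltW d3).
  have : psi w `^ (2 * a)%:R^-1 <= u.
    by apply: root_le => //; [rewrite muln_gt0|exact: ltW|exact: ltW].
  by rewrite /u; lra.
have -> : P E = (\int[P]_w (\1_E w)%:E)%E by rewrite integral_indic// setIT.
apply: (@le_trans _ _ (\int[P]_w ((u ^+ (2 * a))^-1 * psi w + (3 / dl) * rho w)%:E)%E).
  apply: ge0_le_integral => //.
  - by apply/measurable_EFinP; exact: measurable_indic.
  - apply/measurable_EFinP; apply: measurable_funD; exact: measurable_funM.
  move=> w _; rewrite lee_fin indicE; have [/set_mem wE|_] := boolP (w \in E).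
    exact: ple.
  by rewrite addr_ge0// mulr_ge0// ?invr_ge0 ?divr_ge0// ltW.
rewrite integral_lincomb//; last 2 first.
- by rewrite invr_ge0 ltW.
- by rewrite divr_ge0// ltW.
apply: leeD.
- apply: le_trans (lee_wpmul2l _ ip) _; first by rewrite lee_fin invr_ge0 ltW.
  rewrite -EFinM lee_fin mulrC ler_pdivrMr// exprM -exprVn -exprMn.
  have u2 : 0 <= 36^-1 * u ^+ 2 by rewrite mulr_ge0 ?sqr_ge0.
  apply: lerXn2r; rewrite ?nnegrE//.
  have : (t - s) ^+ 2 <= u ^+ 2.
    rewrite lerXn2r// ?nnegrE ?subr_ge0// ?(ltW u0)// /u.
    by rewrite lerDl ltW// divr_gt0.
  by move=> tu; lra.
- apply: le_trans (lee_wpmul2l _ ir) _; first by rewrite lee_fin divr_ge0// ltW.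
  rewrite -EFinM lee_fin mulrAC ler_pdivrMr//; lra.
Qed.

(** The strict event is the increasing union of those with margin 1/(j + 1), so the bound survives
    the limit without any loss. *)
Lemma tail_probability_le t : s <= t -> 36 * K <= (t - s) ^+ 2 ->
  (P [set w | M + t `^ q.+1%:R^-1 < err w]%R <= (36 ^- a)%:E)%E.
Proof.
move=> st Kt; have t0 : 0 <= t by exact: le_trans st.
pose F j := [set w | M + (t + j.+1%:R^-1) `^ q.+1%:R^-1 < err w].
have j0 j : 0 < j.+1%:R^-1 :> R by rewrite invr_gt0.
have mF j : measurable (F j) by exact: measurable_superlevel.
have FE : [set w | M + t `^ q.+1%:R^-1 < err w] = \bigcup_j F j.
  apply/seteqP; split=> w /=.
    rewrite -ltrBrDl => tw; have w0 : 0 <= err w - M by apply: le_trans (ltW tw); exact: powR_ge0.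
    have : 0 < (err w - M) ^+ q.+1 - t.
      rewrite subr_gt0 ltNge; apply/negP => /le_root => /(_ isT t0).
      by rewrite leNgt tw.
    move=> /ltr_add_invr[j jw]; exists j => //; rewrite /F /= -ltrBrDl ltNge; apply/negP => le.
    have tj : 0 <= t + j.+1%:R^-1 by rewrite addr_ge0// ltW.
    have : (err w - M) ^+ q.+1 <= t + j.+1%:R^-1.
      by rewrite -(exp_root (ltn0Sn q) tj) lerXn2r ?nnegrE ?powR_ge0.
    by rewrite leNgt -ltrBrDl; move: jw; rewrite add0r => ->.
  move=> [j _ /=]; apply: le_lt_trans; rewrite lerD2l ler_root// lerDl ltW//.
have ndF : nondecreasing_seq F.
  move=> i j ij; apply/subsetPset => w /=; apply: le_lt_trans.
  rewrite lerD2l ler_root//; first by rewrite addr_ge0// ltW.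
  by rewrite lerD2l lef_pV2 ?posrE// ler_nat ltnS.
rewrite FE; have mU : measurable (\bigcup_j F j) by exact: bigcup_measurable.
have := nondecreasing_cvg_mu (mu := P) mF mU ndF.
move=> cv; rewrite -(cvg_lim _ cv)//; apply: lime_le; first by apply/cvg_ex; eexists; exact: cv.
by apply: nearW => j /=; exact: tail_event_le.
Qed.

(** Two tangent lines, to x^(q+1) and to z^(2a), bound [err] by an affine function of [psi] and
    [rho]; its mean is then known from the first moments of these two. *)
Lemma integral_root_le c : (forall w, 0 <= err w) -> 0 <= c -> K <= c ^+ 2 ->
  (\int[P]_w (err w)%:E <= (M + (s + c) `^ q.+1%:R^-1)%:E)%E.
Proof.
move=> err0 c0 Kc.
have main dl : 0 < dl ->
    (\int[P]_w (err w)%:E <= (M + (s + c + 3 * dl) `^ q.+1%:R^-1)%:E)%E.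
  move=> dl0; have [eta eta0 etaC] := exists_gt0_mul_le dl0.
  have [psi [rho [[mp mr] [p0 r0] err_le ip ir]]] := majE eta0.
  (* The point of tangency has to be positive for the slope to be nonzero even when c = 0. The other
     two copies of [dl] in [S] pay for the mean of [rho] and for the pointwise slack. *)
  pose c1 := c + dl; have c10 : 0 < c1 by rewrite /c1 ltr_wpDl.
  pose S := s + c + 3 * dl; have S0 : 0 < S by rewrite /S ltr_wpDl ?addr_ge0// mulr_gt0.
  pose y := S `^ q.+1%:R^-1; have y0 : 0 < y by rewrite powR_gt0.
  have yS : y ^+ q.+1 = S by rewrite exp_root// ltW.
  pose b := (2 * a).-1; have bE : (2 * a)%N = b.+1 by rewrite /b prednK// muln_gt0.
  pose D1 := q.+1%:R * y ^+ q; have D10 : 0 < D1 by rewrite mulr_gt0// exprn_gt0.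
  pose D2 := b.+1%:R * c1 ^+ b; have D20 : 0 < D2 by rewrite mulr_gt0// exprn_gt0.
  (* The negative constant of the affine bound, moved to the left so that all integrands are
     nonnegative. *)
  pose kap := (c1 ^+ b.+1 / D2 + dl) / D1.
  have kap0 : 0 <= kap by rewrite divr_ge0 ?addr_ge0 ?divr_ge0 ?exprn_ge0// ltW.
  have lin w : err w + kap <= M + y + ((D2 * D1)^-1 * psi w + D1^-1 * rho w).
    have [z z0 zE] : exists2 z, 0 <= z & z = psi w `^ (2 * a)%:R^-1.
      by exists (psi w `^ (2 * a)%:R^-1) => //; exact: powR_ge0.
    have zp : z ^+ b.+1 = psi w by rewrite zE bE exp_root.
    have := err_le w _ dl0; rewrite -zE; set W := s + z + rho w + dl.
    have W0 : 0 <= W by rewrite !addr_ge0// ltW.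
    set x := _ `^ _ => ex.
    have x0 : 0 <= x by exact: powR_ge0.
    have xW : x ^+ q.+1 = W by rewrite exp_root.
    have := power_tangent q x0 (ltW y0); rewrite xW yS -/D1 => t1.
    have := power_tangent b z0 (ltW c10); rewrite zp -/D2 => t2.
    have zle : z <= c1 + (psi w - c1 ^+ b.+1) / D2.
      by rewrite -lerBlDl ler_pdivlMr//; rewrite mulrC; lra.
    have xle : x <= y + (W - S) / D1.
      by rewrite -lerBlDl ler_pdivlMr//; rewrite mulrC; lra.
    have : (W - S) / D1 <= (psi w / D2 - c1 ^+ b.+1 / D2 + rho w - dl) / D1.
      rewrite ler_pM2r ?invr_gt0// /W /S; rewrite mulrBl /c1 in zle *; lra.
    have -> : M + y + ((D2 * D1)^-1 * psi w + D1^-1 * rho w) =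
      M + y + (psi w / D2 - c1 ^+ b.+1 / D2 + rho w - dl) / D1 + kap.
      by rewrite /kap; field; rewrite !gt_eqF.
    by move=> h; lra.
  have ilin : (\int[P]_w (err w + kap)%:E <= (M + y + kap)%:E)%E.
    apply: (@le_trans _ _ (\int[P]_w (M + y + ((D2 * D1)^-1 * psi w + D1^-1 * rho w))%:E)%E).
      apply: ge0_le_integral => //.
      - by move=> w _; rewrite lee_fin addr_ge0.
      - by apply/measurable_EFinP; exact: measurable_funD.
      - apply/measurable_EFinP; apply: measurable_funD => //.
        by apply: measurable_funD; exact: measurable_funM.
      - by move=> w _; rewrite lee_fin.
    have lc0 w : 0 <= (D2 * D1)^-1 * psi w + D1^-1 * rho w.
      by apply: addr_ge0; apply: mulr_ge0 => //; rewrite invr_ge0 ltW// mulr_gt0.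
    under eq_integral do rewrite EFinD.
    rewrite ge0_integralD//=; last 3 first.
    - by move=> w _; rewrite lee_fin addr_ge0// ltW.
    - by move=> w _; rewrite lee_fin.
    - apply/measurable_EFinP; apply: measurable_funD; exact: measurable_funM.
    rewrite integral_cst// [X in (_ * X)%E](@probability_setT _ _ _ P) mule1.
    rewrite (EFinD (M + y) kap) leeD2lE// integral_lincomb//; last 2 first.
    - by rewrite invr_ge0 ltW// mulr_gt0.
    - by rewrite invr_ge0 ltW.
    have -> : kap = (D2 * D1)^-1 * c1 ^+ b.+1 + D1^-1 * dl.
      by rewrite /kap; field; rewrite !gt_eqF.
    rewrite EFinD; apply: leeD.
    - apply: le_trans (lee_wpmul2l _ ip) _; first by rewrite lee_fin invr_ge0 ltW// mulr_gt0.
      rewrite -EFinM lee_fin ler_wpM2l ?invr_ge0 ?(ltW (mulr_gt0 D20 D10))//.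
      rewrite -bE exprM lerXn2r ?nnegrE ?sqr_ge0//; apply: le_trans Kc _.
      by rewrite lerXn2r ?nnegrE ?(ltW c10)// /c1 lerDl ltW.
    - apply: le_trans (lee_wpmul2l _ ir) _; first by rewrite lee_fin invr_ge0 ltW.
      by rewrite -EFinM lee_fin ler_wpM2l// invr_ge0 ltW.
  move: ilin; under eq_integral do rewrite EFinD.
  rewrite ge0_integralD//=; last 2 first.
  - by move=> w _; rewrite lee_fin.
  - exact/measurable_EFinP.
  rewrite integral_cst// [X in (_ + _ * X)%E](@probability_setT _ _ _ P) mule1.
  by rewrite [X in (_ <= X)%E]EFinD leeD2rE.
(* Finiteness of the mean turns the limit of small [dl] into a statement about real numbers. *)
have fin : (\int[P]_w (err w)%:E)%E \is a fin_num.
  rewrite ge0_fin_numE; last by apply: integral_ge0 => w _; rewrite lee_fin.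
  by apply: le_lt_trans (main _ ltr01) _; rewrite ltry.
rewrite -(fineK fin) lee_fin -lerBlDl; apply: le_root_addgt0 => //; first exact: addr_ge0.
move=> e e0; have := main _ (divr_gt0 e0 (ltr0n R 3)).
by rewrite -{1}(fineK fin) lee_fin -lerBlDl mulrC divfK.
Qed.

End Majorant.

(** * Assembly of the spectral and probabilistic estimates *)

Section CoreEstimate.
Context {d : measure_display} {T : measurableType d} {R : realType}.

Lemma sum_rank_split r m (F : nat -> R) :
  \sum_(r.+1 <= j < (r + m).+1) F j = \sum_(i < m) F (r + i).+1.
Proof.
rewrite big_add1 /= -{1}[r]add0n big_addn addKn big_mkord.
by apply: eq_bigr => i _; rewrite addnC.
Qed.

(** In the eigenbasis of A_mu A^q the stable rank is the sum of the b_i^2 over i >= k divided by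
    s^2. The dimension is written r + m from the start, so that the splitting of columns needs no
    casts. *)
Lemma residual_root_majorized (P : probability T R) r m k l q (A : 'M[R]_(r + m)) (mu : R)
    (X : 'I_l -> 'I_(r + m) -> {RV P >-> R}) :
  A^T = A -> k = r.+1 -> l = (2 * k + 2)%N -> (3 <= k)%N -> (0 < m)%N -> (0 < q)%N ->
  gaussian_matrix X ->
  let A_mu := A + mu%:M in
  let err w := spectral_norm ((1%:M -
    orthoproj (A_mu *m (A ^+ q *m (random_matrix X w)^T))) *m A_mu) in
  exists s f C : R, [/\ (0 <= s /\ 0 <= f) /\ 0 <= C,
    s <= sigma A k ^+ q * (sigma A k + `|mu|),
    s * Num.sqrt (stable_rank k (A_mu ^+ 2 * A ^+ (2 * q)) / k%:R) = f &
    root_majorized P err `|mu| s (14 * (f ^+ 2 + s ^+ 2 / 2)) C (uphalf k) q].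
Proof.
move=> symA kE lE k3 m0 q0 [indX lawX] A_mu err.
have [V0 [a0 [VV0 AE0]]] := symmetric_diagonalization symA.
pose fb (x : R) := (x + mu) * x ^+ q.
have [V [p []]] := sorted_diagonalization fb symA VV0 AE0.
set a := \row_i a0 0 (p i) => VV AE as_.
pose b : 'rV[R]_(r + m) := \row_i fb (a 0 i).
have bE i : b 0 i = (a 0 i + mu) * a 0 i ^+ q by rewrite [LHS]mxE.
have bfE i : b 0 i = fb (a 0 i) by exact: bE.
have bs (i j : 'I_(r + m)) : (i <= j)%N -> `|b 0 j| <= `|b 0 i|.
  by move=> ij; rewrite !bfE as_.
have AmuE : A_mu = conj_diag V (\row_i (a 0 i + mu)).
  rewrite /A_mu -(conj_diag_scalar mu VV) {1}AE conj_diagD; congr conj_diag.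
  by apply/rowP => i; rewrite !mxE.
have BE : A_mu *m A ^+ q = conj_diag V b.
  rewrite AmuE {1}AE conj_diagX// conj_diagM//; congr conj_diag.
  by apply/rowP => i; rewrite [LHS]mxE [in LHS]mxE [in X in _ * X]mxE bE.
have B2E : A_mu ^+ 2 * A ^+ (2 * q) = conj_diag V (\row_i (b 0 i ^+ 2)).
  rewrite AmuE {1}AE !conj_diagX// -[_ * _]/(_ *m _) conj_diagM//; congr conj_diag.
  by apply/rowP => i; rewrite !mxE /fb mulnC exprM exprMn.
have VV' := mulmx1C VV.
(* The first index of the tail: 0-based r, hence the k-th entry. *)
pose ik : 'I_(r + m) := rshift r (Ordinal m0).
have ikE : (ik : nat).+1 = k by rewrite /= addn0 kE.
pose s := `|b 0 ik|.
pose F2 := \sum_(i < m) b 0 (rshift r i) ^+ 2.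
have s0 : 0 <= s by exact: normr_ge0.
have F20 : 0 <= F2 by apply: sumr_ge0 => i _; exact: sqr_ge0.
have k0 : 0 < k%:R :> R by rewrite ltr0n; case: (k) k3.
pose f := Num.sqrt (F2 / k%:R).
have bsq (i j : 'I_(r + m)) : (i <= j)%N -> `|(\row_i (b 0 i ^+ 2) : 'rV[R]_(r + m)) 0 j| <= `|(\row_i (b 0 i ^+ 2) : 'rV[R]_(r + m)) 0 i|.
  by move=> ij; rewrite [X in `|X| <= _]mxE [X in _ <= `|X|]mxE !normrX lerXn2r ?nnegrE ?bs.
have srE : stable_rank k (A_mu ^+ 2 * A ^+ (2 * q)) = F2 / s ^+ 2.
  rewrite /stable_rank B2E -ikE sigma_conj_diag// [in X in _ / X]mxE normrX -/s; congr (_ / _).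
  rewrite /= addn0 sum_rank_split; apply: eq_bigr => i _.
  by rewrite (_ : (r + i)%N = rshift r i)// sigma_conj_diag// mxE ger0_norm// sqr_ge0.
have tail_le c : `|b 0 (rshift r c)| <= s by apply: bs; rewrite /= leq_add2l.
have sle : s <= sigma A k ^+ q * (sigma A k + `|mu|).
  rewrite -ikE /s bE; apply: (@sigma_shifted_power_le _ _ V A a mu q ik symA VV AE) => i j.
  exact: as_.
have fE : s * Num.sqrt (stable_rank k (A_mu ^+ 2 * A ^+ (2 * q)) / k%:R) = f.
  rewrite srE; have [s00|sn0] := eqVneq s 0.
    (* If s = 0 the whole tail of b vanishes, so division by zero yielding 0 is harmless here. *)
    have F00 : F2 = 0.
      rewrite /F2 big1// => c _; have := tail_le c; rewrite s00 normr_le0 => /eqP ->.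
      by rewrite expr0n.
    by rewrite /f F00 !mul0r sqrtr0 mulr0.
  rewrite -{1}(ger0_norm s0) -sqrtr_sqr -sqrtrM ?sqr_ge0//; congr Num.sqrt.
  by field; rewrite sn0 gt_eqF.
have l0 : (0 < l)%N by rewrite lE addnS.
have linv0 : 0 < l%:R^-1 :> R by rewrite invr_gt0 ltr0n.
have sq0 : Num.sqrt l%:R^-1 != 0 :> R by rewrite gt_eqF// sqrtr_gt0.
have := gaussian_stein indX lawX sq0; rewrite sqr_sqrtr ?(ltW linv0)// => sX.
pose Y w := random_matrix X w *m V.
have sY : stein_matrix P l%:R^-1 Y := stein_mulmxr sX VV.
(* The auxiliary Gaussian vector z is the start of a row of Y, read at a second sample point;
   independence comes from the product measure, and the probability space need not be enlarged. *)
pose V1 : 'M[R]_(r + m, r) := col_mx 1%:M 0.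
have VV1 : V1^T *m V1 = 1%:M.
  by rewrite /V1 tr_col_mx mul_row_col trmx1 trmx0 mul0mx mul1mx addr0.
have sZ : stein_matrix P l%:R^-1 (fun w => Y w *m V1) := stein_mulmxr sY VV1.
pose i0 : 'I_l := Ordinal l0.
have lr : l%:R - r%:R - 1 = k%:R + 2 :> R.
  by rewrite lE kE natrD natrM -[r.+1%:R]natr1; ring.
have ka (j : 'I_(uphalf k)) : 0 < l%:R - r%:R - 1 - 2 * j%:R :> R.
  rewrite lr subr_gt0 -natrM -natrD ltr_nat.
  have := ltn_ord j; rewrite geq_uphalf_double doubleS -mul2n ltnS => h.
  by apply: (leq_trans h); rewrite leq_addr.
have a_gt0 : (0 < uphalf k)%N by rewrite uphalf_gt0; case: (k) k3.
pose Bsum := \sum_i b 0 i ^+ 2.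
have Bsum0 : 0 <= Bsum by apply: sumr_ge0 => i _; exact: sqr_ge0.
pose C := 1 + Bsum * (r%:R / (l%:R^-1 * (l%:R - r%:R - 1))).
have C0 : 0 <= C.
  rewrite addr_ge0// mulr_ge0// divr_ge0// mulr_ge0 ?(ltW linv0)// lr; lra.
exists s, f, C; split=> //; first by rewrite sqrtr_ge0.
(* The regularization costs a multiple of sqrt(eps), hence the square. *)
move=> eta eta0; pose eps := eta ^+ 2; have eps0 : 0 < eps by rewrite exprn_gt0.
pose bt c := b 0 (rshift r c).
have bt_le c : bt c ^+ 2 <= s ^+ 2.
  by rewrite -[bt c ^+ 2]real_normK ?num_real// lerXn2r ?nnegrE// tail_le.
pose psi := psi P l%:R^-1 eps Y (fun w => Y w *m V1) i0 bt (uphalf k).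
(* The cost contains the square root of t = tr R * |b|^2; sqrt(t) <= 1 + t makes it linear in the
   trace, whose mean is known. *)
pose rho w := eta * (1 + \tr (rsv eps (Y w)) * Bsum).
have tr0 w : 0 <= \tr (rsv eps (Y w)) by exact: rsv_trace_ge0.
have [mY _ _] := sY.
have mtr : measurable_fun setT (fun w => \tr (rsv eps (Y w))).
  apply: measurable_sum => i.
  exact: (proj1 (@tame_rsv R l r m eps eps0 i i) _ _ _ mY).
have psi_ge0w w : 0 <= psi w by exact: psi_ge0.
exists psi, rho; split.
- split; first exact: measurable_psi.
  apply: measurable_funM; first exact: measurable_cst.
  apply: measurable_funD; first exact: measurable_cst.
  by apply: measurable_funM => //; exact: measurable_cst.
- split=> // w; rewrite mulr_ge0 ?(ltW eta0)// addr_ge0// mulr_ge0//.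
- move=> w dl dl0; set tau := s + _ + _ + dl.
  have rho0 : 0 <= rho w by rewrite mulr_ge0 ?(ltW eta0)// addr_ge0// mulr_ge0.
  have tau0 : 0 < tau by rewrite /tau ltr_wpDl// !addr_ge0// powR_ge0.
  apply: residual_le.
  + by rewrite AmuE conj_diagT.
  + by rewrite addr_ge0// powR_ge0.
  move=> u.
  have -> : (A_mu *m (A ^+ q *m (random_matrix X w)^T))^T = random_matrix X w *m conj_diag V b.
    by rewrite mulmxA BE trmx_mul trmxK conj_diagT.
  rewrite {1}/conj_diag -!mulmxA (mulmxA (random_matrix X w)) -/(Y w) => Yu.
  rewrite AmuE; apply: shifted_power_le => //.
  have -> : conj_diag V (\row_i ((a 0 i + mu) * a 0 i ^+ q)) = conj_diag V b.
    by congr conj_diag; apply/rowP => i; rewrite [LHS]mxE bE.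
  rewrite /conj_diag -!mulmxA enorm_orth//.
  have dE : diag_mx b *m (V^T *m u) = \col_i (b 0 i * (V^T *m u) i 0).
    by apply/colP => i; rewrite mul_diag_mx mxE [RHS]mxE.
  rewrite dE in Yu *.
  have cu : enorm (V^T *m u) = enorm u by rewrite enorm_orth// trmxK.
  have := kernel_image_le (b := fun i => b 0 i) eps0 a_gt0 (psi_ge0w w) s0 tail_le _ Yu.
  rewrite cu => /(_ (sqn_pvec_le eps Y i0 bt (uphalf k) sZ linv0 w)) => /le_trans; apply.
  rewrite ler_wpM2r ?enorm_ge0// /tau -!addrA lerD2l lerD2l.
  apply: (@le_trans _ _ (rho w)); last by rewrite lerDl ltW.
  rewrite -/Bsum; set t := \tr _ * _.
  have t0 : 0 <= t by rewrite mulr_ge0// ?tr0.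
  rewrite sqrtrM ?(ltW eps0)// sqrtr_sqr ger0_norm ?(ltW eta0)// /rho ler_wpM2l ?(ltW eta0)//.
  rewrite -/t -(@ler_pXn2r _ 2)// ?nnegrE ?sqrtr_ge0 ?addr_ge0//.
  by rewrite sqr_sqrtr// sqrrD expr1n; have := sqr_ge0 t; lra.
- have := integral_psi_le i0 sY sZ eps0 linv0 (sqr_ge0 s) bt_le ka.
  move=> /le_trans; apply; rewrite lee_fin.
  have := moment_constant_le k3 F20 (sqr_ge0 s).
  rewrite (_ : f ^+ 2 = F2 / k%:R); last by rewrite sqr_sqrtr// divr_ge0// ltW.
  apply: le_trans; rewrite le_eqVlt; apply/orP; left; apply/eqP.
  have -> : k%:R - 1 = r%:R :> R by rewrite kE -[r.+1%:R]natr1 addrK.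
  by apply: eq_bigr => j _; rewrite lr.
- rewrite /rho; under eq_integral do rewrite EFinM EFinD EFinM.
  rewrite ge0_integralZl//=; last 3 first.
  + apply/measurable_EFinP; apply: measurable_funD; first exact: measurable_cst.
    by apply: measurable_funM => //; exact: measurable_cst.
  + by move=> w _; rewrite -EFinM -EFinD lee_fin addr_ge0// mulr_ge0.
  + by rewrite lee_fin ltW.
  rewrite EFinM lee_wpmul2l ?lee_fin ?(ltW eta0)//.
  rewrite ge0_integralD//=; last 2 first.
  + by move=> w _; rewrite -EFinM lee_fin mulr_ge0.
  + by apply/measurable_EFinP; apply: measurable_funM => //; exact: measurable_cst.
  rewrite integral_cst// mul1e [X in (X + _)%E](@probability_setT _ _ _ P).
  rewrite ge0_integralZr//=; last 2 first.
  + exact/measurable_EFinP.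
  + by move=> w _; rewrite lee_fin.
  rewrite /C EFinD leeD2l// muleC EFinM lee_wpmul2l ?lee_fin//.
  exact: (integral_trace_le sY eps0 linv0 ka a_gt0).
Qed.

End CoreEstimate.

(** Since f = s g, the base of the root is s times the bracket with the constants, and s is at most
    sig^q (sig + M). The coefficient of M is relaxed from 1 to 3. *)
Lemma powR_bound_le (R : realType) (q : nat) (M s f g sig c1 c2 : R) :
  0 <= M -> 0 <= sig -> 0 <= s -> 0 <= g -> 0 <= c1 -> 0 <= c2 -> s * g = f ->
  s <= sig ^+ q * (sig + M) ->
  M + (2 * c1 * s + 2 * c2 * f) `^ q.+1%:R^-1 <=
  3 * M + (2 * c1 + 2 * c2 * g) `^ (1 / q.+1%:R) * sig `^ (q%:R / q.+1%:R) *
    (sig + M) `^ (1 / q.+1%:R).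
Proof.
move=> M0 sig0 s0 g0 c10 c20 <- sle.
have co0 : 0 <= 2 * c1 + 2 * c2 * g by rewrite addr_ge0// !mulr_ge0.
have cs0 : 0 <= (2 * c1 + 2 * c2 * g) * sig ^+ q by rewrite mulr_ge0 ?exprn_ge0.
rewrite div1r powRrM powR_mulrn// -(powRM _ co0 (exprn_ge0 q sig0)).
rewrite -(powRM _ cs0 (addr_ge0 sig0 M0)).
apply: lerD; first by rewrite ler_peMl// ler1n.
apply: ler_root; first by rewrite addr_ge0// !mulr_ge0.
rewrite -[leRHS]mulrA (_ : _ + _ = (2 * c1 + 2 * c2 * g) * s); last by ring.
by rewrite ler_wpM2l.
Qed.

Unset Implicit Arguments.

Theorem theorem2p2 (R : realType) (n : nat) (A : 'M[R]_n) (mu : R)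
    (k l q : nat) (d : measure_display) (T : measurableType d)
    (P : probability T R) (X : 'I_l -> 'I_n -> {RV P >-> R})
    (symA : A^T = A) (lE : l = (2 * k + 2)%N) (l_ge8 : (8 <= l)%N)
    (k_le_n : (k <= n)%N) (q_ge1 : (1 <= q)%N) (gaussX : gaussian_matrix X) :
  let A_mu := A + mu%:M in
  let Omega (w : T) := A ^+ q *m (random_matrix X w)^T in
  let Pi (w : T) := orthoproj (A_mu *m Omega w) in
  let err (w : T) := spectral_norm ((1%:M - Pi w) *m A_mu) in
  let bound (C1 C2 : R) :=
    3 * `|mu| +
    (2 * C1 +
     2 * C2 * Num.sqrt (stable_rank k (A_mu ^+ 2 * A ^+ (2 * q)) / k%:R))
      `^ (1 / q.+1%:R)
    * sigma A k `^ (q%:R / q.+1%:R)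
    * (sigma A k + `|mu|) `^ (1 / q.+1%:R) in
  ((1 - 6 ^- k)%:E <=
     P [set w | (err w <= bound 18 (8 * Num.sqrt 2))%R])%E /\
  ('E_P[err] <= (bound 2 (Num.sqrt 2 * expR 1))%:E)%E.
Proof.
have k3 : (3 <= k)%N by move: l_ge8; rewrite lE; case: (k) => [|[|[|]]].
have k0 : (0 < k)%N by exact: leq_trans k3.
(* The k - 1 leading directions form the block U; k <= n leaves a nonempty tail. *)
have nE : n = (k.-1 + (n - k.-1))%N by rewrite subnKC// (leq_trans (leq_pred k)).
have m0 : (0 < n - k.-1)%N by rewrite subn_gt0 prednK.
clear k_le_n; move: (n - k.-1)%N nE m0 => m nE m0; subst n.
move=> A_mu Omega Pi err bound.
have [s [f [C [[[s0 f0] C0] sle gE maj]]]] :=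
  residual_root_majorized mu symA (esym (prednK k0)) lE k3 m0 q_ge1 gaussX.
have merr : measurable_fun setT err.
  apply: measurable_residual => i j; rewrite /Omega.
  under eq_fun do rewrite mxE; apply: measurable_sum => a.
  apply: measurable_funM; first exact: measurable_cst.
  under eq_fun do rewrite mxE; apply: measurable_sum => b.
  apply: measurable_funM; first exact: measurable_cst.
  by under eq_fun do rewrite 2!mxE; exact: measurable_funPT.
have a0 : (0 < uphalf k)%N by rewrite uphalf_gt0.
have K0 : 0 <= 14 * (f ^+ 2 + s ^+ 2 / 2).
  by rewrite mulr_ge0// addr_ge0 ?divr_ge0 ?sqr_ge0.
have sig0 : 0 <= sigma A k.
  have /allP sv := singular_values_ge0 A; rewrite /sigma.
  have [kn|kn] := ltnP k.-1 (size (singular_values A)); first exact/sv/mem_nth.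
  by rewrite nth_default.
have sqrt2 : Num.sqrt 2 ^+ 2 = 2 :> R by rewrite sqr_sqrtr.
have sqrt20 : 0 <= Num.sqrt 2 :> R by exact: sqrtr_ge0.
have e2 : 2 <= expR 1 :> R by apply: le_trans (expR_ge1Dx 1); lra.
have e0 : 0 <= expR 1 :> R by exact: expR_ge0.
have bound_ge c1 c2 : 0 <= c1 -> 0 <= c2 ->
    `|mu| + (2 * c1 * s + 2 * c2 * f) `^ q.+1%:R^-1 <= bound c1 c2.
  by move=> c10 c20; apply: powR_bound_le gE sle => //; exact: sqrtr_ge0.
split.
- set t := 2 * 18 * s + 2 * (8 * Num.sqrt 2) * f.
  have st : s <= t.
    have := mulr_ge0 sqrt20 f0; rewrite /t => ?; lra.
  (* t - s = 35 s + 16 sqrt(2) f, and the squares give 512 >= 504 for f^2 and 1225 >= 252 for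
     s^2. *)
  have Kt : 36 * (14 * (f ^+ 2 + s ^+ 2 / 2)) <= (t - s) ^+ 2.
    have -> : (t - s) ^+ 2 = 1225 * s ^+ 2 + 1120 * (s * (Num.sqrt 2 * f)) +
      256 * (Num.sqrt 2 ^+ 2 * f ^+ 2) by rewrite /t; ring.
    have := mulr_ge0 s0 (mulr_ge0 sqrt20 f0); have := sqr_ge0 s; have := sqr_ge0 f.
    by rewrite sqrt2; lra.
  have tail := tail_probability_le maj merr a0 s0 K0 C0 st Kt.
  set E := [set w | _]; have -> : E = ~` [set w | bound 18 (8 * Num.sqrt 2) < err w].
    by apply/seteqP; split=> w /=; rewrite /E /= leNgt => /negP.
  have mS y := measurable_superlevel y merr.
  rewrite probability_setC// EFinB; apply: leeB => //.
  (* 36^(-a) <= 6^(-k) because 2 ceil(k/2) >= k. *)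
  apply: (@le_trans _ _ (36 ^- uphalf k)%:E).
    apply: le_trans tail; apply: le_measure; rewrite ?inE//.
    by move=> w /=; apply: le_lt_trans; apply: bound_ge => //; rewrite mulr_ge0.
  rewrite lee_fin lef_pV2 ?posrE ?exprn_gt0//.
  rewrite (_ : 36 = 6 ^+ 2 :> R); last by ring.
  rewrite -exprM ler_weXn2l ?ler1n//.
  by rewrite mul2n -leq_uphalf_double.
- rewrite unlock; set c := 3 * s + 2 * (Num.sqrt 2 * expR 1) * f.
  have h0 : 0 <= Num.sqrt 2 * expR 1 * f :> R by rewrite !mulr_ge0.
  have c0 : 0 <= c by rewrite /c addr_ge0// ?mulr_ge0//; lra.
  (* The coefficient 3 of s is 2 C1 - 1, so that s + c is the target. With e >= 2 the squares give 9
     >= 7 for s^2 and 8 e^2 >= 32 >= 14 for f^2. *)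
  have Kc : 14 * (f ^+ 2 + s ^+ 2 / 2) <= c ^+ 2.
    have -> : c ^+ 2 = 9 * s ^+ 2 + 12 * (s * (Num.sqrt 2 * expR 1 * f)) +
      4 * (Num.sqrt 2 ^+ 2 * (expR 1 ^+ 2 * f ^+ 2)) by rewrite /c; ring.
    have e4 : 2 ^+ 2 <= expR 1 ^+ 2 :> R by rewrite lerXn2r ?nnegrE.
    have := ler_wpM2r (sqr_ge0 f) e4.
    have := mulr_ge0 s0 h0; have := sqr_ge0 s; have := sqr_ge0 f.
    rewrite sqrt2; lra.
  have err0 w : 0 <= err w by exact: spectral_norm_ge0.
  apply: le_trans (integral_root_le maj merr a0 s0 K0 C0 (normr_ge0 mu) err0 c0 Kc) _.
  rewrite lee_fin (_ : s + c = 2 * 2 * s + 2 * (Num.sqrt 2 * expR 1) * f); last by rewrite /c; ring.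
  by apply: bound_ge => //; rewrite mulr_ge0.
Qed.
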